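(* Let $F$ be a field of characteristic different from $2$ with $\mathsf{I}^3F=0$. Let $k\in\mathbb{N}$ be such that $u(K)\leq 4k$ for every field extension $K/F$ with $[K:F]\leq 2$. Let $A$ be a central simple $F$-algebra with $\operatorname{ind}A\leq 2$ and $\deg A>4k+2$. Then every orthogonal involution on $A$ is isotropic.
   Context: $\mathsf{I}^3F$ is the third power of the fundamental ideal of the Witt ring of $F$; $u(K)$ is the supremum of dimensions of anisotropic quadratic forms over $K$. An orthogonal involution on $A$ is an $F$-linear anti-automorphism $\sigma$ with $\sigma^2=\mathrm{id}$ which over a splitting field is adjoint to a non-degenerate symmetric bilinear form; $\sigma$ is isotropic if $\sigma(a)a=0$ for some $a\in A\setminus\{0\}$. *)

(* Defs.v *)
From HB Require Import structures.
From mathcomp Require Import all_boot all_order all_algebra all_field.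
From mathcomp Require Import boolp mxtens.

Set Implicit Arguments.
Unset Strict Implicit.
Unset Printing Implicit Defensive.

Import GRing.Theory.
Local Open Scope ring_scope.
Local Open Scope quotient_scope.

(* A nondegenerate symmetric bilinear form on the row vectors 'rV[K]_n,      *)
(* (u, v) |-> u *m M *m v^T, given by its Gram matrix M. In characteristic   *)
(* not 2 these are the same thing as nondegenerate quadratic forms.          *)
Record symform (K : fieldType) := SymForm {
  form_dim : nat;
  gram : 'M[K]_form_dim;
  gram_sym : gram^T = gram;
  gram_unit : gram \in unitmx }.

HB.instance Definition _ (K : fieldType) := gen_eqMixin (symform K).
HB.instance Definition _ (K : fieldType) := gen_choiceMixin (symform K).

(* The two sizes are kept distinct to avoid casts; P *m Q = 1 = Q *m P forces *)
(* them to be equal.                                                          *)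
Definition congruent (K : fieldType) (m n : nat) (M : 'M[K]_m) (N : 'M[K]_n) :=
  exists (P : 'M[K]_(m, n)) (Q : 'M[K]_(n, m)),
    [/\ P *m Q = 1%:M, Q *m P = 1%:M & M = P *m N *m P^T].

Definition dsum_mx (K : fieldType) (m n : nat) (M : 'M[K]_m) (N : 'M[K]_n)
  : 'M[K]_(m + n) := block_mx M 0 0 N.

Definition metabolic_mx (K : fieldType) (n : nat) (D : 'M[K]_n)
  : 'M[K]_(n + n) := block_mx 0 1%:M 1%:M D.

Section MatrixLemmas.
Variable K : fieldType.

Lemma congruent_refl m (M : 'M[K]_m) : congruent M M.
Proof. by exists 1%:M, 1%:M; rewrite !mul1mx trmx1 mulmx1. Qed.

Lemma congruent_sym m n (M : 'M[K]_m) (N : 'M[K]_n) :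
  congruent M N -> congruent N M.
Proof.
move=> [P [Q [PQ QP ->]]]; exists Q, P; split=> //.
by rewrite !mulmxA QP mul1mx -mulmxA -trmx_mul QP trmx1 mulmx1.
Qed.

Lemma congruent_trans m n p (N : 'M[K]_n) (M : 'M[K]_m) (O : 'M[K]_p) :
  congruent M N -> congruent N O -> congruent M O.
Proof.
move=> [P [Q [PQ QP ->]]] [R [S [RS SR ->]]]; exists (P *m R), (S *m Q); split.
- by rewrite mulmxA -(mulmxA P) RS mulmx1.
- by rewrite mulmxA -(mulmxA S) QP mulmx1.
- by rewrite trmx_mul !mulmxA.
Qed.

Lemma congruent_dsum m n m' n' (M : 'M[K]_m) (N : 'M[K]_n)
    (M' : 'M[K]_m') (N' : 'M[K]_n') :
  congruent M M' -> congruent N N' -> congruent (dsum_mx M N) (dsum_mx M' N').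
Proof.
move=> [P [Q [PQ QP ->]]] [R [S [RS SR ->]]].
exists (block_mx P 0 0 R), (block_mx Q 0 0 S); split.
- by rewrite mulmx_block !(mul0mx, mulmx0, addr0, add0r) PQ RS -scalar_mx_block.
- by rewrite mulmx_block !(mul0mx, mulmx0, addr0, add0r) QP SR -scalar_mx_block.
- rewrite tr_block_mx !trmx0 /dsum_mx.
  by rewrite !mulmx_block !(mul0mx, mulmx0, addr0, add0r).
Qed.

Lemma tens1mx1 m n : (1%:M : 'M[K]_m) *t (1%:M : 'M[K]_n) = 1%:M.
Proof.
apply/matrixP=> i j; case: (mxtens_indexP i)=> a b; case: (mxtens_indexP j)=> c d.
rewrite tensmxE !mxE (can_eq (@mxtens_indexK _ _)) xpair_eqE.
by case: eqP; case: eqP; rewrite /= ?(mulr1n, mulr0n, mul1r, mul0r).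
Qed.

Lemma congruent_tens m n m' n' (M : 'M[K]_m) (N : 'M[K]_n)
    (M' : 'M[K]_m') (N' : 'M[K]_n') :
  congruent M M' -> congruent N N' -> congruent (M *t N) (M' *t N').
Proof.
move=> [P [Q [PQ QP ->]]] [R [S [RS SR ->]]].
exists (P *t R), (Q *t S); split.
- by rewrite tensmx_mul PQ RS tens1mx1.
- by rewrite tensmx_mul QP SR tens1mx1.
- by rewrite trmx_tens !tensmx_mul.
Qed.

Lemma congruent_opp m n (M : 'M[K]_m) (N : 'M[K]_n) :
  congruent M N -> congruent (- M) (- N).
Proof.
move=> [P [Q [PQ QP ->]]]; exists P, Q; split=> //.
by rewrite mulmxN mulNmx.
Qed.

Lemma congruent_inj m n (M : 'M[K]_m) (N : 'M[K]_n) (f : 'I_m -> 'I_n) :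
  bijective f -> (forall i j, M i j = N (f i) (f j)) -> congruent M N.
Proof.
move=> [g fK gK] MN.
exists (\matrix_(i, j) (j == f i)%:R), (\matrix_(i, j) (i == f j)%:R); split.
- apply/matrixP=> i j; rewrite !mxE (bigD1 (f i)) //= big1 ?addr0; last first.
    by move=> k /negPf ki; rewrite !mxE ki mul0r.
  by rewrite !mxE eqxx mul1r (can_eq fK).
- apply/matrixP=> i j; rewrite !mxE (bigD1 (g i)) //= big1 ?addr0; last first.
    by move=> k ki; rewrite !mxE -(can_eq gK) fK eq_sym (negPf ki) mul0r.
  by rewrite !mxE gK eqxx mul1r eq_sym.
- apply/matrixP=> i j; rewrite !mxE (bigD1 (f j)) //= big1 ?addr0; last first.
    by move=> k /negPf kj; rewrite !mxE kj mulr0.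
  rewrite !mxE eqxx mulr1 (bigD1 (f i)) //= big1 ?addr0; last first.
    by move=> k /negPf ki; rewrite !mxE ki mul0r.
  by rewrite !mxE eqxx mul1r.
Qed.

Lemma congruent_reindex (T T' : Type) m n (M : 'M[K]_m) (N : 'M[K]_n)
    (h : T -> 'I_m) (h' : T' -> 'I_n) (k : T -> T') :
  bijective h -> bijective h' -> bijective k ->
  (forall t u, M (h t) (h u) = N (h' (k t)) (h' (k u))) -> congruent M N.
Proof.
move=> [g hK gK] bh' bk MN; apply: (@congruent_inj _ _ _ _ (h' \o k \o g)).
  by apply: bij_comp; [exact: bij_comp | exists h].
by move=> i j /=; rewrite -MN !gK.
Qed.

Lemma unsplit_bij m n : bijective (@unsplit m n).
Proof. by exists split; [exact: unsplitK | exact: splitK]. Qed.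

Lemma mxtens_index_bij m n : bijective (@mxtens_index m n).
Proof. by exists (@mxtens_unindex m n); [exact: mxtens_indexK | exact: mxtens_unindexK]. Qed.

Definition sum_fun (A B C D : Type) (f : A -> C) (g : B -> D) (x : A + B) : C + D :=
  match x with inl a => inl (f a) | inr b => inr (g b) end.

Lemma sum_fun_bij A B C D (f : A -> C) (g : B -> D) :
  bijective f -> bijective g -> bijective (sum_fun f g).
Proof.
move=> [f' fK f'K] [g' gK g'K]; exists (sum_fun f' g').
  by case=> x /=; rewrite ?fK ?gK.
by case=> x /=; rewrite ?f'K ?g'K.
Qed.

Definition pair_fun (A B C D : Type) (f : A -> C) (g : B -> D) (x : A * B) : C * D :=
  (f x.1, g x.2).

Lemma pair_fun_bij A B C D (f : A -> C) (g : B -> D) :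
  bijective f -> bijective g -> bijective (pair_fun f g).
Proof.
move=> [f' fK f'K] [g' gK g'K]; exists (pair_fun f' g').
  by case=> x y; rewrite /pair_fun /= fK gK.
by case=> x y; rewrite /pair_fun /= f'K g'K.
Qed.

Lemma id_bij (T : Type) : bijective (@id T).
Proof. by exists id. Qed.

Let blockE := (block_mxEul, block_mxEur, block_mxEdl, block_mxEdr).

Lemma dsumA m n p (M : 'M[K]_m) (N : 'M[K]_n) (O : 'M[K]_p) :
  congruent (dsum_mx M (dsum_mx N O)) (dsum_mx (dsum_mx M N) O).
Proof.
apply: (@congruent_reindex ('I_m + ('I_n + 'I_p)) (('I_m + 'I_n) + 'I_p) _ _ _ _
  (@unsplit _ _ \o sum_fun id (@unsplit _ _))
  (@unsplit _ _ \o sum_fun (@unsplit _ _) id)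
  (fun x => match x with inl a => inl (inl a) | inr (inl b) => inl (inr b)
     | inr (inr c) => inr c end)).
- by apply: bij_comp; [exact: unsplit_bij|apply: sum_fun_bij; [exact: id_bij|exact: unsplit_bij]].
- by apply: bij_comp; [exact: unsplit_bij|apply: sum_fun_bij; [exact: unsplit_bij|exact: id_bij]].
- exists (fun x => match x with inl (inl a) => inl a | inl (inr b) => inr (inl b)
     | inr c => inr (inr c) end); first by case=> [|[]].
  by case=> [[]|].
- by case=> [a|[b|c]] [a'|[b'|c']] /=; rewrite /dsum_mx !blockE // !mxE ?blockE // !mxE.
Qed.

Lemma dsumC m n (M : 'M[K]_m) (N : 'M[K]_n) :
  congruent (dsum_mx M N) (dsum_mx N M).
Proof.
apply: (@congruent_reindex ('I_m + 'I_n) ('I_n + 'I_m) _ _ _ _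
  (@unsplit _ _) (@unsplit _ _)
  (fun x => match x with inl a => inr a | inr a => inl a end)).
- exact: unsplit_bij.
- exact: unsplit_bij.
- by exists (fun x => match x with inl a => inr a | inr a => inl a end); case.
- by case=> [a|a] [b|b] /=; rewrite /dsum_mx !blockE ?mxE.
Qed.

Lemma dsum0 m (M : 'M[K]_m) (N : 'M[K]_0) : congruent (dsum_mx N M) M.
Proof.
apply: (@congruent_inj _ _ _ _ id); first exact: id_bij.
move=> i j; rewrite -(splitK i) -(splitK j).
case: (split i) => [[]//|a]; case: (split j) => [[]//|b] /=.
by rewrite /dsum_mx block_mxEdr; congr (M _ _); apply: val_inj.
Qed.

Lemma tensA m n p (M : 'M[K]_m) (N : 'M[K]_n) (O : 'M[K]_p) :
  congruent (M *t (N *t O)) ((M *t N) *t O).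
Proof.
apply: (@congruent_reindex ('I_m * ('I_n * 'I_p)) (('I_m * 'I_n) * 'I_p) _ _ _ _
  (@mxtens_index _ _ \o pair_fun id (@mxtens_index _ _))
  (@mxtens_index _ _ \o pair_fun (@mxtens_index _ _) id)
  (fun x => ((x.1, x.2.1), x.2.2))).
- by apply: bij_comp; [exact: mxtens_index_bij|apply: pair_fun_bij; [exact: id_bij|exact: mxtens_index_bij]].
- by apply: bij_comp; [exact: mxtens_index_bij|apply: pair_fun_bij; [exact: mxtens_index_bij|exact: id_bij]].
- by exists (fun x => (x.1.1, (x.1.2, x.2))); [case=> ? [] | case=> [[]]].
- by case=> [a [b c]] [a' [b' c']]; rewrite /pair_fun /= !tensmxE mulrA.
Qed.

Lemma tensC m n (M : 'M[K]_m) (N : 'M[K]_n) : congruent (M *t N) (N *t M).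
Proof.
apply: (@congruent_reindex ('I_m * 'I_n) ('I_n * 'I_m) _ _ _ _
  (@mxtens_index _ _) (@mxtens_index _ _) (fun x => (x.2, x.1))).
- exact: mxtens_index_bij.
- exact: mxtens_index_bij.
- by exists (fun x => (x.2, x.1)); case.
- by case=> a b [a' b'] /=; rewrite !tensmxE mulrC.
Qed.

Lemma tens1 m (M : 'M[K]_m) : congruent ((1%:M : 'M[K]_1) *t M) M.
Proof.
apply: congruent_sym.
apply: (@congruent_reindex 'I_m ('I_1 * 'I_m) _ _ _ _
  id (@mxtens_index _ _) (fun x => (ord0, x))).
- exact: id_bij.
- exact: mxtens_index_bij.
- by exists snd => // -[a b] /=; rewrite [a]ord1.
- by move=> a b; rewrite tensmxE mxE eqxx mul1r.
Qed.

Lemma tensDl m n p (M : 'M[K]_m) (N : 'M[K]_n) (O : 'M[K]_p) :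
  congruent (dsum_mx M N *t O) (dsum_mx (M *t O) (N *t O)).
Proof.
apply: (@congruent_reindex (('I_m + 'I_n) * 'I_p) (('I_m * 'I_p) + ('I_n * 'I_p)) _ _ _ _
  (@mxtens_index _ _ \o pair_fun (@unsplit _ _) id)
  (@unsplit _ _ \o sum_fun (@mxtens_index _ _) (@mxtens_index _ _))
  (fun x => match x.1 with inl a => inl (a, x.2) | inr b => inr (b, x.2) end)).
- by apply: bij_comp; [exact: mxtens_index_bij|apply: pair_fun_bij; [exact: unsplit_bij|exact: id_bij]].
- by apply: bij_comp; [exact: unsplit_bij|apply: sum_fun_bij; exact: mxtens_index_bij].
- by exists (fun x => match x with inl a => (inl a.1, a.2) | inr a => (inr a.1, a.2) end);
    case=> [] [].
- by case=> [[a|a] c] [[b|b] d]; rewrite /pair_fun /= tensmxE /dsum_mx !blockE ?tensmxE //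
    !mxE mul0r.
Qed.

Lemma metabolic_dsum m n (M : 'M[K]_m) (N : 'M[K]_n) :
  congruent (dsum_mx (metabolic_mx M) (metabolic_mx N))
            (metabolic_mx (dsum_mx M N)).
Proof.
apply: (@congruent_reindex (('I_m + 'I_m) + ('I_n + 'I_n)) (('I_m + 'I_n) + ('I_m + 'I_n)) _ _ _ _
  (@unsplit _ _ \o sum_fun (@unsplit _ _) (@unsplit _ _))
  (@unsplit _ _ \o sum_fun (@unsplit _ _) (@unsplit _ _))
  (fun x => match x with inl (inl a) => inl (inl a) | inl (inr a) => inr (inl a)
    | inr (inl a) => inl (inr a) | inr (inr a) => inr (inr a) end)).
- by apply: bij_comp; [exact: unsplit_bij|apply: sum_fun_bij; exact: unsplit_bij].
- by apply: bij_comp; [exact: unsplit_bij|apply: sum_fun_bij; exact: unsplit_bij].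
- by exists (fun x => match x with inl (inl a) => inl (inl a) | inl (inr a) => inr (inl a)
    | inr (inl a) => inl (inr a) | inr (inr a) => inr (inr a) end); case=> [[]|[]].
- case=> [[a|a]|[a|a]] [[b|b]|[b|b]] /=; rewrite /dsum_mx /metabolic_mx !blockE //;
    by rewrite ?scalar_mx_block ?blockE // !mxE.
Qed.

Lemma metabolic_tens m n (D : 'M[K]_m) (N : 'M[K]_n) : N \in unitmx ->
  N^T = N -> congruent (metabolic_mx D *t N) (metabolic_mx (D *t N)).
Proof.
move=> uN sN.
pose B := (1%:M : 'M[K]_m) *t N; pose C := (1%:M : 'M[K]_m) *t invmx N.
have BC : B *m C = 1%:M by rewrite tensmx_mul mul1mx mulmxV // tens1mx1.
have CB : C *m B = 1%:M by rewrite tensmx_mul mul1mx mulVmx // tens1mx1.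
have BT : B^T = B by rewrite trmx_tens trmx1 sN.
apply: (@congruent_trans _ _ _ (block_mx 0 B B (D *t N) : 'M_(m * n + m * n))).
  apply: (@congruent_reindex (('I_m + 'I_m) * 'I_n) (('I_m * 'I_n) + ('I_m * 'I_n)) _ _ _ _
    (@mxtens_index _ _ \o pair_fun (@unsplit _ _) id)
    (@unsplit _ _ \o sum_fun (@mxtens_index _ _) (@mxtens_index _ _))
    (fun x => match x.1 with inl a => inl (a, x.2) | inr b => inr (b, x.2) end)).
  - by apply: bij_comp; [exact: mxtens_index_bij|apply: pair_fun_bij; [exact: unsplit_bij|exact: id_bij]].
  - by apply: bij_comp; [exact: unsplit_bij|apply: sum_fun_bij; exact: mxtens_index_bij].
  - by exists (fun x => match x with inl a => (inl a.1, a.2) | inr a => (inr a.1, a.2) end);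
      case=> [] [].
  - by case=> [[a|a] c] [[b|b] d]; rewrite /pair_fun /= tensmxE /metabolic_mx !blockE ?tensmxE //
      !mxE mul0r.
exists (block_mx B 0 0 1%:M), (block_mx C 0 0 1%:M); split.
- by rewrite mulmx_block !(mul0mx, mulmx0, addr0, add0r) BC mul1mx -scalar_mx_block.
- by rewrite mulmx_block !(mul0mx, mulmx0, addr0, add0r) CB mul1mx -scalar_mx_block.
- rewrite tr_block_mx !trmx0 /metabolic_mx !mulmx_block.
  by rewrite !(mul0mx, mulmx0, addr0, add0r, mul1mx, mulmx1, trmx1) BT.
Qed.

Lemma dsum_opp m (M : 'M[K]_m) : M \in unitmx -> M^T = M ->
  congruent (dsum_mx M (- M)) (metabolic_mx (invmx M)).
Proof.
move=> uM sM; apply: congruent_sym.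
exists (block_mx 1%:M 1%:M (invmx M) 0), (block_mx 0 M 1%:M (- M)); split.
- rewrite mulmx_block !(mul0mx, mulmx0, addr0, add0r, mul1mx) subrr mulVmx //.
  by rewrite -scalar_mx_block.
- rewrite mulmx_block !(mul0mx, mulmx0, addr0, add0r, mul1mx, mulmx1) mulmxV //.
  by rewrite mulNmx mulmxV // subrr -scalar_mx_block.
- rewrite tr_block_mx /dsum_mx /metabolic_mx !mulmx_block trmx_inv sM.
  rewrite !(mul0mx, mulmx0, addr0, add0r, mul1mx, trmx1, trmx0, mulmx1, mulVmx, mulmxV) //.
  by rewrite subrr.
Qed.

End MatrixLemmas.

Section FormOperations.
Variable K : fieldType.
Implicit Types f g h : symform K.

Fact zero_form_sym : (1%:M : 'M[K]_0)^T = 1%:M. Proof. exact: trmx1. Qed.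
Definition zero_form := SymForm zero_form_sym (unitmx1 K 0).

Fact one_form_sym : (1%:M : 'M[K]_1)^T = 1%:M. Proof. exact: trmx1. Qed.
Definition one_form := SymForm one_form_sym (unitmx1 K 1).

Fact opp_form_sym f : (- gram f)^T = - gram f.
Proof. by rewrite linearN /= gram_sym. Qed.
Fact opp_form_unit f : - gram f \in unitmx.
Proof. by rewrite -scaleN1r unitmxZ ?unitrN1 ?gram_unit. Qed.
Definition opp_form f := SymForm (opp_form_sym f) (opp_form_unit f).

Fact dsum_form_sym f g : (dsum_mx (gram f) (gram g))^T = dsum_mx (gram f) (gram g).
Proof. by rewrite tr_block_mx !gram_sym !trmx0. Qed.
Fact dsum_form_unit f g : dsum_mx (gram f) (gram g) \in unitmx.
Proof. by rewrite unitmxE det_ublock unitrM -!unitmxE !gram_unit. Qed.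
Definition dsum_form f g := SymForm (dsum_form_sym f g) (dsum_form_unit f g).

Fact tens_form_sym f g : (gram f *t gram g)^T = gram f *t gram g.
Proof. by rewrite trmx_tens !gram_sym. Qed.
Fact tens_form_unit f g : gram f *t gram g \in unitmx.
Proof.
suff /mulmx1_unit[] : (gram f *t gram g) *m (invmx (gram f) *t invmx (gram g)) = 1%:M by [].
by rewrite tensmx_mul !mulmxV ?gram_unit ?tens1mx1.
Qed.
Definition tens_form f g := SymForm (tens_form_sym f g) (tens_form_unit f g).

Definition isometric f g : Prop := congruent (gram f) (gram g).

(* In characteristic not 2 the metabolic forms are the hyperbolic ones; the  *)
(* metabolic ones give the Witt ring of symmetric bilinear forms over any    *)
(* field.                                                                    *)
Definition metabolic f : Prop :=
  exists (n : nat) (D : 'M[K]_n), D^T = D /\ congruent (gram f) (metabolic_mx D).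

Definition witt_equiv f g : Prop :=
  exists m n : symform K,
    [/\ metabolic m, metabolic n & isometric (dsum_form f m) (dsum_form g n)].

Lemma metabolic_zero : metabolic zero_form.
Proof.
exists 0, 0; rewrite trmx0; split=> //.
by apply: (@congruent_inj _ _ _ _ _ id); [exact: id_bij | case].
Qed.

Lemma metabolic_sum f g : metabolic f -> metabolic g -> metabolic (dsum_form f g).
Proof.
move=> [m [D [sD cf]]] [n [E [sE cg]]]; exists (m + n)%N, (dsum_mx D E); split.
  by rewrite tr_block_mx sD sE !trmx0.
exact: congruent_trans (congruent_dsum cf cg) (metabolic_dsum _ _).
Qed.

Lemma metabolic_tensl f g : metabolic f -> metabolic (tens_form f g).
Proof.
move=> [m [D [sD cf]]]; exists (m * form_dim g)%N, (D *t gram g); split.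
  by rewrite trmx_tens sD gram_sym.
apply: congruent_trans (congruent_tens cf (congruent_refl _)) _.
by apply: metabolic_tens; rewrite ?gram_unit ?gram_sym.
Qed.

Lemma metabolic_opp f : metabolic (dsum_form f (opp_form f)).
Proof.
exists (form_dim f), (invmx (gram f)); split; first by rewrite trmx_inv gram_sym.
by apply: dsum_opp; rewrite ?gram_unit ?gram_sym.
Qed.

Lemma isometric_refl f : isometric f f. Proof. exact: congruent_refl. Qed.
Lemma isometric_sym f g : isometric f g -> isometric g f.
Proof. exact: congruent_sym. Qed.
Lemma isometric_trans g f h : isometric f g -> isometric g h -> isometric f h.
Proof. exact: congruent_trans. Qed.
Lemma isometric_dsum f f' g g' : isometric f f' -> isometric g g' ->
  isometric (dsum_form f g) (dsum_form f' g').
Proof. exact: congruent_dsum. Qed.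
Lemma isometric_dsumA f g h :
  isometric (dsum_form f (dsum_form g h)) (dsum_form (dsum_form f g) h).
Proof. exact: dsumA. Qed.
Lemma isometric_dsumC f g : isometric (dsum_form f g) (dsum_form g f).
Proof. exact: dsumC. Qed.
Lemma isometric_dsumACA f g h k :
  isometric (dsum_form (dsum_form f g) (dsum_form h k))
            (dsum_form (dsum_form f h) (dsum_form g k)).
Proof.
apply: isometric_trans (isometric_sym (isometric_dsumA _ _ _)) _.
apply: isometric_trans (isometric_dsumA _ _ _).
apply: isometric_dsum (isometric_refl _) _.
apply: isometric_trans (isometric_dsumA _ _ _) _.
apply: isometric_trans (isometric_sym (isometric_dsumA _ _ _)).
exact: isometric_dsum (isometric_dsumC _ _) (isometric_refl _).
Qed.

Lemma isometric_tensA f g h :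
  isometric (tens_form f (tens_form g h)) (tens_form (tens_form f g) h).
Proof. exact: tensA. Qed.
Lemma isometric_tensC f g : isometric (tens_form f g) (tens_form g f).
Proof. exact: tensC. Qed.
Lemma isometric_tensDl f g h : isometric (tens_form (dsum_form f g) h)
  (dsum_form (tens_form f h) (tens_form g h)).
Proof. exact: tensDl. Qed.
Lemma isometric_dsum0 f : isometric (dsum_form zero_form f) f.
Proof. exact: dsum0. Qed.
Lemma isometric_tens1 f : isometric (tens_form one_form f) f.
Proof. exact: tens1. Qed.

Lemma isometric_witt f g : isometric f g -> witt_equiv f g.
Proof.
move=> fg; exists zero_form, zero_form; split; try exact: metabolic_zero.
exact: isometric_dsum fg (isometric_refl _).
Qed.

Lemma witt_refl f : witt_equiv f f.
Proof. exact: isometric_witt (isometric_refl f). Qed.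

Lemma witt_sym f g : witt_equiv f g -> witt_equiv g f.
Proof. by move=> [m [n [mm mn /isometric_sym gf]]]; exists n, m. Qed.

Lemma witt_trans g f h : witt_equiv f g -> witt_equiv g h -> witt_equiv f h.
Proof.
move=> [m [n [mm mn fg]]] [p [q [mp mq gh]]].
exists (dsum_form m p), (dsum_form q n); split; try exact: metabolic_sum.
apply: isometric_trans (isometric_dsumA _ _ _) _.
apply: isometric_trans (isometric_dsum fg (isometric_refl _)) _.
apply: isometric_trans (isometric_sym (isometric_dsumA _ _ _)) _.
apply: isometric_trans (isometric_dsum (isometric_refl _) (isometric_dsumC _ _)) _.
apply: isometric_trans (isometric_dsumA _ _ _) _.
apply: isometric_trans (isometric_dsum gh (isometric_refl _)) _.
exact: isometric_sym (isometric_dsumA _ _ _).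
Qed.

Lemma witt_dsum f f' g g' : witt_equiv f f' -> witt_equiv g g' ->
  witt_equiv (dsum_form f g) (dsum_form f' g').
Proof.
move=> [m [n [mm mn fg]]] [p [q [mp mq gh]]].
exists (dsum_form m p), (dsum_form n q); split; try exact: metabolic_sum.
apply: isometric_trans (isometric_dsumACA _ _ _ _) _.
apply: isometric_trans (isometric_dsumACA _ _ _ _).
exact: isometric_dsum.
Qed.

Lemma witt_tensl f f' g : witt_equiv f f' ->
  witt_equiv (tens_form f g) (tens_form f' g).
Proof.
move=> [m [n [mm mn ff']]].
exists (tens_form m g), (tens_form n g); split; try exact: metabolic_tensl.
apply: congruent_trans (congruent_sym (tensDl _ _ _)) _.
apply: congruent_trans (tensDl _ _ _).
exact: congruent_tens ff' (congruent_refl _).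
Qed.

Lemma witt_tens f f' g g' : witt_equiv f f' -> witt_equiv g g' ->
  witt_equiv (tens_form f g) (tens_form f' g').
Proof.
move=> ff' gg'; apply: witt_trans (witt_tensl _ ff') _.
apply: witt_trans (isometric_witt (isometric_tensC _ _)) _.
apply: witt_trans (isometric_witt (isometric_tensC _ _)).
exact: witt_tensl.
Qed.

Lemma metabolic_witt f : metabolic f -> witt_equiv f zero_form.
Proof.
move=> mf; exists zero_form, f; split=> //; first exact: metabolic_zero.
exact: isometric_dsumC.
Qed.

Lemma witt_opp f g : witt_equiv f g -> witt_equiv (opp_form f) (opp_form g).
Proof.
have oppm h : metabolic h -> metabolic (opp_form h).
  move=> [n [D [sD cf]]]; exists n, (- D); split; first by rewrite linearN /= sD.
  apply: congruent_trans (congruent_opp cf) _.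
  exists (block_mx (- 1%:M) 0 0 1%:M), (block_mx (- 1%:M) 0 0 1%:M).
  have E : block_mx (- 1%:M) 0 0 1%:M *m block_mx (- 1%:M) 0 0 1%:M = 1%:M :> 'M[K]_(n + n).
    rewrite mulmx_block !(mul0mx, mulmx0, addr0, add0r, mulNmx, mulmxN, mul1mx, oppr0, opprK).
    by rewrite -scalar_mx_block.
  split=> //; rewrite tr_block_mx !trmx0 trmx1 linearN /= trmx1 /metabolic_mx.
  rewrite !mulmx_block !(mul0mx, mulmx0, addr0, add0r, mulNmx, mulmxN, mul1mx, mulmx1, oppr0, opprK).
  by rewrite opp_block_mx oppr0.
move=> [m [n [mm mn fg]]]; exists (opp_form m), (opp_form n); split; try exact: oppm.
have E h k : gram (dsum_form (opp_form h) (opp_form k)) = - gram (dsum_form h k).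
  by rewrite /= /dsum_mx opp_block_mx !oppr0.
by rewrite /isometric !E; apply: congruent_opp.
Qed.

Definition witt_rel f g : bool := `[< witt_equiv f g >].

Fact witt_rel_equiv : equiv_class_of witt_rel.
Proof.
split=> [f|f g|g f h]; first exact/asboolP/witt_refl.
  by apply/asboolP/asboolP; apply: witt_sym.
by move=> /asboolP fg /asboolP gh; apply/asboolP/(witt_trans fg gh).
Qed.

Canonical witt_eqrel := EquivRelPack witt_rel_equiv.
Canonical witt_encmod := defaultEncModRel witt_rel.

End FormOperations.

Definition witt_ring (K : fieldType) := {eq_quot (@witt_rel K)}.

Section WittRing.
Variable K : fieldType.
Local Notation W := (witt_ring K).

HB.instance Definition _ := Choice.on W.
HB.instance Definition _ := EqQuotient.on W.

Definition witt_class (f : symform K) : W := \pi_W f.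

Lemma witt_classP f g : witt_class f = witt_class g <-> witt_equiv f g.
Proof.
split=> [|fg]; first by move/eqquotP/asboolP.
by apply/eqquotP/asboolP.
Qed.

Lemma witt_class_repr (x : W) : witt_class (repr x) = x.
Proof. exact: reprK. Qed.

Definition witt_add (x y : W) : W := witt_class (dsum_form (repr x) (repr y)).
Definition witt_mul (x y : W) : W := witt_class (tens_form (repr x) (repr y)).
Definition witt_neg (x : W) : W := witt_class (opp_form (repr x)).

Let repr_class f : witt_equiv (repr (witt_class f)) f.
Proof. by apply/witt_classP; rewrite witt_class_repr. Qed.

Let addE f g : witt_add (witt_class f) (witt_class g) = witt_class (dsum_form f g).
Proof. by apply/witt_classP/witt_dsum; apply: repr_class. Qed.

Let mulE f g : witt_mul (witt_class f) (witt_class g) = witt_class (tens_form f g).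
Proof. by apply/witt_classP/witt_tens; apply: repr_class. Qed.

Let oppE f : witt_neg (witt_class f) = witt_class (opp_form f).
Proof. by apply/witt_classP/witt_opp; apply: repr_class. Qed.

Let classW (P : W -> Prop) : (forall f, P (witt_class f)) -> forall x, P x.
Proof. by move=> Pf x; rewrite -(witt_class_repr x). Qed.

Fact witt_addA : associative witt_add.
Proof.
elim/classW => f; elim/classW => g; elim/classW => h; rewrite !addE.
exact/witt_classP/isometric_witt/isometric_dsumA.
Qed.

Fact witt_addC : commutative witt_add.
Proof.
elim/classW => f; elim/classW => g; rewrite !addE.
exact/witt_classP/isometric_witt/isometric_dsumC.
Qed.

Fact witt_add0 : left_id (witt_class (zero_form K)) witt_add.
Proof. by elim/classW => f; rewrite addE; apply/witt_classP/isometric_witt/isometric_dsum0. Qed.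

Fact witt_addN : left_inverse (witt_class (zero_form K)) witt_neg witt_add.
Proof.
elim/classW => f; rewrite oppE witt_addC addE.
exact/witt_classP/metabolic_witt/metabolic_opp.
Qed.

Fact witt_mulA : associative witt_mul.
Proof.
elim/classW => f; elim/classW => g; elim/classW => h; rewrite !mulE.
exact/witt_classP/isometric_witt/isometric_tensA.
Qed.

Fact witt_mulC : commutative witt_mul.
Proof.
elim/classW => f; elim/classW => g; rewrite !mulE.
exact/witt_classP/isometric_witt/isometric_tensC.
Qed.

Fact witt_mul1 : left_id (witt_class (one_form K)) witt_mul.
Proof. by elim/classW => f; rewrite mulE; apply/witt_classP/isometric_witt/isometric_tens1. Qed.

Fact witt_mulDl : left_distributive witt_mul witt_add.
Proof.
elim/classW => f; elim/classW => g; elim/classW => h; rewrite !(mulE, addE).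
exact/witt_classP/isometric_witt/isometric_tensDl.
Qed.

HB.instance Definition _ :=
  GRing.isZmodule.Build W witt_addA witt_addC witt_add0 witt_addN.
HB.instance Definition _ :=
  GRing.Zmodule_isComPzRing.Build W witt_mulA witt_mulC witt_mul1 witt_mulDl.

Lemma witt_classD f g :
  witt_class (dsum_form f g) = witt_class f + witt_class g.
Proof. by rewrite -addE. Qed.

Lemma witt_classM f g :
  witt_class (tens_form f g) = witt_class f * witt_class g.
Proof. by rewrite -mulE. Qed.

Lemma witt_classN f : witt_class (opp_form f) = - witt_class f.
Proof. by rewrite -oppE. Qed.

Lemma witt_class0 : witt_class (zero_form K) = 0. Proof. by []. Qed.

Lemma witt_class1 : witt_class (one_form K) = 1. Proof. by []. Qed.

End WittRing.

Definition fundamental_ideal (K : fieldType) (w : witt_ring K) : Prop :=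
  exists f : symform K, ~~ odd (form_dim f) /\ w = witt_class f.

Definition ideal_power (R : pzRingType) (I : R -> Prop) (n : nat) (x : R) : Prop :=
  exists s : seq (n.-tuple R),
    (forall t, t \in s -> forall y, y \in t -> I y)
    /\ x = \sum_(t <- s) \prod_(y <- t) y.

Definition anisotropic (K : fieldType) (f : symform K) : Prop :=
  forall v : 'rV[K]_(form_dim f), v *m gram f *m v^T = 0 -> v = 0.

(* u(K) <= n, where u(K) is the supremum, possibly infinite, of the          *)
(* dimensions of the anisotropic forms. In characteristic not 2 anisotropic  *)
(* quadratic forms are automatically nondegenerate.                          *)
Definition u_invariant_le (K : fieldType) (n : nat) : Prop :=
  forall f : symform K, anisotropic f -> (form_dim f <= n)%N.

Section Algebras.
Variable F : fieldType.
Implicit Types A D : falgType F.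

Definition central A : Prop := ('Z({:A}) = 1)%VS.

(* Two-sided ideals of a unital algebra are subspaces. *)
Definition simple A : Prop :=
  forall I : {vspace A}, ({:A} * I <= I)%VS -> (I * {:A} <= I)%VS ->
    I = 0%VS \/ I = fullv.

Definition central_simple A : Prop := central A /\ simple A.

Definition division A : Prop := forall x : A, x != 0 -> x \is a GRing.unit.

(* Nat.sqrt is the integer square root; it is exact here since the dimension *)
(* of a central simple algebra is a square.                                  *)
Definition degree A : nat := Nat.sqrt (\dim {:A}).

(* A is isomorphic, as an F-algebra, to the r.+1 x r.+1 matrices over a      *)
(* central division algebra D of degree m.                                   *)
Definition has_index A (m : nat) : Prop :=
  exists (D : falgType F) (r : nat) (f : {rmorphism A -> 'M[D]_r.+1}),
    [/\ central D, division D, bijective f,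
        forall (c : F) (a : A), f (c *: a) = map_mx ( *:%R c) (f a)
      & degree D = m].

(* Through iota the field L is an extension of F; the last condition says    *)
(* that the L-linear extension of f from the tensor product of A and L over  *)
(* F, which has vbasis {:A} as an L-basis, to the n x n matrices is          *)
(* bijective. Thus L splits A, and f is the restriction to A of a splitting  *)
(* isomorphism.                                                              *)
Definition splitting A (L : fieldType) (iota : {rmorphism F -> L}) (n : nat)
    (f : {rmorphism A -> 'M[L]_n}) : Prop :=
  (forall (c : F) (a : A), f (c *: a) = iota c *: f a)
  /\ bijective (fun l : {ffun 'I_(\dim {:A}) -> L} =>
       \sum_i l i *: f (vbasis {:A})`_i).

Definition involution A (sigma : A -> A) : Prop :=
  [/\ linear sigma, {morph sigma : x y / x * y >-> y * x} & involutive sigma].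

Definition bilin (L : fieldType) (n : nat) (B : 'M[L]_n) (x y : 'cV[L]_n) : 'M[L]_1 :=
  x^T *m B *m y.

(* By L-linearity it is enough to require the adjunction on the image of A.  *)
Definition orthogonal_involution A (sigma : A -> A) : Prop :=
  involution sigma
  /\ exists (L : fieldType) (iota : {rmorphism F -> L}) (n : nat)
       (f : {rmorphism A -> 'M[L]_n}) (B : 'M[L]_n),
     [/\ splitting iota f, B^T = B, B \in unitmx
       & forall (a : A) (x y : 'cV[L]_n),
           bilin B (f a *m x) y = bilin B x (f (sigma a) *m y)].

Definition isotropic_involution A (sigma : A -> A) : Prop :=
  exists a : A, a != 0 /\ sigma a * a = 0.

End Algebras.

(* Main.v *)
(* If A is split, sigma is adjoint to a symmetric bilinear form over F of     *)
(* dimension deg A > u(F). Otherwise A is a matrix ring over a quaternion     *)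
(* division algebra Q, and sigma is adjoint to a skew-hermitian form over Q   *)
(* of rank > 2k + 1; so let h be such a form, anisotropic and diagonal with   *)
(* 2k + 2 pure quaternion entries, and let d be its discriminant.             *)
(*   For a pure quaternion p, the field N = F(p) splits Q and turns h into a  *)
(* quadratic form h_N over N of dimension 4k + 4; totally isotropic subspaces *)
(* of h_N yield orthogonal vectors of h with values in Fp. As I^3 F = 0,      *)
(* hermitian forms of rank 3 over F(p) are isotropic, so there are no three   *)
(* such vectors, and the Witt class of h_N is not represented by a form of    *)
(* dimension <= 4k - 2.                                                       *)
(*   If d is a square, h can be diagonalised with all entries orthogonal to   *)
(* i, and by a transfer argument the classes of all h_N are restrictions of a *)
(* single class w of W(F). If the anisotropic form in w has dimension > 4k-2, *)
(* it has a binary subform in common with the norm form of Q, hence becomes   *)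
(* isotropic over some N, where it drops to dimension <= 4k - 2: absurd.      *)
(*   If d becomes a square in F(p), then u(F(p)) <= 4k gives two orthogonal   *)
(* vectors with values in Fp. If d is not a square in any F(p), Q remains     *)
(* division over F(sqrt d), where the square case provides an isotropic       *)
(* vector x + y sqrt d of h. In both cases h has orthogonal vectors with      *)
(* values q and -yq, where y is a norm from the discriminant extension of the *)
(* complement of the second one. Such a y is a similarity factor of that      *)
(* complement over N = F(r), for a third entry r of h; this reduces h_N to    *)
(* dimension 4k - 2 again.                                                    *)

From HB Require Import structures.
Require Import Defs.
From mathcomp Require Import all_boot all_order all_algebra all_field.
From mathcomp Require Import ring boolp mxtens zify.

Set Implicit Arguments.
Unset Strict Implicit.
Unset Printing Implicit Defensive.

Import GRing.Theory.
Local Open Scope ring_scope.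

(** * Classes of Gram matrices in the Witt ring *)

(** Let e be the idempotent of A given by a matrix unit over the division algebra D of A. The ideal
    A e carries the form (x, y) |-> sigma(x) y, whose isotropic vectors are isotropic elements of A.
    For D = F it is a symmetric bilinear form of dimension deg A > u(F) ([split_case]). For D a
    quaternion algebra Q it is, up to a scaling, a skew-hermitian form h, and counting dimensions
    extracts 2k + 2 orthogonal vectors ([quaternion_case]); everything then rests on
    [skew_hermitian_isotropic].

    Suppose h anisotropic. For a pure quaternion p and N = F(p), the component of h outside F(p) is
    a quadratic form h_N over N of dimension 4k + 4. By [tot_isotropic_class], a small
    representative of its Witt class yields a large N-subspace on which h has values in F(p). There
    h amounts to p times a hermitian form, and I^3 = 0 makes hermitian forms of rank 3 isotropic
    ([hermitian3_isotropic]). So no form of dimension at most 4k - 2 represents h_N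
    ([trace_anisotropic]), and the proof consists in producing one.

    If the discriminant is a square ([square_disc_impossible]), [planar_full] makes all diagonal
    entries orthogonal to i, that is, of the form z j with z in F(i). Then h_N is a sum of transfers
    of the <z> along a functional depending on p, and [transfer_diff] shows that all h_N are
    restrictions of one class of W(F) ([planar_traces]). Either this class is small already, or
    [common_slot] finds a p over which it becomes small.

    For other discriminants, [no_multiplier] and [multiplier_pair] exclude orthogonal vectors with
    values q and -Yq where Y is a norm from the discriminant extension of the complement of the
    second. Such vectors come from the bound on u(F(p)) if the discriminant becomes a square in F(p)
    ([slot_disc_impossible]), and otherwise from the square case over F(sqrt d), where Q stays
    division ([ext_division]) and I^3 still vanishes ([quadext_I3]). *)

Lemma congruent_unit (K : fieldType) n (P M N : 'M[K]_n) :
  P \in unitmx -> M = P *m N *m P^T -> congruent M N.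
Proof. by move=> uP ->; exists P, (invmx P); rewrite mulmxV ?mulVmx. Qed.

Section WittClasses.
Variable K : fieldType.
Local Notation W := (witt_ring K).

Definition good n (M : 'M[K]_n) := (M^T == M) && (M \in unitmx).

Lemma good_gram (f : symform K) : good (gram f).
Proof. by rewrite /good gram_sym eqxx gram_unit. Qed.

Lemma congruent_good m n (M : 'M[K]_m) (N : 'M[K]_n) :
  congruent M N -> good N -> good M.
Proof.
move=> [P [Q [PQ QP ->]]] /andP[/eqP sN uN].
rewrite /good !trmx_mul trmxK sN mulmxA eqxx /=.
suff: P *m N *m P^T *m (Q^T *m invmx N *m Q) = 1%:M by case/mulmx1_unit.
rewrite -!mulmxA (mulmxA P^T) -trmx_mul QP trmx1 mul1mx (mulmxA N) mulmxV //.
by rewrite mul1mx.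
Qed.

(** The class of a bare matrix, 0 if it is not the Gram matrix of a form, so that computations need
    not carry proofs of symmetry and invertibility. *)
Definition mcl n (M : 'M[K]_n) : W :=
  match @eqP _ M^T M, @idP (M \in unitmx) with
  | ReflectT s, ReflectT u => witt_class (SymForm s u)
  | _, _ => 0
  end.

Lemma witt_class_congr (f g : symform K) :
  congruent (gram f) (gram g) -> witt_class f = witt_class g.
Proof. by move=> c; apply/witt_classP/isometric_witt. Qed.

Lemma mclE (f : symform K) : mcl (gram f) = witt_class f.
Proof.
rewrite /mcl; case: eqP => [s|]; last by rewrite gram_sym.
case: {-}_ / idP => [u|]; last by rewrite gram_unit.
exact/witt_class_congr/congruent_refl.
Qed.

Lemma mcl_good n (M : 'M[K]_n) : good M ->
  exists f : symform K, [/\ form_dim f = n, congruent (gram f) M & mcl M = witt_class f].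
Proof.
case/andP=> /eqP s u; exists (SymForm s u); split=> //; first exact: congruent_refl.
exact: (mclE (SymForm s u)).
Qed.

Lemma mcl_bad n (M : 'M[K]_n) : ~~ good M -> mcl M = 0.
Proof.
rewrite /mcl /good; case: eqP => [s|//].
by case: {-}_ / idP => [u|//] /=; rewrite u.
Qed.

Lemma mcl_congr m n (M : 'M[K]_m) (N : 'M[K]_n) : congruent M N -> mcl M = mcl N.
Proof.
move=> c; case: (boolP (good N)) => gN; last first.
  rewrite (mcl_bad gN) mcl_bad //; apply: contra gN.
  exact/congruent_good/congruent_sym.
have [f [_ cf ->]] := mcl_good (congruent_good c gN).
have [g [_ cg ->]] := mcl_good gN.
apply/witt_class_congr/(congruent_trans cf)/(congruent_trans c).
exact: congruent_sym.
Qed.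

Lemma good_dsum m n (M : 'M[K]_m) (N : 'M[K]_n) :
  good M -> good N -> good (dsum_mx M N).
Proof.
move=> /andP[/eqP sM uM] /andP[/eqP sN uN].
by rewrite /good tr_block_mx sM sN !trmx0 eqxx unitmxE det_ublock unitrM -!unitmxE uM.
Qed.

Lemma mcl_dsum m n (M : 'M[K]_m) (N : 'M[K]_n) :
  good M -> good N -> mcl (dsum_mx M N) = mcl M + mcl N.
Proof.
move=> gM gN; have [f [_ cf ->]] := mcl_good gM.
have [g [_ cg ->]] := mcl_good gN.
rewrite -witt_classD -mclE; apply: mcl_congr; apply: congruent_sym.
exact: congruent_dsum.
Qed.

Lemma mcl_tens m n (M : 'M[K]_m) (N : 'M[K]_n) :
  good M -> good N -> mcl (M *t N) = mcl M * mcl N.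
Proof.
move=> gM gN; have [f [_ cf ->]] := mcl_good gM.
have [g [_ cg ->]] := mcl_good gN.
rewrite -witt_classM -mclE; apply: mcl_congr; apply: congruent_sym.
exact: congruent_tens.
Qed.

Lemma mcl_metabolic n (D : 'M[K]_n) : D^T = D -> mcl (metabolic_mx D) = 0.
Proof.
move=> sD; case: (boolP (good (metabolic_mx D))) => [g|/mcl_bad//].
have [f [_ cf ->]] := mcl_good g.
rewrite -[RHS](witt_class0 K); apply/witt_classP/metabolic_witt.
by exists n, D.
Qed.


(* The class of the one-dimensional form <x>, with junk value 0 at x = 0;    *)
(* with this convention the identities below hold without side conditions.   *)
Definition qcl (x : K) : W := mcl (x%:M : 'M_1).
(** The class of the one-fold Pfister form <1, -x>. *)
Definition pf (x : K) : W := 1 - qcl x.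

Lemma good1 (x : K) : good (x%:M : 'M_1) = (x != 0).
Proof. by rewrite /good tr_scalar_mx eqxx unitmxE det_scalar expr1 unitfE. Qed.

Lemma qcl0 : qcl 0 = 0. Proof. by rewrite /qcl mcl_bad // good1 eqxx. Qed.

Lemma qcl1 : qcl 1 = 1.
Proof. by rewrite -[RHS]witt_class1 -(mclE (one_form K)). Qed.

Lemma mul11 (x y : K) : (x%:M : 'M_1) *t (y%:M : 'M_1) = (x * y)%:M :> 'M_1.
Proof.
apply/matrixP=> i j; rewrite !mxE [i]ord1 [j]ord1.
by rewrite [X in X.1 == _]ord1 || rewrite !(ord1 _.1) !(ord1 _.2) !eqxx.
Qed.

Lemma qclM x y : qcl (x * y) = qcl x * qcl y.
Proof.
have [->|x0] := eqVneq x 0; first by rewrite mul0r qcl0 mul0r.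
have [->|y0] := eqVneq y 0; first by rewrite mulr0 qcl0 mulr0.
by rewrite /qcl -mcl_tens ?good1 // mul11.
Qed.

Lemma qclN x : qcl (- x) = - qcl x.
Proof.
have [->|x0] := eqVneq x 0; first by rewrite oppr0 qcl0 oppr0.
have [f [_ c e]] : exists f : symform K,
    [/\ form_dim f = 1, congruent (gram f) (x%:M : 'M_1) & qcl x = witt_class f].
  by apply: mcl_good; rewrite good1.
rewrite e -witt_classN -mclE; apply: mcl_congr.
have -> : (- x)%:M = - x%:M :> 'M[K]_1 by rewrite raddfN.
exact/congruent_sym/congruent_opp.
Qed.

Lemma qcl_sqr x : x != 0 -> qcl (x ^+ 2) = 1.
Proof.
move=> x0; rewrite -qcl1; apply: mcl_congr.
apply: (@congruent_unit _ _ x%:M); first by rewrite unitmxE det_scalar expr1 unitfE.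
by rewrite tr_scalar_mx mulmx1 -scalar_mxM expr2.
Qed.

Definition bin (k c d : K) : 'M[K]_(1 + 1) := block_mx k%:M c%:M c%:M d%:M.

Lemma det_block11 (a b c d : K) :
  \det (block_mx a%:M b%:M c%:M d%:M : 'M_(1 + 1)) = a * d - b * c.
Proof.
set M := block_mx _ _ _ _.
have E (i j : 'I_1) : [/\ M (lshift 1 i) (lshift 1 j) = a, M (lshift 1 i) (rshift 1 j) = b,
    M (rshift 1 i) (lshift 1 j) = c & M (rshift 1 i) (rshift 1 j) = d].
  by rewrite block_mxEul block_mxEur block_mxEdl block_mxEdr !mxE [i]ord1 [j]ord1 eqxx.
have [E1 E2 E3 E4] := E 0 0; clearbody M.
rewrite (expand_det_row _ (lshift 1 0)) big_split_ord !big_ord1 /= /cofactor !det_mx11 E1 E2 !mxE.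
set u := lift _ _; set v := lift _ _.
have -> : u = rshift 1 0 by exact: val_inj.
have -> : v = lshift 1 0 by exact: val_inj.
by rewrite E3 E4 /= expr0 expr1; ring.
Qed.

Lemma det_bin k c d : \det (bin k c d) = k * d - c ^+ 2.
Proof. exact: det_block11. Qed.

Lemma tr_bin k c d : (bin k c d)^T = bin k c d.
Proof. by rewrite tr_block_mx !tr_scalar_mx. Qed.

Lemma good_bin k c d : good (bin k c d) = (k * d - c ^+ 2 != 0).
Proof. by rewrite /good tr_bin eqxx unitmxE det_bin unitfE. Qed.

Lemma block11 (a b c d a' b' c' d' : K) :
  (block_mx a%:M b%:M c%:M d%:M : 'M_(1 + 1)) *m block_mx a'%:M b'%:M c'%:M d'%:M =
  block_mx (a * a' + b * c')%:M (a * b' + b * d')%:M (c * a' + d * c')%:M (c * b' + d * d')%:M.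
Proof. by rewrite mulmx_block -!scalar_mxM -!raddfD. Qed.

(** Completing the square diagonalises the matrix when k is nonzero. For k = 0 it is metabolic, and
    [qcl 0 = 0] gives the same formula. *)
Lemma mcl_bin (k c d : K) : k * d - c ^+ 2 != 0 ->
  mcl (bin k c d) = qcl k + qcl (k * (k * d - c ^+ 2)).
Proof.
have [->|k0 D0] := eqVneq k 0.
  rewrite !mul0r qcl0 addr0 sub0r oppr_eq0 sqrf_eq0 => c0.
  suff /mcl_congr-> : congruent (bin 0 c d) (metabolic_mx (d%:M : 'M_1)).
    by rewrite mcl_metabolic ?tr_scalar_mx.
  apply: (@congruent_unit _ _ (block_mx c%:M 0%:M 0%:M 1%:M)).
    by rewrite unitmxE raddf0 det_lblock !det_scalar !expr1 mulr1 unitfE.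
  rewrite /metabolic_mx -(raddf0 (@scalar_mx K 1)) tr_block_mx !tr_scalar_mx !block11 /bin.
  by congr block_mx; congr _%:M; ring.
rewrite /qcl -mcl_dsum ?good1 ?mulf_neq0 //; apply: mcl_congr.
apply: (@congruent_unit _ _ (block_mx 1%:M 0%:M (c / k)%:M k^-1%:M)).
  by rewrite unitmxE raddf0 det_lblock !det_scalar !expr1 mul1r unitfE invr_eq0.
rewrite /dsum_mx -(raddf0 (@scalar_mx K 1)) tr_block_mx !tr_scalar_mx !block11 /bin.
by congr block_mx; congr _%:M; field.
Qed.

(** In <x, y> the vectors (1, 1) and (-y, x) are orthogonal, with values x + y and x y (x + y). *)
Lemma qclD (x y : K) : qcl x + qcl y = qcl (x + y) + qcl (x * y * (x + y)).
Proof.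
have [->|x0] := eqVneq x 0; first by rewrite add0r mul0r mul0r qcl0 addr0 add0r.
have [->|y0] := eqVneq y 0; first by rewrite addr0 mulr0 mul0r qcl0.
have [e|s0] := eqVneq (x + y) 0.
  by rewrite e mulr0 qcl0 addr0; move/eqP: e; rewrite addr_eq0 => /eqP->; rewrite qclN addNr.
rewrite /qcl -!mcl_dsum ?good1 ?mulf_neq0 //; apply/esym/mcl_congr.
apply: (@congruent_unit _ _ (block_mx 1%:M 1%:M (- y)%:M x%:M)).
  by rewrite unitmxE det_block11 unitfE mul1r mul1r opprK.
rewrite /dsum_mx -(raddf0 (@scalar_mx K 1)) tr_block_mx !tr_scalar_mx !block11.
by congr block_mx; congr _%:M; ring.
Qed.

End WittClasses.

(** * Witt decomposition and totally isotropic subspaces *)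

Section Decomposition.
Variable K : fieldType.
Local Notation W := (witt_ring K).

Lemma good_dsumr m n (M : 'M[K]_m) (N : 'M[K]_n) : good (dsum_mx M N) -> good N.
Proof.
rewrite /good tr_block_mx !trmx0 => /andP[/eqP/eq_block_mx[_ _ _ ->]].
by rewrite eqxx unitmxE det_ublock unitrM -!unitmxE => /andP[].
Qed.

Lemma congruent_full m n (P : 'M[K]_(m, n)) (M : 'M[K]_n) :
  row_free P -> row_full P -> congruent (P *m M *m P^T) M.
Proof. by move=> rP fP; exists P, (pinvmx P); rewrite mulmxVp ?mulVpmx. Qed.

(** A subspace on which the form is nondegenerate splits off; the rows of [C] below are a basis of
    its orthogonal complement. *)
Lemma congruent_split s n (M : 'M[K]_n) (U : 'M[K]_(s, n)) :
  good M -> U *m M *m U^T \in unitmx ->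
  exists m (N : 'M[K]_m),
    [/\ n = (s + m)%N, good N & congruent M (dsum_mx (U *m M *m U^T) N)].
Proof.
move=> gM uU; have /andP[sM uM] := gM.
have rMU : \rank (M *m U^T) = s.
  have : (\rank (U *m M *m U^T) <= \rank (M *m U^T))%N by rewrite -mulmxA mxrankM_maxr.
  by rewrite mxrank_unit // => h; apply/eqP; rewrite eqn_leq h rank_leq_col.
pose C := row_base (kermx (M *m U^T)).
have CU : C *m (M *m U^T) = 0.
  by apply/sub_kermxP; rewrite eq_row_base.
have UC : U *m M *m C^T = 0.
  by apply: trmx_inj; rewrite trmx_mul trmxK trmx_mul (eqP sM) CU trmx0.
have sn : (s <= n)%N by rewrite -rMU rank_leq_row.
have rC : \rank (kermx (M *m U^T)) = (n - s)%N by rewrite mxrank_ker rMU.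
have rP : row_free (col_mx U C).
  apply: inj_row_free => v; rewrite -[v]hsubmxK mul_row_col => e.
  have l0 : lsubmx v = 0.
    have := congr1 (mulmx^~ (M *m U^T)) e; rewrite mulmxDl -(mulmxA _ C) CU mulmx0 addr0 mul0mx.
    by rewrite -mulmxA (mulmxA U) => h; rewrite -(mulmxK uU (lsubmx v)) h mul0mx.
  move: e; rewrite l0 mul0mx add0r => /eqP.
  by rewrite mulmx_free_eq0 ?row_base_free // => /eqP->; rewrite row_mx0.
have fP : row_full (col_mx U C).
  by rewrite /row_full (eqP rP) rC subnKC.
have c := congruent_full M rP fP.
have E : col_mx U C *m M *m (col_mx U C)^T = dsum_mx (U *m M *m U^T) (C *m M *m C^T).
  by rewrite mul_col_mx tr_col_mx mul_col_row UC -(mulmxA C M U^T) CU.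
rewrite E in c; exists _, (C *m M *m C^T); split.
- by rewrite rC subnKC.
- exact: good_dsumr (congruent_good c gM).
- exact: congruent_sym.
Qed.

Lemma congruent_dim m n (M : 'M[K]_m) (N : 'M[K]_n) : congruent M N -> m = n.
Proof.
case=> P [Q [PQ QP _]]; apply/eqP; rewrite eqn_leq.
have := mxrankM_maxl P Q; have := mxrankM_maxl Q P.
rewrite PQ QP !mxrank1; have := rank_leq_col P; have := rank_leq_col Q; lia.
Qed.

(** Let f _|_ m and g _|_ n be isometric, with m and n metabolic of dimensions 2 mu and 2 nu. A
    Lagrangian of n becomes a totally isotropic subspace of f _|_ m. Intersecting it with the
    orthogonal of a Lagrangian of m and projecting to f loses at most mu dimensions, and 2 (nu - mu)
    is the difference of dimensions of f and g. *)
Lemma tot_isotropic_class (f g : symform K) s :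
  witt_class f = witt_class g -> (form_dim g + 2 * s <= form_dim f)%N ->
  exists U : 'M[K]_(s, form_dim f), row_free U /\ U *m gram f *m U^T = 0.
Proof.
move=> /witt_classP[m [n [[mu [D [sD cm]]] [nu [D' [sD' cn]]] c]]] le_s.
pose md := metabolic_mx D; pose md' := metabolic_mx D'.
have : congruent (dsum_mx (gram f) md) (dsum_mx (gram g) md').
  apply: congruent_trans (congruent_dsum (congruent_refl _) (congruent_sym cm)) _.
  exact: congruent_trans c (congruent_dsum (congruent_refl _) cn).
move=> E0; have [P [Q [PQ QP E]]] := E0.
have dims := congruent_dim E0.
pose Z : 'M[K]_(nu, form_dim g + (nu + nu)) := row_mx 0 (row_mx 1%:M 0).
have ZG : Z *m dsum_mx (gram g) md' *m Z^T = 0.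
  rewrite /Z /dsum_mx /md' /metabolic_mx !tr_row_mx !mul_row_block !mul_row_col.
  by do !rewrite !(mul0mx, mulmx0, addr0, add0r, trmx0, mul_row_col).
pose L := Z *m Q.
have LG : L *m dsum_mx (gram f) md *m L^T = 0.
  rewrite /L E trmx_mul !mulmxA -(mulmxA Z) QP mulmx1.
  by rewrite -(mulmxA _ P^T) -trmx_mul QP trmx1 mulmx1.
have fL : row_free L.
  apply: inj_row_free => v; rewrite mulmxA => /(congr1 (mulmx^~ P)).
  rewrite -!mulmxA QP mulmx1 mul0mx /Z !mul_mx_row mulmx0 mulmx1 => e.
  have := congr1 rsubmx e; rewrite row_mxKr => /(congr1 lsubmx).
  by rewrite row_mxKl !linear0.
(* [L1] is the component in f, [L2] the one along the Lagrangian of [md], and [L3] the one along the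
   dual half. *)
pose L1 := lsubmx L; pose L2 := lsubmx (rsubmx L); pose L3 := rsubmx (rsubmx L).
have LE : L = row_mx L1 (row_mx L2 L3) by rewrite !hsubmxK.
have G0 : L1 *m gram f *m L1^T + (L3 *m L2^T + (L2 + L3 *m D) *m L3^T) = 0.
  rewrite -LG LE /dsum_mx /md /metabolic_mx !tr_row_mx !mul_row_block !mul_row_col.
  by rewrite !(mul0mx, mulmx0, addr0, add0r, mulmx1) mul_row_col.
(* [A] selects the vectors of [L] inside the Lagrangian of [md]; they are orthogonal to all of [L],
   which bounds their number by [rA]. *)
pose A := kermx (row_mx L1 L3).
have [A1 A3] : A *m L1 = 0 /\ A *m L3 = 0.
  have := mulmx_ker (row_mx L1 L3); rewrite mul_mx_row -row_mx0.
  by case/eq_row_mx.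
have rA : (\rank A <= mu - \rank L3)%N.
  have A2 : A *m L2 *m L3^T = 0.
    have := congr1 (mulmx A) G0; rewrite mulmx0 !mulmxDr !mulmxDl !mulmxA A1 A3.
    by rewrite !mul0mx mulmxDr !mulmxA A3 !mul0mx addr0 !add0r.
  have -> : \rank A = \rank (A *m L2).
    rewrite -(mxrankMfree A fL) LE !mul_mx_row A1 A3.
    pose J : 'M[K]_(mu, form_dim f + (mu + mu)) := row_mx 0 (row_mx 1%:M 0).
    have <- : A *m L2 *m J = row_mx 0 (row_mx (A *m L2) 0).
      by rewrite !mul_mx_row !mulmx0 mulmx1.
    apply: mxrankMfree; apply: inj_row_free => v; rewrite !mul_mx_row mulmx1 !mulmx0.
    by rewrite -!row_mx0 => /eq_row_mx[_ /eq_row_mx[]].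
  rewrite -(mxrank_tr L3) -mxrank_ker; apply: mxrankS; exact/sub_kermxP.
(* [C] selects the vectors of [L] orthogonal to the Lagrangian of [md]; their components in f
   already form a totally isotropic space. *)
pose C := kermx L3.
have rC : (nu - mu <= \rank (C *m L1))%N.
  have rk := mxrank_mul_ker C L1; have rkC : \rank C = (nu - \rank L3)%N by exact: mxrank_ker.
  have : (\rank (C :&: kermx L1) <= \rank A)%N.
    apply: mxrankS; apply/sub_kermxP; rewrite mul_mx_row.
    rewrite (sub_kermxP (capmxSr _ _)) (_ : _ *m L3 = 0) ?row_mx0 //.
    exact/sub_kermxP/capmxSl.
  have := rank_leq_col L3; have := rank_leq_row L3; lia.
have CG : C *m L1 *m gram f *m (C *m L1)^T = 0.
  have C3 : C *m L3 = 0 by exact: mulmx_ker.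
  have -> : C *m L1 *m gram f *m (C *m L1)^T = C *m (L1 *m gram f *m L1^T) *m C^T.
    by rewrite trmx_mul !mulmxA.
  move/eqP: G0; rewrite addr_eq0 => /eqP->.
  rewrite mulmxN mulmxDr mulmxA C3 mul0mx add0r mulNmx mulmxA -mulmxA.
  by rewrite -trmx_mul C3 trmx0 mulmx0 oppr0.
have le_r : (s <= \rank (C *m L1))%N by apply: leq_trans rC; lia.
exists ((pid_mx s : 'M_(s, \rank (C *m L1))) *m row_base (C *m L1)); split.
  by rewrite /row_free mxrankMfree ?row_base_free // rank_pid_mx.
have /submxP[X ->] : (row_base (C *m L1) <= C *m L1)%MS by rewrite eq_row_base.
set V := pid_mx s; set Y := C *m L1 in CG *.
have -> : V *m (X *m Y) *m gram f *m (V *m (X *m Y))^T =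
          V *m X *m (Y *m gram f *m Y^T) *m (V *m X)^T by rewrite !trmx_mul !mulmxA.
by rewrite CG mulmx0 mul0mx.
Qed.

Lemma odd_dim_class (f g : symform K) :
  witt_class f = witt_class g -> odd (form_dim f) = odd (form_dim g).
Proof.
move=> /witt_classP[m [n [[mu [D [sD cm]]] [nu [D' [sD' cn]]] c]]].
have e : (form_dim f + form_dim m = form_dim g + form_dim n)%N := congruent_dim c.
by have := congruent_dim cm; have := congruent_dim cn; lia.
Qed.

(** An isotropic vector and a partner pairing to 1 with it span a plane of class 0, whose complement
    keeps the class of f. *)
Lemma isotropic_reduce (f : symform K) : ~ anisotropic f ->
  exists g : symform K, witt_class g = witt_class f /\ form_dim f = (form_dim g + 2)%N.
Proof.
move=> /existsNP[v /not_implyP[v0 nz]].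
have /rV0Pn[j vj] : v *m gram f != 0.
  apply/eqP => e; apply: nz; apply: (can_inj (mulmxK (gram_unit f))).
  by rewrite mul0mx.
pose w : 'rV[K]_(form_dim f) := ((v *m gram f) 0 j)^-1 *: delta_mx 0 j.
have vw : v *m gram f *m w^T = 1%:M.
  rewrite /w; move: (v *m gram f) vj => u vj.
  rewrite linearZ /= trmx_delta -scalemxAr -colE.
  by apply/matrixP=> a b; rewrite !ord1 !mxE mulVf ?eqxx.
have wv : w *m gram f *m v^T = 1%:M.
  by apply: trmx_inj; rewrite !trmx_mul trmxK gram_sym mulmxA vw trmx1.
have E : col_mx v w *m gram f *m (col_mx v w)^T = bin 0 1 ((w *m gram f *m w^T) 0 0).
  rewrite mul_col_mx tr_col_mx mul_col_row v0 vw wv /bin raddf0.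
  by congr block_mx; apply/matrixP=> a b; rewrite !ord1 [RHS]mxE eqxx.
have d0 : 0 * (w *m gram f *m w^T) 0 0 - 1 ^+ 2 != 0 :> K.
  by rewrite mul0r expr1n sub0r oppr_eq0 oner_neq0.
have [||m [N [nE gN c]]] := @congruent_split _ _ (gram f) (col_mx v w).
- exact: good_gram.
- by rewrite E; have := d0; rewrite -good_bin => /andP[].
have [g [gE cg gcl]] := mcl_good gN.
exists g; split; last by rewrite gE nE addnC.
rewrite -gcl -mclE (mcl_congr c) mcl_dsum ?E ?good_bin //.
by rewrite mcl_bin // mul0r qcl0 !add0r.
Qed.

Lemma anisotropic_rep (f : symform K) :
  exists g : symform K, [/\ anisotropic g, witt_class g = witt_class f & (form_dim g <= form_dim f)%N].
Proof.
have [n le_n] := ubnP (form_dim f); elim: n => // n IHn in f le_n *.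
have [a|/isotropic_reduce[g [cg dg]]] := pselect (anisotropic f); first by exists f.
have [|h [ah ch dh]] := IHn g; first by move: le_n; rewrite dg; lia.
by exists h; rewrite ch cg dg; split=> //; lia.
Qed.

Lemma class_rep_le n (w : witt_ring K) : u_invariant_le K n ->
  exists g : symform K, [/\ anisotropic g, witt_class g = w & (form_dim g <= n)%N].
Proof.
move=> un; have [g [ag cg _]] := anisotropic_rep (repr w).
by exists g; rewrite cg witt_class_repr; split=> //; apply: un.
Qed.

(** A singular matrix is allowed: vectors of its radical are isotropic. *)
Lemma isotropic_vector n m (M : 'M[K]_m) : u_invariant_le K n -> M^T = M -> (n < m)%N ->
  exists2 v : 'rV_m, v != 0 & v *m M *m v^T = 0.
Proof.
move=> un sM lt_nm; have [uM|nuM] := boolP (M \in unitmx).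
  have : ~ anisotropic (SymForm sM uM) by move=> /un /=; rewrite leqNgt lt_nm.
  move=> /existsNP[v /not_implyP[v0 nz]].
  by exists v => //; apply/eqP.
have : kermx M != 0 by rewrite kermx_eq0 row_free_unit.
case/rowV0Pn=> v /sub_kermxP vM v0; exists v => //.
by rewrite vM mul0mx.
Qed.

End Decomposition.

(** * Pfister forms and diagonal forms *)

Section Pfister.
Variable K : fieldType.
Implicit Types a b c x y z : K.

(** The vanishing of I^3 on its generators, the three-fold Pfister forms, is the form in which the
    hypothesis is used. *)
Definition I3_zero := forall x y z, x != 0 -> y != 0 -> z != 0 ->
  pf x * pf y * pf z = 0.

Lemma pfM x y : pf (x * y) = pf x + pf y - pf x * pf y.
Proof. by rewrite /pf qclM; ring. Qed.

Lemma pf_sqr x : x != 0 -> pf (x ^+ 2) = 0.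
Proof. by move=> x0; rewrite /pf qcl_sqr ?subrr. Qed.

Lemma pf_opp x : x != 0 -> pf x * pf (- x) = 0.
Proof.
move=> x0; have e : qcl x * qcl (- x) = - 1 by rewrite qclN mulrN -qclM -expr2 qcl_sqr.
rewrite /pf [_ * _](_ : _ = 1 - (qcl x + qcl (- x)) + qcl x * qcl (- x)); last by ring.
by rewrite e qclN; ring.
Qed.

Lemma pf_steinberg x y : x + y = 1 -> pf x * pf y = 0.
Proof.
move=> e; have := qclD x y; rewrite e mulr1 qcl1 qclM => s.
rewrite /pf [_ * _](_ : _ = 1 - (qcl x + qcl y) + qcl x * qcl y); last by ring.
by rewrite s; ring.
Qed.

(** Norms from F(sqrt a) are similarity factors of <1, -a>: apply [qclD] to the two terms of the
    norm. *)
Lemma qcl_norm1 a x y : a != 0 -> x ^+ 2 - a * y ^+ 2 != 0 ->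
  qcl (x ^+ 2 - a * y ^+ 2) * pf a = pf a.
Proof.
move=> a0; have [->|y0] := eqVneq y 0.
  by rewrite expr0n mulr0 subr0 sqrf_eq0 => x0; rewrite qcl_sqr ?mul1r.
have aa : qcl a * qcl a = 1 by rewrite -qclM -expr2 qcl_sqr.
have [->|x0] := eqVneq x 0.
  rewrite expr0n sub0r => _; move: (y ^+ 2) (qcl_sqr y0) => Y Y1.
  by rewrite qclN qclM Y1 mulr1 /pf mulrBr mulr1 mulNr aa; ring.
move: (x ^+ 2) (qcl_sqr x0) (y ^+ 2) (qcl_sqr y0) => X X1 Y Y1 _.
have := qclD X (- (a * Y)).
by rewrite !qclM !qclN !qclM X1 Y1 !mulr1 mul1r /pf => e; rewrite [RHS]e; ring.
Qed.

(** Values of a two-fold Pfister form are similarity factors of it: with z = A - b B for norms A and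
    B, [qclD] reduces to [qcl_norm1]. *)
Lemma qcl_norm2 a b x0 x1 x2 x3 : a != 0 -> b != 0 ->
  let z := (x0 ^+ 2 - a * x1 ^+ 2) - b * (x2 ^+ 2 - a * x3 ^+ 2) in
  z != 0 -> qcl z * (pf a * pf b) = pf a * pf b.
Proof.
move=> a0 b0 z z0; pose A := x0 ^+ 2 - a * x1 ^+ 2; pose B := x2 ^+ 2 - a * x3 ^+ 2.
have bb : qcl b * qcl b = 1 by rewrite -qclM -expr2 qcl_sqr.
have [B0|B0] := eqVneq B 0.
  have zA : z = A by rewrite /z -/B B0 mulr0 subr0.
  by rewrite mulrA zA qcl_norm1 // -/A -zA.
have [A0|A0] := eqVneq A 0.
  have -> : z = - (b * B) by rewrite /z -/A A0 sub0r.
  have := qcl_norm1 a0 B0; rewrite -/B qclN qclM => e.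
  rewrite [LHS](_ : _ = - (qcl b * (1 - qcl b) * (qcl B * pf a))); last by rewrite /pf; ring.
  by rewrite e (mulrBr (qcl b)) bb /pf; ring.
have e : qcl A - qcl b * qcl B = qcl z - qcl A * qcl b * qcl B * qcl z.
  by have := qclD A (- (b * B)); rewrite -/z mulrN mulNr !qclN !qclM !mulrA.
have eA := qcl_norm1 a0 A0; have eB := qcl_norm1 a0 B0; rewrite -/A in eA; rewrite -/B in eB.
have [lhs rhs] : (qcl A - qcl b * qcl B) * pf a = pf a * pf b /\
    (qcl z - qcl A * qcl b * qcl B * qcl z) * pf a = qcl z * (pf a * pf b).
  split; first by rewrite mulrBl eA -mulrA eB /pf; ring.
  rewrite [LHS](_ : _ = qcl z * pf a - qcl z * qcl b * (qcl B * (qcl A * pf a))); last by ring.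
  by rewrite eA eB /pf; ring.
by rewrite -rhs -e lhs.
Qed.

Fixpoint dmx (s : seq K) : 'M[K]_(size s) :=
  match s with
  | [::] => 0
  | x :: s' => dsum_mx (x%:M : 'M_1) (dmx s')
  end.

Lemma good_dmx (s : seq K) : all (fun x => x != 0) s -> good (dmx s).
Proof.
elim: s => [|x s IHs] /=.
  by move=> _; apply/andP; split; [apply/eqP/matrixP => -[]|rewrite unitmxE det_mx00 unitr1].
case/andP=> x0 /IHs gs; apply: (@good_dsum K 1 (size s) x%:M (dmx s) _ gs).
by rewrite good1.
Qed.

Lemma mcl0 (M : 'M[K]_0) : mcl M = 0.
Proof.
rewrite -(witt_class0 K) -mclE; apply: mcl_congr; rewrite [M]flatmx0 /= [1%:M]flatmx0.
exact: congruent_refl.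
Qed.

Lemma mcl_dmx (s : seq K) : all (fun x => x != 0) s -> mcl (dmx s) = \sum_(x <- s) qcl x.
Proof.
elim: s => [|x s IHs] /=; first by rewrite big_nil mcl0.
case/andP=> x0 s0; rewrite big_cons -IHs //.
by rewrite -(@mcl_dsum K 1 (size s) x%:M (dmx s)) ?good_dmx ?good1.
Qed.

Lemma dsum_value m n (M : 'M[K]_m) (N : 'M[K]_n) (u v : 'rV_(m + n)) :
  u *m dsum_mx M N *m v^T =
  lsubmx u *m M *m (lsubmx v)^T + rsubmx u *m N *m (rsubmx v)^T.
Proof.
rewrite -{1}[u]hsubmxK -{1}[v]hsubmxK /dsum_mx tr_row_mx mul_row_block mul_row_col.
by rewrite !mulmx0 addr0 add0r.
Qed.

Lemma dmx_value (s : seq K) (u : 'rV[K]_(size s)) (f : nat -> K) :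
  (forall i, u 0 i = f i) ->
  (u *m dmx s *m u^T) 0 0 = \sum_(i < size s) s`_i * f i ^+ 2.
Proof.
elim: s u f => [|x s IHs] u f uf /=; first by rewrite big_ord0 mulmx0 mul0mx mxE.
rewrite -[LHS]/((u *m dsum_mx (x%:M : 'M_1) (dmx s) *m u^T) 0 0).
transitivity ((lsubmx (u : 'rV_(1 + size s)) *m x%:M *m (lsubmx (u : 'rV_(1 + size s)))^T) 0 0 +
  (rsubmx (u : 'rV_(1 + size s)) *m dmx s *m (rsubmx (u : 'rV_(1 + size s)))^T) 0 0).
  have := dsum_value (x%:M : 'M_1) (dmx s) (u : 'rV_(1 + size s)) u.
  by move/matrixP/(_ 0 0); rewrite [RHS]mxE.
rewrite big_ord_recl /=; congr (_ + _).
  rewrite mul_mx_scalar -scalemxAl mxE mxE big_ord1 !mxE.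
  by rewrite (uf (@lshift 1 (size s) 0)) /= expr2.
rewrite (IHs _ (fun i => f i.+1)) // => i.
by rewrite mxE uf.
Qed.

(** The case s = 1 of [tot_isotropic_class]. The vector is a function on [nat], so that sums over
    explicit sequences unfold. *)
Lemma dmx_isotropic (s t : seq K) :
  all (fun x => x != 0) s -> all (fun x => x != 0) t ->
  \sum_(x <- s) qcl x = \sum_(x <- t) qcl x -> (size t + 2 <= size s)%N ->
  exists f : nat -> K, (exists2 i, (i < size s)%N & f i != 0) /\
    \sum_(i < size s) s`_i * f i ^+ 2 = 0.
Proof.
move=> s0 t0 e le.
have [/eqP ss us] := andP (good_dmx s0); have [/eqP st ut] := andP (good_dmx t0).
have [||U [rU U0]] := @tot_isotropic_class K (SymForm ss us) (SymForm st ut) 1.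
- by rewrite -!mclE /= !mcl_dmx.
- exact: le.
pose u : 'rV_(size s) := U.
pose h i := oapp (u 0) 0 (insub i : option 'I_(size s)).
have uh i : u 0 i = h i by rewrite /h valK.
exists h; split; last by rewrite -(dmx_value uh) U0 mxE.
have /rV0Pn[j uj] : u != 0.
  apply/eqP => u0; move: rU; rewrite /row_free -/u u0 mxrank0; lia.
by exists j; rewrite // -uh.
Qed.

End Pfister.

(** * Symbols and quadratic extensions *)

Lemma subr_transfer (V : zmodType) (x y z t : V) : z = t -> x - y = z - t -> x = y.
Proof. by move=> ->; rewrite subrr => /eqP; rewrite subr_eq0 => /eqP. Qed.

Section Universality.
Variable K : fieldType.
Hypothesis two0 : (2 : K) != 0.
Hypothesis I3 : I3_zero K.
Implicit Types a b c x y z : K.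

Definition nrm a b x0 x1 x2 x3 := (x0 ^+ 2 - a * x1 ^+ 2) - b * (x2 ^+ 2 - a * x3 ^+ 2).

(** On the line t f + e_i, with f isotropic and f_i nonzero, the form is an affine function of t
    with nonzero slope. *)
Lemma isotropic_nrm_universal a b (f : nat -> K) i z :
  a != 0 -> b != 0 -> (i < 4)%N -> f i != 0 ->
  nrm a b (f 0) (f 1) (f 2) (f 3) = 0 ->
  exists x0 x1 x2 x3, z = nrm a b x0 x1 x2 x3.
Proof.
move=> a0 b0 i4 fi n0.
case: i i4 fi => [|[|[|[|//]]]] _ fi.
- pose t := (z - 1) / (2 * f 0%N); exists (t * f 0 + 1), (t * f 1), (t * f 2), (t * f 3).
  have -> : nrm a b (t * f 0 + 1) (t * f 1) (t * f 2) (t * f 3) =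
    t ^+ 2 * nrm a b (f 0) (f 1) (f 2) (f 3) + t * (2 * f 0) + 1 by rewrite /nrm; ring.
  by rewrite n0 /t; field; rewrite ?two0 ?fi ?oppr_eq0 ?a0 ?b0.
- pose t := (z + a) / (- a * (2 * f 1%N)); exists (t * f 0), (t * f 1 + 1), (t * f 2), (t * f 3).
  have -> : nrm a b (t * f 0) (t * f 1 + 1) (t * f 2) (t * f 3) =
    t ^+ 2 * nrm a b (f 0) (f 1) (f 2) (f 3) + t * (- a * (2 * f 1)) - a by rewrite /nrm; ring.
  by rewrite n0 /t; field; rewrite ?two0 ?fi ?oppr_eq0 ?a0 ?b0.
- pose t := (z + b) / (- b * (2 * f 2%N)); exists (t * f 0), (t * f 1), (t * f 2 + 1), (t * f 3).
  have -> : nrm a b (t * f 0) (t * f 1) (t * f 2 + 1) (t * f 3) =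
    t ^+ 2 * nrm a b (f 0) (f 1) (f 2) (f 3) + t * (- b * (2 * f 2)) - b by rewrite /nrm; ring.
  by rewrite n0 /t; field; rewrite ?two0 ?fi ?oppr_eq0 ?a0 ?b0.
- pose t := (z - a * b) / (a * b * (2 * f 3%N)); exists (t * f 0), (t * f 1), (t * f 2), (t * f 3 + 1).
  have -> : nrm a b (t * f 0) (t * f 1) (t * f 2) (t * f 3 + 1) =
    t ^+ 2 * nrm a b (f 0) (f 1) (f 2) (f 3) + t * (a * b * (2 * f 3)) + a * b by rewrite /nrm; ring.
  by rewrite n0 /t; field; rewrite ?two0 ?fi ?oppr_eq0 ?a0 ?b0.
Qed.

Lemma qcl_pf2 c x y : c != 0 -> x != 0 -> y != 0 -> qcl c * (pf x * pf y) = pf x * pf y.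
Proof.
move=> c0 x0 y0; have := I3 x0 y0 c0; rewrite {3}/pf => e.
by apply/esym/(subr_transfer e); rewrite mulrC; ring.
Qed.

(** As z <<a, b>> = <<a, b>> in W, the form <1, -a, -b, ab, -z> has the class of a form of dimension
    3 and is isotropic. If the last coordinate of the zero is nonzero, z is represented; otherwise
    the norm form is isotropic, hence universal. *)
Lemma nrm_universal a b z : a != 0 -> b != 0 -> z != 0 ->
  exists x0 x1 x2 x3, z = nrm a b x0 x1 x2 x3.
Proof.
move=> a0 b0 z0.
have [|||//|f [[i i5 fi]]] := @dmx_isotropic _ [:: 1; - a; - b; a * b; - z]
  [:: - (z * a); - (z * b); z * (a * b)].
- by rewrite /= oner_neq0 !oppr_eq0 a0 b0 z0 mulf_neq0.
- by rewrite /= !oppr_eq0 !mulf_neq0.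
- rewrite !big_cons !big_nil !qclN !qclM qcl1.
  by have := qcl_pf2 z0 a0 b0; rewrite /pf => e; apply: (subr_transfer (esym e)); ring.
rewrite /= !big_ord_recl big_ord0 /= /bump /= => E.
have {}E : nrm a b (f 0) (f 1) (f 2) (f 3) = z * f 4 ^+ 2.
  by rewrite /nrm; move: E; rewrite !add1n /= => E; apply: (subr_transfer E); ring.
have [f4|f4] := eqVneq (f 4%N) 0.
  have i4 : (i < 4)%N by move: i5 fi => /=; case: i => [|[|[|[|[|]]]]] //; rewrite f4 eqxx.
  by apply: (isotropic_nrm_universal z a0 b0 i4 fi); rewrite E f4 expr0n mulr0.
exists (f 0 / f 4), (f 1 / f 4), (f 2 / f 4), (f 3 / f 4).
have -> : nrm a b (f 0 / f 4) (f 1 / f 4) (f 2 / f 4) (f 3 / f 4) =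
  nrm a b (f 0) (f 1) (f 2) (f 3) / f 4 ^+ 2 by rewrite /nrm; field.
by rewrite E; field.
Qed.

(** Adding xyz <1, -a> to <1, -a> times <x, y, z> gives x times the Pfister form <<a, -xy, -xz>>,
    which vanishes. So the form of dimension 6 has the class of a binary form. *)
Lemma hermitian3_isotropic a x y z : a != 0 -> x != 0 -> y != 0 -> z != 0 ->
  exists f : nat -> K, (exists2 i, (i < 6)%N & f i != 0) /\
    x * (f 0 ^+ 2 - a * f 1 ^+ 2) + y * (f 2 ^+ 2 - a * f 3 ^+ 2)
      + z * (f 4 ^+ 2 - a * f 5 ^+ 2) = 0.
Proof.
move=> a0 x0 y0 z0.
have [||||f [hf E]] := @dmx_isotropic _ [:: x; - (a * x); y; - (a * y); z; - (a * z)]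
   [:: - (x * y * z); a * (x * y * z)].
- by rewrite /= !oppr_eq0 !mulf_neq0 ?x0 ?y0 ?z0.
- by rewrite /= !oppr_eq0 !mulf_neq0.
- rewrite !big_cons !big_nil !qclN !qclM.
  have xy : - (x * y) != 0 by rewrite oppr_eq0 mulf_neq0.
  have xz : - (x * z) != 0 by rewrite oppr_eq0 mulf_neq0.
  have xx : qcl x * qcl x = 1 by rewrite -qclM -expr2 qcl_sqr.
  have := congr1 (fun t => qcl x * t) (I3 a0 xy xz); rewrite mulr0 /pf !qclN !qclM => e.
  suff : (qcl x + (qcl x * qcl x) * qcl y + (qcl x * qcl x) * qcl z
    + (qcl x * qcl x) * qcl x * qcl y * qcl z) * (1 - qcl a) = 0.
    by rewrite xx => e'; apply: (subr_transfer e'); ring.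
  by rewrite -e; ring.
- by [].
exists f; split=> //; rewrite -E !big_ord_recl big_ord0 /= /bump /= !add1n /=; ring.
Qed.
End Universality.

(** A field F(sqrt a) with its coordinate functions in the basis 1, sqrt a; [qfree] makes these
    unique and prevents a from being a square in F. *)
Record quadext (F : fieldType) (a : F) := QuadExt {
  qx :> fieldType;
  qin : {rmorphism F -> qx};
  qrt : qx;
  qre : qx -> F;
  qim : qx -> F;
  qrt_sq : qrt ^+ 2 = qin a;
  qeta : forall z, z = qin (qre z) + qin (qim z) * qrt;
  qfree : forall x y, qin x + qin y * qrt = 0 -> x = 0 /\ y = 0 }.

Section QuadExtTheory.
Variables (F : fieldType) (a : F) (L : quadext a).
Local Notation i := (qin L).
Local Notation t := (qrt L).
Implicit Types (x y : F) (z w : L).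

Lemma qin_eq0 x : (i x == 0) = (x == 0).
Proof. exact: fmorph_eq0. Qed.

Lemma qcoord x y x' y' : i x + i y * t = i x' + i y' * t -> x = x' /\ y = y'.
Proof.
move=> e; have [] : x - x' = 0 /\ y - y' = 0.
  apply: (@qfree _ _ L); rewrite !rmorphB /= mulrBl addrACA -opprD e subrr //.
by move=> /eqP; rewrite subr_eq0 => /eqP-> /eqP; rewrite subr_eq0 => /eqP->.
Qed.

Lemma qreE x y : qre (i x + i y * t) = x.
Proof. by have [] := qcoord (esym (qeta (i x + i y * t))). Qed.
Lemma qimE x y : qim (i x + i y * t) = y.
Proof. by have [] := qcoord (esym (qeta (i x + i y * t))). Qed.
Lemma qre_in x : qre (i x) = x.
Proof. by rewrite -[i x]addr0 -(mul0r t) -(rmorph0 i) qreE. Qed.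
Lemma qim_in x : qim (i x) = 0.
Proof. by rewrite -[i x]addr0 -(mul0r t) -(rmorph0 i) qimE. Qed.
Lemma qreD z w : qre (z + w) = qre z + qre w.
Proof. by rewrite {1}[z]qeta {1}[w]qeta addrACA -mulrDl -!rmorphD qreE. Qed.
Lemma qimD z w : qim (z + w) = qim z + qim w.
Proof. by rewrite {1}[z]qeta {1}[w]qeta addrACA -mulrDl -!rmorphD qimE. Qed.

Lemma qmulE z w : z * w = i (qre z * qre w + a * (qim z * qim w))
  + i (qre z * qim w + qim z * qre w) * t.
Proof.
rewrite {1}[z]qeta {1}[w]qeta !rmorphD !rmorphM /= -(qrt_sq L) expr2; ring.
Qed.
Lemma qreM z w : qre (z * w) = qre z * qre w + a * (qim z * qim w).
Proof. by rewrite qmulE qreE. Qed.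
Lemma qimM z w : qim (z * w) = qre z * qim w + qim z * qre w.
Proof. by rewrite qmulE qimE. Qed.

Definition qnorm z : F := qre z ^+ 2 - a * qim z ^+ 2.

Lemma qnormM z w : qnorm (z * w) = qnorm z * qnorm w.
Proof. by rewrite /qnorm qreM qimM; ring. Qed.
Lemma qnorm_in x : qnorm (i x) = x ^+ 2.
Proof. by rewrite /qnorm qre_in qim_in; ring. Qed.
Lemma qnormE z : i (qnorm z) = z * (i (qre z) - i (qim z) * t).
Proof.
by rewrite {2}[z]qeta /qnorm rmorphB rmorphXn rmorphM rmorphXn /= -(qrt_sq L); ring.
Qed.
Lemma qnorm_eq0 z : (qnorm z == 0) = (z == 0).
Proof.
apply/eqP/eqP => [n0|->]; last by rewrite -(rmorph0 i) qnorm_in expr0n.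
have /eqP := qnormE z; rewrite n0 rmorph0 eq_sym mulf_eq0 => /orP[/eqP//|/eqP].
rewrite -mulNr -rmorphN => /qfree[r0 /eqP]; rewrite oppr_eq0 => /eqP m0.
by rewrite [z]qeta r0 m0 !rmorph0 mul0r addr0.
Qed.

Lemma quadext_two : (2 : F) != 0 -> (2 : L) != 0.
Proof. by rewrite -(rmorph_nat i) fmorph_eq0. Qed.

(* Any two elements y, z of L satisfy a linear relation f1 y + f2 z = f3     *)
(* over F, which is turned into a Steinberg relation.                        *)
Lemma quadext_symbols (V : zmodType) (Phi : witt_ring L -> V) :
  {morph Phi : x y / x - y} ->
  (forall (g : F) (z : L), g != 0 -> z != 0 -> Phi (pf (i g) * pf z) = 0) ->
  (forall (g : F) (y z : L) (w : witt_ring L), g != 0 -> y != 0 -> z != 0 ->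
    Phi (pf (i g) * pf y * pf z * w) = 0) ->
  forall y z : L, y != 0 -> z != 0 -> Phi (pf y * pf z) = 0.
Proof.
move=> PhiB H2 H3 y z y0 z0.
have Phi0 : Phi 0 = 0 by have := PhiB 0 0; rewrite !subrr.
have PhiD : {morph Phi : x y / x + y}.
  by move=> u v; rewrite -{1}[v]opprK PhiB -[- v]add0r PhiB Phi0 sub0r opprK.
have [my|my] := eqVneq (qim y) 0.
  have ey : y = i (qre y) by rewrite {1}[y]qeta my rmorph0 mul0r addr0.
  by rewrite ey H2 // -qin_eq0 -ey.
have [mz|mz] := eqVneq (qim z) 0.
  have ez : z = i (qre z) by rewrite {1}[z]qeta mz rmorph0 mul0r addr0.
  by rewrite mulrC ez H2 // -qin_eq0 -ez.
have scale1 (g : F) (u v : L) : g != 0 -> u != 0 -> v != 0 ->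
    Phi (pf (i g * u) * pf v) = Phi (pf u * pf v).
  move=> g0 u0 v0; rewrite pfM.
  have -> : (pf (i g) + pf u - pf (i g) * pf u) * pf v =
      pf u * pf v + (pf (i g) * pf v - pf (i g) * pf u * pf v * 1) by ring.
  by rewrite PhiD PhiB H2 ?H3 // subrr addr0.
have scale g1 g2 : g1 != 0 -> g2 != 0 ->
    Phi (pf (i g1 * y) * pf (i g2 * z)) = Phi (pf y * pf z).
  by move=> g10 g20; rewrite scale1 ?mulf_neq0 ?qin_eq0 // mulrC scale1 // mulrC.
pose c := qim z * qre y - qim y * qre z.
have rel : i (qim z) * y - i (qim y) * z = i c.
  by rewrite {1}[y]qeta {2}[z]qeta /c rmorphB !rmorphM /=; ring.
have [c0|c0] := eqVneq c 0.
  rewrite -(@scale (qim z) (- qim y)) ?oppr_eq0 // rmorphN mulNr.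
  have -> : i (qim y) * z = i (qim z) * y.
    by apply/esym/eqP; rewrite -subr_eq0 rel c0 rmorph0.
  by rewrite pf_opp ?Phi0 // mulf_neq0 ?qin_eq0.
rewrite -(@scale (qim z / c) (- qim y / c)) ?mulf_neq0 ?oppr_eq0 ?invr_eq0 //.
rewrite pf_steinberg ?Phi0 //.
have c0' : i c != 0 by rewrite qin_eq0.
rewrite !fmorph_div rmorphN /=; move: (i c) c0' rel => C C0 rel; apply: (mulIf C0).
by rewrite mul1r -[RHS]rel; field.
Qed.

Hypothesis two0 : (2 : F) != 0.

Lemma qcl_base f g c : I3_zero F -> f != 0 -> g != 0 -> c != 0 ->
  qcl (i c) * (pf (i f) * pf (i g)) = pf (i f) * pf (i g).
Proof.
move=> I3 f0 g0 c0; have [x0 [x1 [x2 [x3 e]]]] := nrm_universal two0 I3 f0 g0 c0.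
have ic0 : i c != 0 by rewrite qin_eq0.
move: (ic0); rewrite e /nrm !(rmorphB, rmorphXn, rmorphM) /= => nz.
by apply: qcl_norm2; rewrite ?qin_eq0.
Qed.

(** The entries of a three-fold symbol are moved into F by [quadext_symbols]. It remains that <<f,
    g>>, with f and g in F, absorbs every z in L. Since N(z) is a value of the norm form over F, the
    equation z^2 = tr(z) z - N(z) makes some nonzero F-multiple of z a value of <<f, g>> over L. *)
Lemma quadext_I3 : I3_zero F -> I3_zero L.
Proof.
move=> I3.
have trick (f g c : F) (z w1 w2 w3 w0 : L) : f != 0 -> g != 0 -> c != 0 -> z != 0 ->
    i c * z = (z + w0) ^+ 2 - i f * w1 ^+ 2 - i g * (w2 ^+ 2 - i f * w3 ^+ 2) ->
    qcl z * (pf (i f) * pf (i g)) = pf (i f) * pf (i g).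
  move=> f0 g0 c0 z0 e.
  have if0 : i f != 0 by rewrite qin_eq0.
  have ig0 : i g != 0 by rewrite qin_eq0.
  have ic0 : i c != 0 by rewrite qin_eq0.
  have nz : i c * z != 0 by rewrite mulf_neq0.
  have := @qcl_norm2 L (i f) (i g) (z + w0) w1 w2 w3 if0 ig0; rewrite /= -e => /(_ nz).
  by rewrite qclM (mulrC (qcl (i c))) -mulrA qcl_base.
have S1 (f g : F) (z : L) : f != 0 -> g != 0 -> z != 0 -> qcl z * (pf (i f) * pf (i g)) = pf (i f) * pf (i g).
  move=> f0 g0; have gen (w : L) : qre w != 0 -> qcl w * (pf (i f) * pf (i g)) = pf (i f) * pf (i g).
    move=> r0; have w0 : w != 0.
      by apply: contraNneq r0 => ->; rewrite -(rmorph0 i) qre_in.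
    have n0 : qnorm w != 0 by rewrite qnorm_eq0.
    have [x0 [x1 [x2 [x3 e]]]] := nrm_universal two0 I3 f0 g0 n0.
    (* The sign of [x0] is free; it is chosen so that the coefficient of w does not vanish. *)
    have [s [s0 es]] : exists s, 2 * (qre w + s) != 0 /\ qnorm w = nrm f g s x1 x2 x3.
      have [e0|] := eqVneq (qre w + x0) 0; last by exists x0; rewrite mulf_neq0.
      exists (- x0); split; last by rewrite e /nrm sqrrN.
      have -> : x0 = - qre w by apply/eqP; rewrite -addr_eq0 addrC e0.
      have -> : 2 * (qre w - - qre w) = 2 * (2 * qre w) by ring.
      by rewrite !mulf_neq0.
    apply: (@trick f g (2 * (qre w + s)) w (i x1) (i x2) (i x3) (i s)) => //.
    rewrite rmorphM rmorph_nat rmorphD.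
    have := congr1 i es; rewrite qnormE /nrm !(rmorphB, rmorphXn, rmorphM) /= => e'.
    have ew : i (qre w) - i (qim w) * t = 2 * i (qre w) - w.
      by rewrite {4}[w]qeta; ring.
    by move: e'; rewrite ew => e'; apply: (subr_transfer e'); ring.
  move=> z0; have [r0|/gen//] := eqVneq (qre z) 0.
  have m0 : qim z != 0.
    by apply: contraNneq z0 => m0; rewrite [z]qeta r0 m0 !rmorph0 mul0r addr0.
  have a0 : a != 0.
    apply: contraNneq z0 => a0; rewrite -qnorm_eq0 /qnorm r0 expr0n sub0r oppr_eq0.
    by rewrite [X in X * _]a0 mul0r.
  (* An element of trace 0 acquires a nonzero trace when multiplied by the square of 1 + sqrt a. *)
  have u0 : 1 + t != 0.
    apply/eqP => u0; have [] := @qfree _ _ L 1 1; first by rewrite rmorph1 mul1r.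
    by move/eqP; rewrite oner_eq0.
  rewrite -[qcl z]mulr1 -(qcl_sqr u0) -qclM gen //.
  rewrite expr2 !(qreM, qimM, qreD, qimD) r0.
  have -> : (1 : L) = i 1 by rewrite rmorph1.
  have et : t = i 0 + i 1 * t by rewrite rmorph0 rmorph1 add0r mul1r.
  have -> : qre t = 0 by rewrite et qreE.
  have -> : qim t = 1 by rewrite et qimE.
  rewrite qre_in qim_in; set E := (X in X != 0); have -> : E = 2 * (a * qim z) by rewrite /E; ring.
  by rewrite !mulf_neq0.
have S2 (f : F) (y z : L) : f != 0 -> y != 0 -> z != 0 -> pf (i f) * pf y * pf z = 0.
  move=> f0 y0 z0; rewrite -mulrA.
  have H (g : F) (w : L) : g != 0 -> w != 0 -> pf (i f) * (pf (i g) * pf w) = 0.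
    move=> g0 w0; have := S1 f g w f0 g0 w0; rewrite {3}/pf => e; rewrite mulrA mulrBr mulr1.
    by rewrite [X in _ - X]mulrC e subrr.
  apply: (@quadext_symbols _ (fun u => pf (i f) * u)) => //= [u v|g y' z' w g0 y'0 z'0]; first exact: mulrBr.
  rewrite [LHS](_ : _ = pf (i f) * (pf (i g) * pf z') * (pf y' * w)); last by ring.
  by rewrite H // !mul0r.
move=> x y z x0 y0 z0; rewrite -mulrA.
apply: (@quadext_symbols _ (fun u => pf x * u)) => //= [u v|g w g0 w0|g y' z' w g0 y'0 z'0].
- exact: mulrBr.
- by rewrite mulrA (mulrC (pf x)) S2.
by rewrite !mulrA (mulrC (pf x)) S2 // !mul0r.
Qed.

End QuadExtTheory.

Lemma quadext_exists (F : fieldType) (a : F) : (forall x, x ^+ 2 != a) ->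
  exists (L : fieldExtType F) (Q : quadext a), \dim {:L} = 2 /\ qx Q = L.
Proof.
move=> nsq; pose p : {poly F} := 'X^2 - a%:P.
have sp : size p = 3 by rewrite size_XnsubC.
have irr : irreducible_poly p.
  apply: cubic_irreducible; rewrite ?sp // => x.
  by rewrite /root !hornerE subr_eq0 nsq.
have [L dL [z rz _]] := irredp_FAdjoin irr.
have zz : z ^+ 2 = a%:A.
  move: rz; rewrite rmorphB /= map_polyXn map_polyC /root !hornerE subr_eq0 => /eqP.
  by [].
have z1 : z \notin <<[:: (1 : L)%R]>>%VS.
  rewrite span_seq1; apply/negP => /vlineP[x zx].
  have /eqP := zz; rewrite zx exprZn expr1n -subr_eq0 -scalerBl scaler_eq0 oner_eq0 orbF.
  by rewrite subr_eq0 (negPf (nsq x)).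
have fr : free [:: z; 1] by rewrite free_cons z1 free_cons span_nil memv0 oner_eq0 nil_free.
have full : <<[:: z; (1 : L)%R]>>%VS = fullv.
  by apply/eqP; rewrite eqEdim subvf /= dL sp (eqnP fr).
have ex (w : L) : exists c : F * F, w = c.1%:A + c.2%:A * z.
  have : w \in <<[:: z; (1 : L)%R]>>%VS by rewrite full memvf.
  rewrite span_cons span_seq1 => /memv_addP[_ /vlineP[y ->] [_ /vlineP[x ->] ->]].
  by exists (x, y); rewrite /= addrC mulr_algl.
have [f fP] := choice ex.
have fre x y : x%:A + y%:A * z = 0 :> L -> x = 0 /\ y = 0.
  have [->|y0] := eqVneq y 0.
    rewrite scale0r mul0r addr0 => /eqP; rewrite scaler_eq0 oner_eq0 orbF => /eqP.
    by [].
  rewrite addrC => /eqP; rewrite addr_eq0 mulr_algl => /eqP e.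
  case/negP: z1; rewrite span_seq1; apply/vlineP; exists (- y^-1 * x).
  by rewrite mulNr scaleNr -scalerA -scalerN -e scalerA mulVf // scale1r.
pose i : {rmorphism F -> L} := GRing.in_alg L.
exists L, (@QuadExt F a L i z (fun w => (f w).1) (fun w => (f w).2) zz fP fre).
by rewrite dL sp.
Qed.

(** * Skew-hermitian forms over quaternion algebras *)

(** Coordinates on 1, i, j, ij with i^2 = a and j^2 = b; the parameters only select the
    multiplication. *)
Definition quat (F : fieldType) (a b : F) : Type := (F * F * F * F)%type.

Section Quaternions.
Variables (F : fieldType) (a b : F).
Local Notation Q := (quat a b).

HB.instance Definition _ := GRing.Zmodule.copy Q (F * F * F * F)%type.

Definition q0 (x : Q) := x.1.1.1.
Definition q1 (x : Q) := x.1.1.2.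
Definition q2 (x : Q) := x.1.2.
Definition q3 (x : Q) := x.2.
Definition Q4 x0 x1 x2 x3 : Q := (x0, x1, x2, x3).

Lemma quat_eq (x y : Q) : q0 x = q0 y -> q1 x = q1 y -> q2 x = q2 y -> q3 x = q3 y -> x = y.
Proof. by rewrite /q0 /q1 /q2 /q3; case: x y => [[[? ?] ?] ?] [[[? ?] ?] ?] /= -> -> -> ->. Qed.

Definition quat_mul (x y : Q) : Q :=
  Q4 (q0 x * q0 y + a * q1 x * q1 y + b * q2 x * q2 y - a * b * q3 x * q3 y)
     (q0 x * q1 y + q1 x * q0 y - b * q2 x * q3 y + b * q3 x * q2 y)
     (q0 x * q2 y + q2 x * q0 y + a * q1 x * q3 y - a * q3 x * q1 y)
     (q0 x * q3 y + q3 x * q0 y + q1 x * q2 y - q2 x * q1 y).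

Lemma q0D (x y : Q) : q0 (x + y) = q0 x + q0 y. Proof. by []. Qed.
Lemma q1D (x y : Q) : q1 (x + y) = q1 x + q1 y. Proof. by []. Qed.
Lemma q2D (x y : Q) : q2 (x + y) = q2 x + q2 y. Proof. by []. Qed.
Lemma q3D (x y : Q) : q3 (x + y) = q3 x + q3 y. Proof. by []. Qed.
Lemma q0N (x : Q) : q0 (- x) = - q0 x. Proof. by []. Qed.
Lemma q1N (x : Q) : q1 (- x) = - q1 x. Proof. by []. Qed.
Lemma q2N (x : Q) : q2 (- x) = - q2 x. Proof. by []. Qed.
Lemma q3N (x : Q) : q3 (- x) = - q3 x. Proof. by []. Qed.
Lemma q0_0 : q0 0 = 0. Proof. by []. Qed.
Lemma q1_0 : q1 0 = 0. Proof. by []. Qed.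
Lemma q2_0 : q2 0 = 0. Proof. by []. Qed.
Lemma q3_0 : q3 0 = 0. Proof. by []. Qed.
Let qDE := (q0D, q1D, q2D, q3D).

Let quat_mulA : associative quat_mul.
Proof. by move=> x y z; apply: quat_eq; rewrite /quat_mul /Q4 /q0 /q1 /q2 /q3 /=; ring. Qed.
Let quat_mul1 : left_id (Q4 1 0 0 0) quat_mul.
Proof. by move=> x; apply: quat_eq; rewrite /quat_mul /Q4 /q0 /q1 /q2 /q3 /=; ring. Qed.
Let quat_mulr1 : right_id (Q4 1 0 0 0) quat_mul.
Proof. by move=> x; apply: quat_eq; rewrite /quat_mul /Q4 /q0 /q1 /q2 /q3 /=; ring. Qed.
Let quat_mulDl : left_distributive quat_mul +%R.
Proof.
move=> x y z; apply: quat_eq; rewrite !qDE /quat_mul ![in LHS]qDE;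
  rewrite /Q4 /q0 /q1 /q2 /q3 /=; ring.
Qed.
Let quat_mulDr : right_distributive quat_mul +%R.
Proof.
move=> x y z; apply: quat_eq; rewrite !qDE /quat_mul ![in LHS]qDE;
  rewrite /Q4 /q0 /q1 /q2 /q3 /=; ring.
Qed.
Let quat_one_neq0 : Q4 1 0 0 0 != 0.
Proof. by apply/eqP => /(congr1 q0) /eqP; rewrite /= oner_eq0. Qed.

HB.instance Definition _ := GRing.Zmodule_isNzRing.Build Q
  quat_mulA quat_mul1 quat_mulr1 quat_mulDl quat_mulDr quat_one_neq0.

Lemma q0M (x y : Q) :
  q0 (x * y) = q0 x * q0 y + a * q1 x * q1 y + b * q2 x * q2 y - a * b * q3 x * q3 y.
Proof. by []. Qed.
Lemma q1M (x y : Q) :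
  q1 (x * y) = q0 x * q1 y + q1 x * q0 y - b * q2 x * q3 y + b * q3 x * q2 y.
Proof. by []. Qed.
Lemma q2M (x y : Q) :
  q2 (x * y) = q0 x * q2 y + q2 x * q0 y + a * q1 x * q3 y - a * q3 x * q1 y.
Proof. by []. Qed.
Lemma q3M (x y : Q) :
  q3 (x * y) = q0 x * q3 y + q3 x * q0 y + q1 x * q2 y - q2 x * q1 y.
Proof. by []. Qed.
Lemma q0_1 : q0 1 = 1. Proof. by []. Qed.
Lemma q1_1 : q1 1 = 0. Proof. by []. Qed.
Lemma q2_1 : q2 1 = 0. Proof. by []. Qed.
Lemma q3_1 : q3 1 = 0. Proof. by []. Qed.

Definition qconj (x : Q) : Q := Q4 (q0 x) (- q1 x) (- q2 x) (- q3 x).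
Definition nrd (x : Q) : F := nrm a b (q0 x) (q1 x) (q2 x) (q3 x).
Definition qc (c : F) : Q := Q4 c 0 0 0.

Lemma qcE (c : F) : (q0 (qc c) = c) * (q1 (qc c) = 0) * (q2 (qc c) = 0) * (q3 (qc c) = 0).
Proof. by []. Qed.
Lemma qconjE (x : Q) : (q0 (qconj x) = q0 x) * (q1 (qconj x) = - q1 x)
  * (q2 (qconj x) = - q2 x) * (q3 (qconj x) = - q3 x).
Proof. by []. Qed.
Lemma Q4E x0 x1 x2 x3 : (q0 (Q4 x0 x1 x2 x3) = x0) * (q1 (Q4 x0 x1 x2 x3) = x1)
  * (q2 (Q4 x0 x1 x2 x3) = x2) * (q3 (Q4 x0 x1 x2 x3) = x3).
Proof. by []. Qed.

Definition qE := (q0D, q1D, q2D, q3D, q0N, q1N, q2N, q3N, q0M, q1M, q2M, q3M,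
  (q0_0, q1_0, q2_0, q3_0, q0_1, q1_1, q2_1, q3_1), qcE, qconjE, Q4E).

Local Ltac qring := apply: quat_eq; rewrite ?qE ?/nrd ?/nrm ?qE; ring.

Lemma qconjD x y : qconj (x + y) = qconj x + qconj y. Proof. by qring. Qed.
Lemma qconjN x : qconj (- x) = - qconj x. Proof. by qring. Qed.
Lemma qconjM x y : qconj (x * y) = qconj y * qconj x. Proof. by qring. Qed.
Lemma qconjK x : qconj (qconj x) = x. Proof. by qring. Qed.
Lemma qconj0 : qconj 0 = 0. Proof. by qring. Qed.
Lemma qconj1 : qconj 1 = 1. Proof. by qring. Qed.
Lemma qconj_qc c : qconj (qc c) = qc c. Proof. by qring. Qed.
Lemma mul_qconj x : x * qconj x = qc (nrd x). Proof. by qring. Qed.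
Lemma qconj_mul x : qconj x * x = qc (nrd x). Proof. by qring. Qed.
Lemma nrdM x y : nrd (x * y) = nrd x * nrd y.
Proof. by rewrite /nrd /nrm !qE; ring. Qed.
Lemma nrdD x y : nrd (x + y) = nrd x + nrd y + 2 * q0 (qconj x * y).
Proof. by rewrite /nrd /nrm !qE; ring. Qed.
Lemma nrd_qconj x : nrd (qconj x) = nrd x.
Proof. by rewrite /nrd /nrm !qE; ring. Qed.
Lemma nrdN x : nrd (- x) = nrd x.
Proof. by rewrite /nrd /nrm !qE; ring. Qed.
Lemma nrd_qc c : nrd (qc c) = c ^+ 2.
Proof. by rewrite /nrd /nrm !qE; ring. Qed.
Lemma nrd0 : nrd 0 = 0.
Proof. by rewrite /nrd /nrm !qE; ring. Qed.
Lemma qcM c d : qc (c * d) = qc c * qc d. Proof. by qring. Qed.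
Lemma qcD c d : qc (c + d) = qc c + qc d. Proof. by qring. Qed.
Lemma qcN c : qc (- c) = - qc c. Proof. by qring. Qed.
Lemma qc1 : qc 1 = 1. Proof. by []. Qed.
Lemma qc0 : qc 0 = 0. Proof. by []. Qed.
Lemma qc_comm c x : qc c * x = x * qc c. Proof. by qring. Qed.

Definition pure (x : Q) := q0 x = 0.

Lemma pureP x : (2 : F) != 0 -> qconj x = - x -> pure x.
Proof.
move=> two0 /(congr1 q0); rewrite !qE => /eqP; rewrite -addr_eq0 -mulr2n -mulr_natl mulf_eq0.
by rewrite (negPf two0) => /eqP.
Qed.
Lemma pure_conj x : pure x -> qconj x = - x.
Proof. by rewrite /pure => x0; apply: quat_eq; rewrite !qE ?x0 ?oppr0. Qed.

Lemma nrd_pureD x c : pure x -> nrd (x + qc c) = c ^+ 2 + nrd x.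
Proof. by rewrite /pure => x0; rewrite /nrd /nrm !qE x0; ring. Qed.
Lemma nrd_mulD1 x y : nrd (x * y + x) = nrd (x * y) + nrd x + 2 * q0 y * nrd x.
Proof.
by rewrite nrdD qconjM -mulrA qconj_mul -qc_comm q0M !qcE qconjE; ring.
Qed.

Definition qinv (x : Q) : Q := qc (nrd x)^-1 * qconj x.
Lemma mul_qinv x : nrd x != 0 -> x * qinv x = 1.
Proof. by move=> n0; rewrite /qinv mulrA -qc_comm -mulrA mul_qconj -qcM mulVf. Qed.
Lemma qinv_mul x : nrd x != 0 -> qinv x * x = 1.
Proof. by move=> n0; rewrite /qinv -mulrA qconj_mul -qcM mulVf. Qed.
Lemma nrd_qinv x : nrd (qinv x) = (nrd x)^-1.
Proof.
rewrite /qinv nrdM nrd_qc nrd_qconj.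
have [->|n0] := eqVneq (nrd x) 0; first by rewrite mulr0 invr0.
by field.
Qed.
Lemma qconj_qinv x : qconj (qinv x) = qinv (qconj x).
Proof. by rewrite /qinv qconjM qconj_qc nrd_qconj qc_comm. Qed.
Lemma qinvN x : qinv (- x) = - qinv x.
Proof. by rewrite /qinv nrdN qconjN mulrN. Qed.

Definition quat_division := forall x : Q, nrd x = 0 -> x = 0.

Record shs := SHS {
  sv :> zmodType;
  sact : sv -> Q -> sv;
  sh : sv -> sv -> Q;
  sactDl : forall x y c, sact (x + y) c = sact x c + sact y c;
  sactDr : forall x c d, sact x (c + d) = sact x c + sact x d;
  sactA : forall x c d, sact x (c * d) = sact (sact x c) d;
  sact1 : forall x, sact x 1 = x;
  shDr : forall x y z, sh x (y + z) = sh x y + sh x z;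
  shZr : forall x y c, sh x (sact y c) = sh x y * c;
  shC : forall x y, sh y x = - qconj (sh x y) }.

Section Frames.
Variable V : shs.
Local Notation h := (@sh V).
Local Notation "x ** c" := (@sact V x c) (at level 40, left associativity).
Hypothesis two0 : (2 : F) != 0.
Hypothesis division : quat_division.
Hypothesis anis : forall x : V, h x x = 0 -> x = 0.

Lemma shDl x y z : h (x + y) z = h x z + h y z.
Proof. by rewrite shC shDr qconjD opprD -!shC. Qed.
Lemma shZl x y c : h (x ** c) y = qconj c * h x y.
Proof. by rewrite shC shZr qconjM -mulrN -shC. Qed.
Lemma sact0 x : x ** 0 = 0.
Proof. by apply: (addrI (x ** 0)); rewrite -sactDr !addr0. Qed.
Lemma sact0l c : 0 ** c = 0 :> V.
Proof. by apply: (addrI (0 ** c)); rewrite -sactDl !addr0. Qed.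
Lemma sactN x c : x ** - c = - (x ** c).
Proof. by apply/eqP; rewrite -addr_eq0 -sactDr addNr sact0. Qed.
Lemma shNr x y : h x (- y) = - h x y.
Proof. by rewrite -[y]sact1 -sactN !shZr mulrN. Qed.
Lemma nrd_sact x c : nrd (h (x ** c) (x ** c)) = nrd c ^+ 2 * nrd (h x x).
Proof. by rewrite shZl shZr !nrdM nrd_qconj; ring. Qed.
Lemma sh0r x : h x 0 = 0.
Proof. by rewrite -(sact0 0) shZr mulr0. Qed.
Lemma sh0l x : h 0 x = 0.
Proof. by rewrite shC sh0r qconj0 oppr0. Qed.
Lemma sh_pure x : pure (h x x).
Proof. by apply: pureP => //; rewrite [in RHS]shC opprK. Qed.
Lemma sh_sym0 x y : h x y = 0 -> h y x = 0.
Proof. by move=> e; rewrite shC e qconj0 oppr0. Qed.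
Lemma nrd_neq0 (x : Q) : x != 0 -> nrd x != 0.
Proof. by apply: contra_neq => /division. Qed.
Lemma sh_neq0 x : x != 0 -> nrd (h x x) != 0.
Proof. by move=> x0; apply: nrd_neq0; apply: contra_neq x0; apply: anis. Qed.
Lemma sact_neq0 x c : x != 0 -> c != 0 -> x ** c != 0.
Proof.
move=> x0 c0; apply: contra_neq x0 => e.
by rewrite -[x]sact1 -(mul_qinv (nrd_neq0 c0)) sactA e sact0l.
Qed.

Fixpoint perp (X : seq V) (u : V) : Prop :=
  if X is x :: X' then h x u = 0 /\ perp X' u else True.

Fixpoint frame (X : seq V) : Prop :=
  if X is x :: X' then [/\ x != 0, perp X' x & frame X'] else True.

(** The double orthogonal stands for the span and avoids linear combinations over Q. *)
Definition in_span (X : seq V) (v : V) := forall u, perp X u -> h u v = 0.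

Definition disc (X : seq V) : F := \prod_(x <- X) nrd (h x x).

Definition proj_coef (x v : V) : Q := qinv (h x x) * h x v.

Lemma perpD X u v : perp X u -> perp X v -> perp X (u + v).
Proof. by elim: X => //= x X IHX [e /IHX i] [e' /i]; rewrite shDr e e' addr0. Qed.
Lemma perpZ X u c : perp X u -> perp X (u ** c).
Proof. by elim: X => //= x X IHX [e /IHX i]; rewrite shZr e mul0r. Qed.


Lemma proj_perp x v : x != 0 -> h x (v - x ** proj_coef x v) = 0.
Proof.
by move=> x0; rewrite shDr shNr shZr mulrA mul_qinv ?sh_neq0 // mul1r subrr.
Qed.

Lemma in_span_cons x X v : frame (x :: X) -> in_span (x :: X) v ->
  in_span X (v - x ** proj_coef x v).
Proof.
move=> [x0 pX fX] sv u pu.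
have -> : u = (u - x ** proj_coef x u) + x ** proj_coef x u by rewrite subrK.
rewrite shDl shZl proj_perp // mulr0 addr0 shDr shNr shZr.
have p1 : perp (x :: X) (u - x ** proj_coef x u).
  split; first exact: proj_perp.
  by apply: perpD => //; rewrite -sactN; apply: perpZ.
by rewrite sv // (sh_sym0 (proj_perp u x0)) mul0r subr0.
Qed.

Lemma in_span_nil v : in_span [::] v -> v = 0.
Proof. by move=> sv; apply: anis; apply: sv. Qed.

Lemma disc_cons x X : disc (x :: X) = nrd (h x x) * disc X.
Proof. by rewrite /disc big_cons. Qed.

Lemma disc_neq0 X : frame X -> disc X != 0.
Proof.
elim: X => [|x X IHX] /=; first by rewrite /disc big_nil oner_neq0.
by case=> x0 _ /IHX dX; rewrite disc_cons mulf_neq0 ?sh_neq0.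
Qed.

(** An exchange lemma. Write y = x c + y'; induction puts y' in a frame of the remaining span. The
    orthogonal pair x c, y' is then replaced by y and a vector z orthogonal to y. The identity A^-1
    + B^-1 = A^-1 (A + B) B^-1 shows that the discriminant changes by a square. *)
Lemma frame_rebase X y : frame X -> in_span X y -> y != 0 ->
  exists X', [/\ size X = (size X').+1, frame (y :: X'),
    (forall u, perp X u <-> perp (y :: X') u) &
    exists2 c : F, c != 0 & disc (y :: X') = c ^+ 2 * disc X].
Proof.
elim: X y => [|x X IHX] y fX sy y0; first by case/eqP: y0; apply: in_span_nil.
have [x0 px fX'] := fX.
pose c := proj_coef x y; pose y' := y - x ** c.
have yE : y = x ** c + y' by rewrite /y' addrC subrK.
have sy' : in_span X y' := in_span_cons fX sy.
have xy' : h x y' = 0 by apply: proj_perp.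
clearbody y' c.
have nx := sh_neq0 x0.
have [y'0|y'0] := eqVneq y' 0.
  have yx : y = x ** c by rewrite yE y'0 addr0.
  have c0 : c != 0 by apply: contra_neq y0 => c0; rewrite yx c0 sact0.
  have pc u : h x u = 0 <-> h y u = 0.
    rewrite yx shZl; split=> [->|e]; first by rewrite mulr0.
    have cc : nrd (qconj c) != 0 by rewrite nrd_qconj nrd_neq0.
    by rewrite -[h x u]mul1r -(qinv_mul cc) -mulrA e mulr0.
  exists X; split=> //.
  - by split=> //; rewrite yx; apply: perpZ.
  - by move=> u /=; rewrite pc.
  - exists (nrd c); first exact: nrd_neq0.
    by rewrite !disc_cons yx nrd_sact mulrA.
have [X1 [sX1 fX1 pX1 [d d0 dX1]]] := IHX y' fX' sy' y'0.
have [_ py'X1 fX1'] := fX1.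
have [c0|c0] := eqVneq c 0.
  have yy' : y = y' by rewrite yE c0 sact0 add0r.
  have pxX1 := (pX1 x).1 px.
  exists (x :: X1); rewrite yy'; split.
  - by rewrite /= sX1.
  - by split=> //; split=> //; case: pxX1.
  - by move=> u; have := pX1 u => /=; tauto.
  - exists d => //; move: dX1; rewrite !disc_cons => e; rewrite mulrCA e; ring.
pose x1 := x ** c.
have x10 : x1 != 0 by apply: sact_neq0.
have x1y' : h x1 y' = 0 by rewrite shZl xy' mulr0.
have px1 := perpZ c ((pX1 x).1 px); rewrite -/x1 in px1 yE.
have nx1 : nrd (h x1 x1) = nrd c ^+ 2 * nrd (h x x) by apply: nrd_sact.
have px1' u : h x u = 0 <-> h x1 u = 0.
  rewrite shZl; split=> [->|e]; first by rewrite mulr0.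
  have cc : nrd (qconj c) != 0 by rewrite nrd_qconj nrd_neq0.
  by rewrite -[h x u]mul1r -(qinv_mul cc) -mulrA e mulr0.
clearbody x1.
pose A := h x1 x1; pose B := h y' y'.
have nA : nrd A != 0 := sh_neq0 x10.
have nB : nrd B != 0 := sh_neq0 y'0.
have y'x1 := sh_sym0 x1y'.
have hyy : h y y = A + B.
  by rewrite yE shDl !shDr x1y' y'x1 addr0 add0r.
(* The products of [z] with [x1] and [y'] are 1 and -1, so [z] is orthogonal to their sum y. *)
pose z := x1 ** qinv A - y' ** qinv B.
have pA := pure_conj (sh_pure x1); have pB := pure_conj (sh_pure y').
have cA : qconj (qinv A) = - qinv A by rewrite qconj_qinv pA qinvN.
have cB : qconj (qinv B) = - qinv B by rewrite qconj_qinv pB qinvN.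
have hx1z : h x1 z = 1 by rewrite /z shDr shNr !shZr x1y' mul0r subr0 -/A mul_qinv.
have hy'z : h y' z = - 1 by rewrite /z shDr shNr !shZr y'x1 mul0r sub0r -/B mul_qinv.
have hyz : h y z = 0 by rewrite yE shDl hx1z hy'z subrr.
have hz u : h z u = - (qinv A * h x1 u) + qinv B * h y' u.
  by rewrite /z -sactN shDl !shZl qconjN cA cB opprK mulNr.
have hzz : h z z = - (qinv A + qinv B) by rewrite hz hx1z hy'z mulr1 mulrN1 opprD.
have nzz : nrd (h y y) * nrd (h z z) = (nrd (A + B) / (nrd A * nrd B)) ^+ 2 * (nrd A * nrd B).
  have -> : h z z = - (qinv A * (A + B) * qinv B).
    by rewrite hzz mulrDr qinv_mul // mulrDl mul1r -mulrA mul_qinv // mulr1 addrC.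
  by rewrite nrdN (nrdM _ (qinv B)) (nrdM (qinv A)) !nrd_qinv hyy; field; rewrite nA nB.
have nS : nrd (A + B) != 0 by rewrite -hyy; apply: sh_neq0.
have z0 : z != 0.
  have : (1 : Q) != 0 by exact: oner_neq0.
  by apply: contra_neq => z0; rewrite -hx1z z0 sh0r.
have perp2 u : h x1 u = 0 /\ h y' u = 0 <-> h y u = 0 /\ h z u = 0.
  rewrite hz yE shDl; split=> [[-> ->]|[e1 e2]]; first by rewrite !mulr0 oppr0 !addr0.
  have e3 : h y' u = - h x1 u by apply/eqP; rewrite -addr_eq0 addrC e1.
  suff e : h x1 u = 0 by rewrite e3 e oppr0.
  have : (qinv A * (A + B) * qinv B) * h x1 u = 0.
    rewrite mulrDr qinv_mul // mulrDl mul1r -mulrA mul_qinv // mulr1 mulrDl.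
    by move: e2; rewrite e3 mulrN -opprD => /eqP; rewrite oppr_eq0 addrC => /eqP.
  set E := _ * qinv B => e; have nE : nrd E != 0.
    by rewrite /E (nrdM _ (qinv B)) (nrdM (qinv A)) !nrd_qinv !mulf_neq0 ?invr_eq0.
  by rewrite -[h x1 u]mul1r -(qinv_mul nE) -mulrA e mulr0.
have pX1y : perp X1 y by rewrite yE; apply: perpD => //; case: px1.
exists (z :: X1); split.
- by rewrite /= sX1.
- split=> //=; first by split=> //; apply: sh_sym0.
  split=> //; rewrite /z -sactN; apply: perpD; apply: perpZ => //.
  by case: px1.
- move=> u /=; have := pX1 u; have := perp2 u; have := px1' u => /=; tauto.
- exists (nrd (A + B) / (nrd A * nrd B) * nrd c * d).
    by have nc := nrd_neq0 c0; rewrite !mulf_neq0 ?invr_eq0 ?mulf_neq0.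
  move: dX1; rewrite !disc_cons mulrA nzz -/B => e.
  have eA : nrd A = nrd c ^+ 2 * nrd (h x x) := nx1.
  move: (nrd (A + B) / _) => t; rewrite eA.
  rewrite [LHS](_ : _ = t ^+ 2 * (nrd c ^+ 2 * nrd (h x x)) * (nrd B * disc X1)); last by ring.
  by rewrite e; ring.
Qed.

End Frames.
End Quaternions.

Local Ltac qring := apply: quat_eq; rewrite ?qE ?/nrd ?/nrm ?qE; ring.

Definition is_norm (F : fieldType) (a x : F) := exists u v : F, x = u ^+ 2 - a * v ^+ 2.

Lemma is_normM (F : fieldType) (a x y : F) : is_norm a x -> is_norm a y -> is_norm a (x * y).
Proof.
move=> [u [v ->]] [u' [v' ->]].
by exists (u * u' + a * v * v'), (u * v' + v * u'); ring.
Qed.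

Lemma is_norm_sqr (F : fieldType) (a x : F) : is_norm a (x ^+ 2).
Proof. by exists x, 0; ring. Qed.

Lemma is_normV (F : fieldType) (a x : F) : is_norm a x -> is_norm a x^-1.
Proof.
have [->|x0] := eqVneq x 0; first by rewrite invr0.
by move=> nx; rewrite (_ : x^-1 = x * x^-1 ^+ 2); [apply: is_normM (is_norm_sqr _ _)|field].
Qed.

(** * Frames whose values are orthogonal to i *)

Section Planar.
Variables (F : fieldType) (a b : F) (V : shs a b).
Local Notation Q := (quat a b).
Local Notation h := (@sh F a b V).
Local Notation "x ** c" := (@sact F a b V x c) (at level 40, left associativity).
Hypothesis two0 : (2 : F) != 0.
Hypothesis a0 : a != 0.
Hypothesis b0 : b != 0.
Hypothesis division : @quat_division F a b.
Hypothesis anis : forall x : V, h x x = 0 -> x = 0.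
Implicit Types (x y z u v : V) (c d q : Q).

(* For pure q with q1 q <> 0, the vectors 1 and planar_vec q are orthogonal  *)
(* for the hermitian form F(i)-component of (x, y) |-> qconj x * q * y.      *)
Definition planar_vec (q : Q) : Q := Q4 a b (- (b * q3 q / q1 q)) (- (b * q2 q / (q1 q * a))) 1 0.

Lemma planar_value (q : Q) (f : nat -> F) : pure q -> q1 q != 0 ->
  let c := Q4 a b (f 0) (f 1) 0 0 + planar_vec q * Q4 a b (f 2) (f 3) 0 0 in
  q1 (qconj c * q * c) = q1 q * (f 0 ^+ 2 - a * f 1 ^+ 2)
     + - (b * nrd q / (q1 q * a)) * (f 2 ^+ 2 - a * f 3 ^+ 2).
Proof.
move=> pq t0 c; rewrite /c /planar_vec /nrd /nrm !qE pq.
by field; rewrite ?a0 ?t0.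
Qed.

(** On the vectors x c + y d, with c in Q and d in F(i), the component of h along i is a hermitian
    form of rank 3 over F(i), hence isotropic. *)
Lemma planar_pair x y : x != 0 -> y != 0 -> h x y = 0 -> I3_zero F ->
  exists c d, x ** c + y ** d != 0 /\ q1 (h (x ** c + y ** d) (x ** c + y ** d)) = 0.
Proof.
move=> x0 y0 xy I3; have yx := sh_sym0 xy.
have val c d : h (x ** c + y ** d) (x ** c + y ** d) = qconj c * h x x * c + qconj d * h y y * d.
  rewrite shDr !shZr !shDl !shZl xy yx !mulr0 addr0 add0r //.
have [t0|t0] := eqVneq (q1 (h x x)) 0.
  by exists 1, 0; rewrite sact0 addr0 sact1.
have [u0|u0] := eqVneq (q1 (h y y)) 0.
  by exists 0, 1; rewrite sact0 add0r sact1.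
have n0 : - (b * nrd (h x x) / (q1 (h x x) * a)) != 0.
  by rewrite oppr_eq0 !mulf_neq0 ?invr_eq0 ?mulf_neq0 ?sh_neq0.
have [f [[k k6 fk] E]] := hermitian3_isotropic I3 a0 t0 n0 u0.
pose c := Q4 a b (f 0) (f 1) 0 0 + planar_vec (h x x) * Q4 a b (f 2) (f 3) 0 0.
pose d := Q4 a b (f 4) (f 5) 0 0.
exists c, d; split.
  apply/eqP => e.
  have xc : h x (x ** c + y ** d) = h x x * c by rewrite shDr !shZr xy mul0r addr0.
  have yd : h y (x ** c + y ** d) = h y y * d by rewrite shDr !shZr yx mul0r add0r.
  have c0 : c = 0.
    by rewrite -[c]mul1r -(qinv_mul (sh_neq0 division anis x0)) -mulrA -xc e sh0r mulr0.
  have d0 : d = 0.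
    by rewrite -[d]mul1r -(qinv_mul (sh_neq0 division anis y0)) -mulrA -yd e sh0r mulr0.
  have f2 : f 2%N = 0 by have := congr1 (@q2 _ _ _) c0; rewrite !qE => <-; ring.
  have f3 : f 3%N = 0.
    by apply/eqP; rewrite -oppr_eq0; apply/eqP; have := congr1 (@q3 _ _ _) c0; rewrite !qE => <-; ring.
  have f0 : f 0%N = 0 by have := congr1 (@q0 _ _ _) c0; rewrite !qE f2 f3 => <-; ring.
  have f1 : f 1%N = 0 by have := congr1 (@q1 _ _ _) c0; rewrite !qE f2 f3 => <-; ring.
  have f4 : f 4%N = 0 by have := congr1 (@q0 _ _ _) d0; rewrite !qE.
  have f5 : f 5%N = 0 by have := congr1 (@q1 _ _ _) d0; rewrite !qE.
  by case: k k6 fk => [|[|[|[|[|[|]]]]]] //; rewrite ?f0 ?f1 ?f2 ?f3 ?f4 ?f5 eqxx.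
rewrite val q1D planar_value //; last exact: sh_pure.
by rewrite -[RHS]E; congr (_ + _); rewrite /d !qE (sh_pure two0 y); ring.
Qed.

Definition planar (X : seq V) := forall x, x \in X -> q1 (h x x) = 0.

(** Two vectors of the frame yield one planar vector, so a single vector is left unconstrained at
    the end. *)
Lemma planar_frame n X : I3_zero F -> frame X -> size X = n.+1 ->
  exists x Y, [/\ frame (x :: Y), size Y = n, planar Y,
    (forall u, perp X u <-> perp (x :: Y) u) &
    exists2 c : F, c != 0 & disc (x :: Y) = c ^+ 2 * disc X].
Proof.
move=> I3; elim: n X => [|n IHn] X.
  case: X => [|x [|]] //= fX _; exists x, [::]; split=> //.
  by exists 1; rewrite ?oner_neq0 // expr1n mul1r.
case: X => [|x1 [|x2 X]] // fX [sX].
have [x10 [x21 px] [x20 _ _]] := fX.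
have [c [d [y0 yp]]] := planar_pair x10 x20 (sh_sym0 x21) I3.
set y := _ + _ in y0 yp.
have sy : in_span (x1 :: x2 :: X) y.
  move=> u [/sh_sym0 e1 [/sh_sym0 e2 _]].
  by rewrite shDr !shZr e1 e2 !mul0r addr0.
have [X' [sX' fX' pX' [e e0 dX']]] := frame_rebase two0 division anis fX sy y0.
have [_ pyX' fX'2] := fX'.
have [|x [Y [fY sY pY pe [g g0 dY]]]] := IHn X' fX'2; first by move: sX'; rewrite /= sX => -[].
have [xy pyY] := (pe y).1 pyX'.
have [x0 pxY fY2] := fY.
exists x, (y :: Y); split.
- by split=> //; split=> //; apply: sh_sym0.
- by rewrite /= sY.
- by move=> z; rewrite inE => /orP[/eqP->|/pY].
- by move=> u; have := pX' u; have := pe u => /=; tauto.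
- exists (g * e); first exact: mulf_neq0.
  move: dX' dY; rewrite !disc_cons => eX eY.
  by rewrite mulrCA eY mulrCA eX; ring.
Qed.

Lemma planar_nrd x : q1 (h x x) = 0 -> nrd (h x x) = - b * (q2 (h x x) ^+ 2 - a * q3 (h x x) ^+ 2).
Proof. by move=> e; rewrite /nrd /nrm e (sh_pure two0 x); ring. Qed.

Lemma planar_disc X : planar X -> exists2 m, is_norm a m & disc X = (- b) ^+ size X * m.
Proof.
elim: X => [|x X IHX] pX.
  by exists 1; [rewrite -(expr1n _ 2); apply: is_norm_sqr|rewrite /disc big_nil expr0 mul1r].
have [|m nm dm] := IHX; first by move=> y yX; apply: pX; rewrite inE yX orbT.
exists ((q2 (h x x) ^+ 2 - a * q3 (h x x) ^+ 2) * m).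
  by apply: is_normM => //; exists (q2 (h x x)), (q3 (h x x)).
by rewrite disc_cons dm planar_nrd ?exprS; [ring|apply: pX; rewrite inE eqxx].
Qed.

(** On x Q the component of h along i is hermitian of rank 2 over F(i). Such a form is isotropic
    once minus its determinant is a norm, and -a is a norm. *)
Lemma planar_single x : x != 0 -> is_norm a (- b * nrd (h x x)) ->
  exists2 c, c != 0 & q1 (qconj c * h x x * c) = 0.
Proof.
move=> x0 nx; set q := h x x in nx *.
have [t0|t0] := eqVneq (q1 q) 0.
  by exists 1; [exact: oner_neq0|rewrite qconj1 mul1r mulr1].
have [u [v e]] : is_norm a (b * nrd q / (q1 q ^+ 2 * a)).
  have -> : b * nrd q / (q1 q ^+ 2 * a) = (- b * nrd q) * ((- a)^-1 * (q1 q)^-1 ^+ 2).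
    by field; rewrite ?t0 ?oppr_eq0 ?a0.
  apply: is_normM => //; apply: is_normM (is_norm_sqr _ _); apply: is_normV.
  by exists 0, 1; ring.
exists (Q4 a b u v 0 0 + planar_vec q * Q4 a b 1 0 0 0).
  apply/eqP => /(congr1 (@q2 _ _ _)); rewrite !qE => e1.
  by have /eqP := oner_neq0 F; apply; rewrite -[RHS]e1; ring.
rewrite (@planar_value q (fun i => nth 0 [:: u; v; 1; 0] i)) //=; last exact: sh_pure.
by rewrite -e; field; rewrite ?a0 ?t0.
Qed.

(** The planar part has discriminant (-b)^(2n + 1) times a norm; as the total is a square, -b times
    the norm of the last entry is a norm from F(i). *)
Lemma planar_full n (X : seq V) (s : F) : I3_zero F -> frame X -> size X = n.*2.+2 -> disc X = s ^+ 2 ->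
  exists X' : seq V, [/\ frame X', size X' = n.*2.+2, planar X' & exists s', disc X' = s' ^+ 2].
Proof.
move=> I3 fX sX dX.
have [x [Y [fY sY pY _ [c c0 dY]]]] := planar_frame I3 fX sX.
have [x0 pxY fY'] := fY.
have [m nm dm] := planar_disc pY.
have nx : is_norm a (- b * nrd (h x x)).
  have dY0 : disc Y != 0 by apply: disc_neq0.
  have -> : - b * nrd (h x x) = (disc (x :: Y)) * (m * ((- b) ^+ n.+1 / disc Y) ^+ 2).
    rewrite disc_cons; rewrite dm sY in dY0 *.
    have e1 : (- b) ^+ n.*2.+1 = - b * ((- b) ^+ n) ^+ 2 by rewrite exprS -exprM muln2.
    have bn : (- b) ^+ n != 0 by rewrite expf_neq0 ?oppr_eq0.
    have m0 : m != 0 by apply: contraNneq dY0 => ->; rewrite mulr0.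
    rewrite e1 (exprS _ n); move: ((- b) ^+ n) bn => B B0.
    by field; rewrite ?m0 ?B0 ?oppr_eq0 ?b0.
  rewrite dY dX -exprMn; apply: is_normM (is_norm_sqr _ _) _.
  exact: is_normM nm (is_norm_sqr _ _).
have [e e0 pe] := planar_single x0 nx.
exists (x ** e :: Y); split.
- split=> //; [exact: sact_neq0|exact: perpZ].
- by rewrite /= sY.
- move=> z; rewrite inE => /orP[/eqP->|/pY//].
  by rewrite shZl shZr mulrA.
- exists (nrd e * c * s); move: dY; rewrite !disc_cons nrd_sact dX => dY.
  by rewrite -mulrA dY; ring.
Qed.
End Planar.

(** * Trace forms over quadratic subfields *)

Section Transport.
Variables (F : fieldType) (a b a' b' : F) (V : shs a b).
Variables (mu : quat a' b' -> quat a b) (nu : quat a b -> quat a' b').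
Hypothesis muK : cancel mu nu.
Hypothesis nuK : cancel nu mu.
Hypothesis muD : forall x y, mu (x + y) = mu x + mu y.
Hypothesis muM : forall x y, mu (x * y) = mu x * mu y.
Hypothesis mu1 : mu 1 = 1.
Hypothesis muJ : forall x, mu (qconj x) = qconj (mu x).

Let muN x : mu (- x) = - mu x.
Proof.
apply/eqP; rewrite -addr_eq0 -muD addNr.
by apply/eqP/(addrI (mu 0)); rewrite -muD !addr0.
Qed.
Let nuD x y : nu (x + y) = nu x + nu y.
Proof. by apply: (can_inj muK); rewrite muD !nuK. Qed.
Let nuN x : nu (- x) = - nu x.
Proof. by apply: (can_inj muK); rewrite muN !nuK. Qed.
Let nuJ x : nu (qconj x) = qconj (nu x).
Proof. by apply: (can_inj muK); rewrite muJ !nuK. Qed.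
Let nuM x y : nu (x * mu y) = nu x * y.
Proof. by apply: (can_inj muK); rewrite muM !nuK. Qed.

(** The same space over another presentation of Q. Through [pres] below, a pure p off the line of i
    takes the place of i, so that statements about F(i) apply to F(p). *)
Definition transport : shs a' b'.
Proof.
apply: (@SHS F a' b' V (fun x c => sact x (mu c)) (fun x y => nu (sh x y))).
- by move=> x y c; rewrite sactDl.
- by move=> x c d; rewrite muD sactDr.
- by move=> x c d; rewrite muM sactA.
- by move=> x; rewrite mu1 sact1.
- by move=> x y z; rewrite shDr nuD.
- by move=> x y c; rewrite shZr nuM.
- by move=> x y; rewrite shC nuN nuJ.
Defined.

Lemma nu0 : nu 0 = 0.
Proof. by apply: (addrI (nu 0)); rewrite -nuD !addr0. Qed.
Lemma nu_eq0 x : nu x = 0 -> x = 0.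
Proof. by move=> e; rewrite -[x]nuK e; apply: (addrI (mu 0)); rewrite -muD !addr0. Qed.
Lemma transport_anis : (forall x : V, @sh _ _ _ V x x = 0 -> x = 0) ->
  forall x : transport, @sh _ _ _ transport x x = 0 -> x = 0.
Proof. by move=> an x /nu_eq0/an. Qed.

Lemma transport_frame (X : seq V) : frame X -> @frame _ _ _ transport X.
Proof.
have P (u : V) Y : perp Y u -> @perp _ _ _ transport Y u.
  elim: Y => //= y Y IHY [e p]; split; [exact: etrans (congr1 nu e) nu0|exact: IHY].
elim: X => //= x X IHX [x0 px fX]; split=> //; [exact: P|exact: IHX].
Qed.
End Transport.

Section Presentation.
Variables (F : fieldType) (a b t v0 v1 : F).
Let N := v0 ^+ 2 - a * v1 ^+ 2.
Let P := a * t ^+ 2 + b * N.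
Let e := - (a * b * N).
Hypothesis N0 : N != 0.
Hypothesis P0 : P != 0.

(* The presentation with generators p = t i + v j and w = i v j, for v = v0 + v1 i. *)
Definition pres_mu (x : quat P e) : quat a b :=
  Q4 a b (q0 x) (t * q1 x - b * N * q3 x) (v0 * q1 x + a * v1 * q2 x + a * t * v0 * q3 x)
    (v1 * q1 x + v0 * q2 x + a * t * v1 * q3 x).
Definition pres_nu (y : quat a b) : quat P e :=
  Q4 P e (q0 y) ((t * a * q1 y + b * (v0 * q2 y - a * v1 * q3 y)) / P)
    ((v0 * q3 y - v1 * q2 y) / N)
    ((t * (v0 * q2 y - a * v1 * q3 y) / N - q1 y) / P).

Lemma pres_muK : cancel pres_mu pres_nu.
Proof.
move=> x; have := N0; have := P0; rewrite /P /N => P0' N0'.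
by apply: quat_eq; rewrite /pres_mu /pres_nu !Q4E //; rewrite /P /N; field; rewrite ?P0' ?N0'.
Qed.
Lemma pres_nuK : cancel pres_nu pres_mu.
Proof.
move=> x; have := N0; have := P0; rewrite /P /N => P0' N0'.
by apply: quat_eq; rewrite /pres_mu /pres_nu !Q4E //; rewrite /P /N; field; rewrite ?P0' ?N0'.
Qed.
Lemma pres_muD x y : pres_mu (x + y) = pres_mu x + pres_mu y.
Proof. by apply: quat_eq; rewrite /pres_mu !qE; ring. Qed.
Lemma pres_muM x y : pres_mu (x * y) = pres_mu x * pres_mu y.
Proof. by apply: quat_eq; rewrite /pres_mu !qE /e /P /N; ring. Qed.
Lemma pres_mu1 : pres_mu 1 = 1.
Proof. by apply: quat_eq; rewrite /pres_mu !qE; ring. Qed.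
Lemma pres_muJ x : pres_mu (qconj x) = qconj (pres_mu x).
Proof. by apply: quat_eq; rewrite /pres_mu !qE; ring. Qed.
Lemma pres_nrd x : nrd (pres_mu x) = nrd x.
Proof. by rewrite /nrd /nrm /pres_mu !qE /e /P /N; ring. Qed.

Lemma pres_division : @quat_division F a b -> @quat_division F P e.
Proof.
move=> dv x; rewrite -pres_nrd => /dv e0; rewrite -[x]pres_muK e0.
by apply: quat_eq; rewrite /pres_nu !qE; ring.
Qed.

Definition pres (V : shs a b) : shs P e :=
  transport V pres_muK pres_nuK pres_muD pres_muM pres_mu1 pres_muJ.
End Presentation.

Section Trace.
Variables (F : fieldType) (a b : F) (V : shs a b) (N : quadext a).
Local Notation Q := (quat a b).
Local Notation h := (@sh F a b V).
Local Notation "x ** c" := (@sact F a b V x c) (at level 40, left associativity).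
Local Notation i := (qin N).
Local Notation th := (qrt N).
Hypothesis two0 : (2 : F) != 0.
Hypothesis division : @quat_division F a b.
Hypothesis anis : forall x : V, h x x = 0 -> x = 0.
Implicit Types (x y : V) (c d q : Q) (n m : N).

Definition emb n : Q := Q4 a b (qre n) (qim n) 0 0.

(* Writing q = c + j * n with c, n in F(i), this is n, read in N = F(sqrt a). *)
Definition jpart q : N := i (q2 q) - i (q3 q) * th.

Lemma embD n m : emb (n + m) = emb n + emb m.
Proof. by apply: quat_eq; rewrite /emb !qE ?qreD ?qimD; ring. Qed.
Lemma embM n m : emb (n * m) = emb n * emb m.
Proof. by apply: quat_eq; rewrite /emb !qE ?qreM ?qimM; ring. Qed.
Lemma emb0 : emb 0 = 0.
Proof. by rewrite /emb -(rmorph0 i) qre_in qim_in. Qed.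
Lemma emb_eq0 n : emb n = 0 -> n = 0.
Proof.
move=> e; have := congr1 (@q0 _ _ _) e; have := congr1 (@q1 _ _ _) e.
by rewrite !qE => im re; rewrite [n]qeta re im !rmorph0 mul0r addr0.
Qed.
Lemma jpartD q c : jpart (q + c) = jpart q + jpart c.
Proof. by rewrite /jpart !qE !rmorphD /=; ring. Qed.
Lemma jpart0P q : jpart q = 0 -> q2 q = 0 /\ q3 q = 0.
Proof.
rewrite /jpart -mulNr -rmorphN => /qfree[-> /eqP].
by rewrite oppr_eq0 => /eqP.
Qed.

(** The Gram matrix of (x, y) |-> [jpart] of qconj x q y on Q, as an N-space with basis 1, j. *)
Definition jform q : 'M[N]_(1 + 1) :=
  bin (jpart q) (- (i (q1 q) * th)) (- (i b * (i (q2 q) + i (q3 q) * th))).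

Lemma jform_det q : pure q ->
  jpart q * - (i b * (i (q2 q) + i (q3 q) * th)) - (- (i (q1 q) * th)) ^+ 2 = i (nrd q).
Proof.
move=> pq; rewrite /jpart /nrd /nrm pq.
rewrite !(rmorphB, rmorphXn, rmorphM, rmorph0) /= -(qrt_sq N); ring.
Qed.

Definition jclass q : witt_ring N := qcl (jpart q) * (1 + qcl (i (nrd q))).

Lemma jform_class q : pure q -> nrd q != 0 -> good (jform q) /\ mcl (jform q) = jclass q.
Proof.
move=> pq nq; have D := jform_det pq; split.
  by rewrite good_bin D qin_eq0.
by rewrite mcl_bin D ?qin_eq0 // qclM /jclass mulrDr mulr1.
Qed.

Definition jval n m : Q := emb n + Q4 a b 0 0 1 0 * emb m.

Lemma jpart_embr q n : jpart (q * emb n) = jpart q * n.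
Proof.
rewrite {2}[n]qeta /jpart !qE ?(mulr0, mul0r, addr0, add0r, subr0, sub0r, oppr0).
by rewrite ?(rmorphB, rmorphD, rmorphM, rmorphN) /= -(qrt_sq N); ring.
Qed.

Lemma jpart_embl n q : jpart (qconj (emb n) * q) = n * jpart q.
Proof.
rewrite {2}[n]qeta /jpart !qE ?(mulr0, mul0r, addr0, add0r, subr0, sub0r, oppr0).
by rewrite ?(rmorphB, rmorphD, rmorphM, rmorphN) /= -(qrt_sq N); ring.
Qed.

Lemma jval_form q n m n' m' : pure q ->
  jpart (qconj (jval n m) * q * jval n' m') =
  jpart q * n * n' - i (q1 q) * th * (n * m' + m * n')
  - i b * (i (q2 q) + i (q3 q) * th) * m * m'.
Proof.
move=> pq; rewrite /jval; set J := Q4 a b 0 0 1 0.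
have jpartQ (y z t u : F) : jpart (Q4 a b y z t u) = i t - i u * th by [].
have qJ : jpart (q * J) = - (i (q1 q) * th).
  have -> : q * J = Q4 a b (b * q2 q) (b * q3 q) 0 (q1 q).
    by apply: quat_eq; rewrite /J !qE ?pq; ring.
  by rewrite jpartQ rmorph0 sub0r.
have Jq : jpart (qconj J * q) = - (i (q1 q) * th).
  have -> : qconj J * q = Q4 a b (- (b * q2 q)) (b * q3 q) 0 (q1 q).
    by apply: quat_eq; rewrite /J !qE ?pq; ring.
  by rewrite jpartQ rmorph0 sub0r.
have JqJ : jpart (qconj J * q * J) = - (i b * (i (q2 q) + i (q3 q) * th)).
  have -> : qconj J * q * J = Q4 a b 0 (b * q1 q) (- (b * q2 q)) (b * q3 q).
    by apply: quat_eq; rewrite /J !qE ?pq; ring.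
  by rewrite jpartQ rmorphN !rmorphM /=; ring.
have -> : qconj (emb n + J * emb m) * q * (emb n' + J * emb m') =
    qconj (emb n) * (q * emb n') + qconj (emb n) * (q * J * emb m')
    + qconj (emb m) * (qconj J * q * emb n') + qconj (emb m) * (qconj J * q * J * emb m').
  by rewrite qconjD qconjM !mulrDl !mulrDr !mulrA !addrA.
by rewrite !jpartD !jpart_embl !jpart_embr qJ Jq JqJ; ring.
Qed.
End Trace.

Lemma bin_value (K : fieldType) (k c d : K) (w w' : 'rV[K]_(1 + 1)) :
  (w *m bin k c d *m w'^T) 0 0 =
  k * lsubmx w 0 0 * lsubmx w' 0 0
  + c * (lsubmx w 0 0 * rsubmx w' 0 0 + rsubmx w 0 0 * lsubmx w' 0 0)
  + d * rsubmx w 0 0 * rsubmx w' 0 0.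
Proof.
have sc (v : 'rV[K]_1) : v = (v 0 0)%:M.
  by apply/matrixP => i j; rewrite !ord1 !mxE eqxx.
rewrite -{1}[w]hsubmxK -{1}[w']hsubmxK /bin tr_row_mx mul_row_block mul_row_col.
rewrite (sc (lsubmx w)) (sc (rsubmx w)) (sc (lsubmx w')) (sc (rsubmx w')).
move: (lsubmx w 0 0) (rsubmx w 0 0) (lsubmx w' 0 0) (rsubmx w' 0 0) => x y x' y'.
by rewrite !tr_scalar_mx -!scalar_mxM -!raddfD /= -!scalar_mxM -!raddfD !mxE !eqxx !mulr1n /=; ring.
Qed.

Section TraceForm.
Variables (F : fieldType) (a b : F) (V : shs a b) (N : quadext a).
Local Notation Q := (quat a b).
Local Notation h := (@sh F a b V).
Local Notation "x ** c" := (@sact F a b V x c) (at level 40, left associativity).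
Local Notation i := (qin N).
Local Notation th := (qrt N).
Local Notation emb := (@emb F a b N).
Local Notation jpart := (@jpart F a b N).
Local Notation jval := (@jval F a b N).
Hypothesis two0 : (2 : F) != 0.
Hypothesis division : @quat_division F a b.
Hypothesis anis : forall x : V, h x x = 0 -> x = 0.
Implicit Types (x y : V) (c d q : Q) (n m : N).

Definition semilinear s (phi : 'rV[N]_s -> V) :=
  [/\ forall u v, phi (u + v) = phi u + phi v,
      forall n u, phi (n *: u) = phi u ** emb n &
      forall u, phi u = 0 -> u = 0].

Lemma jvalD n m n' m' : jval (n + n') (m + m') = jval n m + jval n' m'.
Proof. by rewrite /jval !embD mulrDr addrACA. Qed.
Lemma jvalM n m n' : jval (n' * n) (n' * m) = jval n m * emb n'.
Proof. by rewrite /jval ![n' * _]mulrC !embM mulrDl mulrA. Qed.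
Lemma jval_eq0 n m : jval n m = 0 -> n = 0 /\ m = 0.
Proof.
move=> e; split; apply: (@emb_eq0 _ a b); apply: quat_eq; rewrite /emb !qE //.
- by have := congr1 (@q0 _ _ _) e; rewrite /jval /emb !qE => <-; ring.
- by have := congr1 (@q1 _ _ _) e; rewrite /jval /emb !qE => <-; ring.
- by have := congr1 (@q2 _ _ _) e; rewrite /jval /emb !qE => <-; ring.
- apply/eqP; rewrite -oppr_eq0; apply/eqP.
  by have := congr1 (@q3 _ _ _) e; rewrite /jval /emb !qE => <-; ring.
Qed.

(** This is h_N: the orthogonal sum of the forms [jform] along the frame, with [phi] realising its
    vectors in V. *)
Lemma trace_form (X : seq V) : frame X ->
  exists (G : symform N) (phi : 'rV[N]_(form_dim G) -> V),
  [/\ form_dim G = (2 * size X)%N,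
      witt_class G = \sum_(x <- X) jclass N (h x x),
      semilinear phi,
      (forall x u, perp X x -> h x (phi u) = 0) &
      forall u v, jpart (h (phi u) (phi v)) = (u *m gram G *m v^T) 0 0].
Proof.
elim: X => [|x X IHX] /=.
  move=> _; exists (zero_form N), (fun _ => 0); split=> //.
  - by rewrite big_nil.
  - split=> [u v|n u|u _]; rewrite ?addr0 ?sact0l //.
    by apply/matrixP => ? [].
  - by move=> x u; rewrite sh0r.
  - move=> u v; rewrite sh0r /jpart !qE !rmorph0 mul0r subr0.
    by rewrite !mxE big_ord0.
case=> x0 px /IHX[G [phi [dG cG [phiD phiZ phi0] hphi jphi]]].
have nq := sh_neq0 division anis x0; have pq := sh_pure two0 x.
have [gJ cJ] := jform_class N pq nq.
have [/eqP sJ uJ] := andP gJ.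
pose f := SymForm sJ uJ.
pose psi (u : 'rV[N]_(form_dim (dsum_form f G))) : V :=
  let w : 'rV[N]_(1 + 1) := lsubmx (u : 'rV[N]_((1 + 1) + form_dim G)) in
  x ** jval (lsubmx w 0 0) (rsubmx w 0 0) + phi (rsubmx (u : 'rV[N]_((1 + 1) + form_dim G))).
exists (dsum_form f G), psi; split.
- by rewrite /= dG mulnS.
- by rewrite witt_classD big_cons -cG -(mclE f) /= cJ.
- split=> [u v|n u|u].
  + rewrite /psi !linearD /= phiD !mxE jvalD sactDr addrACA //.
  + rewrite /psi !linearZ /= phiZ !mxE jvalM sactA sactDl //.
  + pose w : 'rV[N]_(1 + 1) := lsubmx (u : 'rV_((1 + 1) + form_dim G)).
    pose u' := rsubmx (u : 'rV_((1 + 1) + form_dim G)).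
    rewrite /psi -/w -/u' => e.
    have J0 : jval (lsubmx w 0 0) (rsubmx w 0 0) = 0.
      rewrite -[LHS]mul1r -(qinv_mul nq) -mulrA -shZr.
      have -> : h x (x ** jval (lsubmx w 0 0) (rsubmx w 0 0)) = 0.
        by have := congr1 (h x) e; rewrite shDr (hphi _ _ px) addr0 sh0r.
      by rewrite mulr0.
    have [n0 m0] := jval_eq0 J0.
    move: e; rewrite J0 sact0 add0r => /phi0 u'0.
    have w0 : w = 0.
      rewrite -[w]hsubmxK -row_mx0; congr row_mx; apply/matrixP => r s;
        by rewrite !ord1 [RHS]mxE.
    by rewrite -[u](@hsubmxK _ _ (1 + 1) (form_dim G)) -/w -/u' w0 u'0 row_mx0.
- move=> y u [/sh_sym0 yx py]; rewrite /psi shDr shZr.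
  by rewrite yx mul0r add0r hphi.
- move=> u v; rewrite /psi /= dsum_value [RHS]mxE [X in _ = X + _]bin_value -jphi.
  pose w : 'rV[N]_(1 + 1) := lsubmx (u : 'rV_((1 + 1) + form_dim G)).
  pose w' : 'rV[N]_(1 + 1) := lsubmx (v : 'rV_((1 + 1) + form_dim G)).
  rewrite -/w -/w'.
  rewrite shDr !shDl jpartD !jpartD.
  have -> : h (phi (rsubmx u)) (x ** jval (lsubmx w' 0 0) (rsubmx w' 0 0)) = 0.
    by rewrite shZr shC hphi // qconj0 oppr0 mul0r.
  rewrite (_ : h (x ** _) (phi _) = 0); last by rewrite shZl hphi // mulr0.
  have j0 : jpart 0 = 0 by rewrite /jpart !qE !rmorph0 mul0r subr0.
  rewrite j0 addr0 add0r; congr (_ + _).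
  rewrite shZl shZr mulrA jval_form //; ring.
Qed.

(** A small representative of the class of h_N leaves room for an N-subspace on which h takes values
    in F(i). *)
Lemma trace_subspace s (X : seq V) (g : symform N) : frame X ->
  witt_class g = \sum_(x <- X) jclass N (h x x) -> (form_dim g + 2 * s <= 2 * size X)%N ->
  exists psi : 'rV[N]_s -> V, semilinear psi /\ forall u v, jpart (h (psi u) (psi v)) = 0.
Proof.
move=> fX cg le; have [G [phi [dG cG [phiD phiZ phi0] _ jphi]]] := trace_form fX.
have [||U [fU U0]] := @tot_isotropic_class _ G g s; rewrite ?cG ?dG //.
exists (fun u => phi (u *m U)); split.
  split=> [u v|n u|u /phi0 e]; rewrite ?mulmxDl ?phiD -?scalemxAl ?phiZ //.
  by apply/eqP; rewrite -(mulmx_free_eq0 _ fU) e.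
move=> u v; rewrite jphi trmx_mul.
have -> : u *m U *m gram G *m (U^T *m v^T) = u *m (U *m gram G *m U^T) *m v^T.
  by rewrite !mulmxA.
by rewrite U0 mulmx0 mul0mx mxE.
Qed.

(** Where h has values in F(i), so do the Gram-Schmidt coefficients, and orthogonalisation stays in
    the N-subspace. *)
Lemma proj_emb s (psi : 'rV[N]_s -> V) u v : semilinear psi ->
  (forall u v, jpart (h (psi u) (psi v)) = 0) ->
  exists n, psi v - psi u ** proj_coef (psi u) (psi v) = psi (v - n *: u).
Proof.
move=> [psiD psiZ _] j0.
have [e2 e3] := jpart0P (j0 u u); have [f2 f3] := jpart0P (j0 u v).
set c := proj_coef _ _.
have [n cE] : exists n, c = emb n.
  exists (i (q0 c) + i (q1 c) * th).
  apply: quat_eq; rewrite /emb !Q4E ?qreE ?qimE //; rewrite e2 e3 f2 f3; ring.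
exists n; have -> : v - n *: u = v + (- n) *: u by rewrite scaleNr.
rewrite cE.
rewrite psiD psiZ -sactN; congr (_ + _ ** _).
by apply/eqP; rewrite eq_sym -addr_eq0 -embD addNr emb0.
Qed.

Lemma semilinear_neq0 s (psi : 'rV[N]_s -> V) u : semilinear psi -> u != 0 -> psi u != 0.
Proof. by move=> [_ _ psi0]; apply: contra_neq => /psi0. Qed.

Lemma trace_pair (X : seq V) (g : symform N) : frame X ->
  witt_class g = \sum_(x <- X) jclass N (h x x) -> (form_dim g + 4 <= 2 * size X)%N ->
  exists x y, [/\ x != 0, y != 0, h x y = 0, jpart (h x x) = 0 & jpart (h y y) = 0].
Proof.
move=> fX cg le; have [psi [sl j0]] := @trace_subspace 2 X g fX cg le.
pose u : 'rV[N]_2 := delta_mx 0 0; pose v : 'rV[N]_2 := delta_mx 0 1.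
have u0 : psi u != 0.
  by apply: semilinear_neq0 => //; apply/rV0Pn; exists 0; rewrite !mxE oner_neq0.
have [n en] := proj_emb u v sl j0.
exists (psi u), (psi (v - n *: u)); split=> //.
  apply: semilinear_neq0 => //; apply/rV0Pn; exists 1.
  by rewrite !mxE /= mulr0 subr0 oner_neq0.
by rewrite -en proj_perp.
Qed.

Lemma trace_triple (X : seq V) (g : symform N) : frame X ->
  witt_class g = \sum_(x <- X) jclass N (h x x) -> (form_dim g + 6 <= 2 * size X)%N ->
  exists x y z, [/\ x != 0, y != 0 & z != 0] /\ [/\ h x y = 0, h x z = 0, h y z = 0 &
    [/\ jpart (h x x) = 0, jpart (h y y) = 0 & jpart (h z z) = 0]].
Proof.
move=> fX cg le; have [psi [sl j0]] := @trace_subspace 3 X g fX cg le.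
pose u : 'rV[N]_3 := delta_mx 0 0; pose v : 'rV[N]_3 := delta_mx 0 1.
pose w : 'rV[N]_3 := delta_mx 0 2.
have u0 : psi u != 0.
  by apply: semilinear_neq0 => //; apply/rV0Pn; exists 0; rewrite !mxE oner_neq0.
have [n en] := proj_emb u v sl j0; have [m em] := proj_emb u w sl j0.
have v0 : psi (v - n *: u) != 0.
  apply: semilinear_neq0 => //; apply/rV0Pn; exists 1.
  by rewrite !mxE /= mulr0 subr0 oner_neq0.
have [l el] := proj_emb (v - n *: u) (w - m *: u) sl j0.
have uv : h (psi u) (psi (v - n *: u)) = 0 by rewrite -en proj_perp.
exists (psi u), (psi (v - n *: u)), (psi (w - m *: u - l *: (v - n *: u))); split; split=> //.
- apply: semilinear_neq0 => //; apply/rV0Pn; exists 2.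
  by rewrite !mxE /= !mulr0 !subr0 !mulr0 subr0 oner_neq0.
- by rewrite -el shDr shNr shZr uv mul0r subr0 -em proj_perp.
- by rewrite -el proj_perp.
Qed.

Lemma sact_eq0 x c : x != 0 -> x ** c = 0 -> c = 0.
Proof. by move=> x0 e; apply/eqP/negPn/negP => /(sact_neq0 division x0); rewrite e eqxx. Qed.

(** The values are pure and lie in F(i), hence are multiples of i. So on F(i)-combinations h is i
    times a hermitian form of rank 3, which is isotropic. *)
Lemma no_triple x y z : I3_zero F -> a != 0 -> x != 0 -> y != 0 -> z != 0 ->
  h x y = 0 -> h x z = 0 -> h y z = 0 ->
  jpart (h x x) = 0 -> jpart (h y y) = 0 -> jpart (h z z) = 0 -> False.
Proof.
move=> I3 a0 x0 y0 z0 xy xz yz jx jy jz.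
have val (t : V) : t != 0 -> jpart (h t t) = 0 ->
    q1 (h t t) != 0 /\ h t t = Q4 a b 0 (q1 (h t t)) 0 0.
  move=> t0 /jpart0P[e2 e3]; have e : h t t = Q4 a b 0 (q1 (h t t)) 0 0.
    by apply: quat_eq; rewrite !Q4E // sh_pure.
  split=> //; apply: contraNneq t0 => e1; apply/eqP/anis.
  by rewrite e e1.
have [x1 hx] := val x x0 jx; have [y1 hy] := val y y0 jy; have [z1 hz] := val z z0 jz.
have [f [[k k6 fk] E]] := hermitian3_isotropic I3 a0 x1 y1 z1.
pose c := Q4 a b (f 0) (f 1) 0 0; pose d := Q4 a b (f 2) (f 3) 0 0; pose e := Q4 a b (f 4) (f 5) 0 0.
have yx := sh_sym0 xy; have zx := sh_sym0 xz; have zy := sh_sym0 yz.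
have v0 : x ** c + y ** d + z ** e = 0.
  apply: anis; rewrite !shDr !shDl !shZr !shZl xy xz yz yx zx zy.
  rewrite !mulr0 !mul0r !addr0 !add0r hx hy hz.
  apply: quat_eq; rewrite /c /d /e !qE; try ring.
  by rewrite -[RHS]E; ring.
have cf (t : V) (s : Q) (v w : V) : t != 0 -> h t v = 0 -> h t w = 0 ->
    t ** s + v + w = 0 -> s = 0.
  move=> t0 tv tw e0; apply: (sact_eq0 t0); have := congr1 (h t) e0.
  rewrite !shDr tv tw sh0r !addr0 shZr => e1.
  by rewrite -[s]mul1r -(qinv_mul (sh_neq0 division anis t0)) -mulrA e1 mulr0 sact0.
have c0 : c = 0 by apply: (cf x c (y ** d) (z ** e)); rewrite ?shZr ?xy ?xz ?mul0r.
have d0 : d = 0.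
  by apply: (cf y d (x ** c) (z ** e)); rewrite ?shZr ?yx ?yz ?mul0r // [y ** d + _]addrC.
have e0 : e = 0.
  by apply: (cf z e (x ** c) (y ** d)); rewrite ?shZr ?zx ?zy ?mul0r // -addrA addrC.
have f0 := congr1 (@q0 _ _ _) c0; have f1 := congr1 (@q1 _ _ _) c0.
have f2 := congr1 (@q0 _ _ _) d0; have f3 := congr1 (@q1 _ _ _) d0.
have f4 := congr1 (@q0 _ _ _) e0; have f5 := congr1 (@q1 _ _ _) e0.
rewrite !qE in f0 f1 f2 f3 f4 f5.
by case: k k6 fk => [|[|[|[|[|[|]]]]]] //; rewrite ?f0 ?f1 ?f2 ?f3 ?f4 ?f5 eqxx.
Qed.

Lemma trace_anisotropic (X : seq V) (g : symform N) : I3_zero F -> a != 0 -> frame X ->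
  witt_class g = \sum_(x <- X) jclass N (h x x) -> (form_dim g + 6 <= 2 * size X)%N -> False.
Proof.
move=> I3 a0 fX cg le; have [x [y [z [[x0 y0 z0] [xy xz yz [jx jy jz]]]]]] := trace_triple fX cg le.
exact: (no_triple I3 a0 x0 y0 z0).
Qed.
End TraceForm.

(** * Base change and transfer *)

Section ClassMap.
Variables K N : fieldType.

(** The map of Witt groups induced by an operation on Gram matrices; base change and transfer are
    its two instances. *)
Definition class_map (d : nat -> nat) (T : forall n, 'M[K]_n -> 'M[N]_(d n)) (w : witt_ring K) :=
  mcl (T _ (gram (repr w))).

Variables (d : nat -> nat) (T : forall n, 'M[K]_n -> 'M[N]_(d n)).
Hypothesis T_good : forall n (M : 'M[K]_n), good M -> good (T M).
Hypothesis T_congr : forall m n (M : 'M[K]_m) (M' : 'M[K]_n),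
  congruent M M' -> congruent (T M) (T M').
Hypothesis T_dsum : forall m n (M : 'M[K]_m) (M' : 'M[K]_n),
  congruent (T (dsum_mx M M')) (dsum_mx (T M) (T M')).
Hypothesis T_metabolic : forall n (D : 'M[K]_n), D^T = D -> mcl (T (metabolic_mx D)) = 0.

Lemma class_map_form (h : symform K) : class_map T (witt_class h) = mcl (T (gram h)).
Proof.
have E k k' : witt_equiv k k' -> mcl (T (gram k)) = mcl (T (gram k')).
  move=> [m [n [[x [D [sD cm]]] [y [D' [sD' cn]]] c]]].
  have := mcl_congr (T_congr c).
  have gT (l : symform K) : good (T (gram l)) := T_good (good_gram l).
  rewrite !(mcl_congr (T_dsum _ _)) !mcl_dsum // (mcl_congr (T_congr cm)) (mcl_congr (T_congr cn)).
  by rewrite !T_metabolic // !addr0.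
by apply: E; apply/witt_classP; rewrite witt_class_repr.
Qed.

Lemma class_mapD : {morph class_map T : x y / x + y}.
Proof.
move=> x y; rewrite -(witt_class_repr x) -(witt_class_repr y) -witt_classD !class_map_form /=.
by rewrite (mcl_congr (T_dsum _ _)) mcl_dsum ?T_good ?good_gram.
Qed.

Lemma class_map0 : class_map T 0 = 0.
Proof. by apply: (addrI (class_map T 0)); rewrite -class_mapD !addr0. Qed.

Lemma class_mapN x : class_map T (- x) = - class_map T x.
Proof. by apply/eqP; rewrite -addr_eq0 -class_mapD addNr class_map0. Qed.

Lemma class_mapB : {morph class_map T : x y / x - y}.
Proof. by move=> x y; rewrite class_mapD class_mapN. Qed.

Lemma class_map_mcl n (M : 'M[K]_n) : good M -> class_map T (mcl M) = mcl (T M).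
Proof.
move=> gM; have [h [_ ch ->]] := mcl_good gM.
by rewrite class_map_form; apply/mcl_congr/T_congr.
Qed.
End ClassMap.

Section BaseChange.
Variables (K N : fieldType) (j : {rmorphism K -> N}).

Lemma map_congruent m n (M : 'M[K]_m) (M' : 'M[K]_n) :
  congruent M M' -> congruent (map_mx j M) (map_mx j M').
Proof.
move=> [P [Q [PQ QP ->]]]; exists (map_mx j P), (map_mx j Q).
by rewrite -!map_mxM PQ QP !map_mx1 !map_mxM matrix.map_trmx.
Qed.

Lemma map_good n (M : 'M[K]_n) : good M -> good (map_mx j M).
Proof. by move=> /andP[/eqP sM uM]; rewrite /good map_unitmx uM matrix.map_trmx sM eqxx. Qed.

Definition base_change := class_map (fun n (M : 'M[K]_n) => map_mx j M).

Lemma map_dsum m n (M : 'M[K]_m) (M' : 'M[K]_n) :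
  map_mx j (dsum_mx M M') = dsum_mx (map_mx j M) (map_mx j M').
Proof. by rewrite map_block_mx !map_mx0. Qed.

Lemma map_metabolic n (D : 'M[K]_n) : D^T = D -> mcl (map_mx j (metabolic_mx D)) = 0.
Proof.
move=> sD; rewrite /metabolic_mx map_block_mx map_mx0 map_mx1.
by apply: mcl_metabolic; rewrite matrix.map_trmx sD.
Qed.

Let map_dsum_congr m n (M : 'M[K]_m) (M' : 'M[K]_n) :
  congruent (map_mx j (dsum_mx M M')) (dsum_mx (map_mx j M) (map_mx j M')).
Proof. by rewrite map_dsum; apply: congruent_refl. Qed.

Lemma base_changeD : {morph base_change : x y / x + y}.
Proof. exact: (class_mapD map_good map_congruent map_dsum_congr map_metabolic). Qed.

Lemma base_changeN x : base_change (- x) = - base_change x.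
Proof. exact: (class_mapN map_good map_congruent map_dsum_congr map_metabolic). Qed.

Lemma base_change0 : base_change 0 = 0.
Proof. exact: (class_map0 map_good map_congruent map_dsum_congr map_metabolic). Qed.

Lemma base_change_qcl x : base_change (qcl x) = qcl (j x).
Proof.
have [->|x0] := eqVneq x 0; first by rewrite qcl0 rmorph0 qcl0 base_change0.
rewrite /base_change (class_map_mcl map_good map_congruent map_dsum_congr map_metabolic) ?good1 //.
by rewrite map_scalar_mx.
Qed.

Lemma base_change_form (f : symform K) : base_change (witt_class f) = mcl (map_mx j (gram f)).
Proof. exact: (class_map_form map_good map_congruent map_dsum_congr map_metabolic). Qed.

Lemma base_change_pf2 x y : base_change (pf x * pf y) = pf (j x) * pf (j y).
Proof.
have e (L : fieldType) (u v : L) : pf u * pf v = qcl 1 - qcl u - qcl v + qcl (u * v).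
  by rewrite /pf qclM qcl1; ring.
by rewrite !e !(base_changeD, base_changeN) !base_change_qcl rmorph1 rmorphM.
Qed.

Lemma base_change_sum (I : Type) (s : seq I) (f : I -> witt_ring K) :
  base_change (\sum_(x <- s) f x) = \sum_(x <- s) base_change (f x).
Proof. by elim: s => [|x s IHs]; rewrite ?big_nil ?base_change0 // !big_cons base_changeD IHs. Qed.
End BaseChange.

(** * Transfer along a functional on a quadratic extension *)

Section Transfer.
Variables (F : fieldType) (a : F) (K : quadext a) (N : fieldType).
Variables (j : {rmorphism F -> N}) (l0 l1 : N).
Local Notation i := (qin K).
Local Notation th := (qrt K).
Definition tdisc := l1 ^+ 2 - j a * l0 ^+ 2.
Hypothesis d0 : tdisc != 0.

(** The functional x + y sqrt a |-> l0 x + l1 y. Composed with M it has, in the basis e, sqrt a e,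
    the Gram matrix [trg M] over N, while [rho] expresses K-linear maps in that basis; [tdisc] is
    minus the determinant of [trg 1] in rank one. *)
Definition tfun (z : K) : N := j (qre z) * l0 + j (qim z) * l1.
Definition trg m n (M : 'M[K]_(m, n)) : 'M[N]_(m + m, n + n) :=
  block_mx (map_mx tfun M) (map_mx tfun (th *: M))
           (map_mx tfun (th *: M)) (j a *: map_mx tfun M).
Definition rho m n (M : 'M[K]_(m, n)) : 'M[N]_(m + m, n + n) :=
  block_mx (map_mx (j \o qre (q := K)) M) (map_mx (j \o qim (q := K)) M)
    (j a *: map_mx (j \o qim (q := K)) M) (map_mx (j \o qre (q := K)) M).

Lemma qre_th : qre th = 0 :> F.
Proof. by have := qreE K 0 1; rewrite rmorph0 rmorph1 add0r mul1r. Qed.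
Lemma qim_th : qim th = 1 :> F.
Proof. by have := qimE K 0 1; rewrite rmorph0 rmorph1 add0r mul1r. Qed.

Lemma tfunD : {morph tfun : x y / x + y}.
Proof. by move=> x y; rewrite /tfun qreD qimD !rmorphD; ring. Qed.
Lemma tfun0 : tfun 0 = 0.
Proof. by rewrite /tfun -(rmorph0 i) qre_in qim_in rmorph0 !mul0r addr0. Qed.
Lemma tfunM x y : tfun (x * y) = j (qre x) * tfun y + j (qim x) * tfun (th * y).
Proof. by rewrite /tfun !qreM !qimM qre_th qim_th !(rmorphD, rmorphM, rmorph0, rmorph1); ring. Qed.
Lemma tfun_th x : tfun (th * (th * x)) = j a * tfun x.
Proof. by rewrite /tfun !(qreM, qimM) qre_th qim_th !(rmorphD, rmorphM, rmorph0, rmorph1); ring. Qed.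
Lemma tfun_sum (I : Type) (s : seq I) (P : pred I) (f : I -> K) :
  tfun (\sum_(x <- s | P x) f x) = \sum_(x <- s | P x) tfun (f x).
Proof. exact: (big_morph _ tfunD tfun0). Qed.

Lemma trg_mul m n p (P : 'M[K]_(m, n)) (M : 'M[K]_(n, p)) :
  trg (P *m M) = rho P *m trg M.
Proof.
have E0 : map_mx tfun (P *m M) = map_mx (j \o qre (q := K)) P *m map_mx tfun M
    + map_mx (j \o qim (q := K)) P *m map_mx tfun (th *: M).
  apply/matrixP=> r s; rewrite !mxE tfun_sum -big_split; apply: eq_bigr => k _.
  by rewrite !mxE tfunM.
have E1 : map_mx tfun (th *: (P *m M)) = map_mx (j \o qre (q := K)) P *m map_mx tfun (th *: M)
    + map_mx (j \o qim (q := K)) P *m (j a *: map_mx tfun M).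
  apply/matrixP=> r s; rewrite !mxE mulr_sumr tfun_sum -big_split; apply: eq_bigr => k _.
  by rewrite !mxE (mulrCA th) (tfunM (P r k)) tfun_th.
rewrite /trg /rho mulmx_block -E0 -E1; congr block_mx.
- by rewrite E1 -scalemxAl -scalemxAr addrC.
- by rewrite E0 scalerDr -!scalemxAl -scalemxAr addrC.
Qed.

Lemma trg_tr m n (M : 'M[K]_(m, n)) : (trg M)^T = trg M^T.
Proof. by rewrite /trg tr_block_mx linearZ /= !matrix.map_trmx linearZ. Qed.

Lemma rhoM m n p (P : 'M[K]_(m, n)) (Q : 'M[K]_(n, p)) : rho (P *m Q) = rho P *m rho Q.
Proof.
rewrite /rho mulmx_block; congr block_mx; apply/matrixP=> r s; rewrite !mxE /=.
- rewrite (big_morph _ (@qreD _ _ K) (_ : qre 0 = 0)) ?rmorph_sum -?big_split /=; last first.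
    by rewrite -(rmorph0 i) qre_in.
  by apply: eq_bigr => k _; rewrite !mxE qreM rmorphD !rmorphM /=; ring.
- rewrite (big_morph _ (@qimD _ _ K) (_ : qim 0 = 0)) ?rmorph_sum -?big_split /=; last first.
    by rewrite -(rmorph0 i) qim_in.
  by apply: eq_bigr => k _; rewrite !mxE qimM rmorphD !rmorphM /=; ring.
- rewrite (big_morph _ (@qimD _ _ K) (_ : qim 0 = 0)) ?rmorph_sum ?mulr_sumr -?big_split /=; last first.
    by rewrite -(rmorph0 i) qim_in.
  by apply: eq_bigr => k _; rewrite !mxE qimM rmorphD !rmorphM /=; ring.
- rewrite (big_morph _ (@qreD _ _ K) (_ : qre 0 = 0)) ?rmorph_sum -?big_split /=; last first.
    by rewrite -(rmorph0 i) qre_in.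
  by apply: eq_bigr => k _; rewrite !mxE qreM rmorphD !rmorphM /=; ring.
Qed.

Lemma rho1 n : rho (1%:M : 'M[K]_n) = 1%:M.
Proof.
rewrite /rho scalar_mx_block; congr block_mx; apply/matrixP=> r s; rewrite !mxE /=.
all: case: (r == s); rewrite /= ?mulr1n ?mulr0n -?(rmorph1 i) -?(rmorph0 i).
all: by rewrite ?qre_in ?qim_in ?rmorph1 ?rmorph0 ?mulr0.
Qed.

Lemma trg_congr m n (M : 'M[K]_m) (M' : 'M[K]_n) :
  congruent M M' -> congruent (trg M) (trg M').
Proof.
move=> [P [Q [PQ QP ->]]]; exists (rho P), (rho Q); split.
- by rewrite -rhoM PQ rho1.
- by rewrite -rhoM QP rho1.
- rewrite -[_ *m P^T]trmxK -trg_tr trmx_mul trmxK trg_mul trmx_mul; congr (_ *m _).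
  by rewrite -trg_mul trg_tr trmxK.
Qed.

Lemma trg1_unit n : trg (1%:M : 'M[K]_n) \in unitmx.
Proof.
have tc (z : K) : map_mx tfun (z%:M : 'M_n) = (tfun z)%:M.
  apply/matrixP=> r s; rewrite !mxE; case: (r == s); rewrite ?mulr1n ?mulr0n //.
  exact: tfun0.
rewrite /trg scale_scalar_mx mulr1 !tc.
have -> : tfun 1 = l0 by rewrite /tfun -(rmorph1 i) qre_in qim_in rmorph1 rmorph0 mul1r mul0r addr0.
have -> : tfun th = l1 by rewrite /tfun qre_th qim_th rmorph0 rmorph1 mul0r mul1r add0r.
rewrite scale_scalar_mx.
suff /mulmx1_unit[] : block_mx l0%:M l1%:M l1%:M (j a * l0)%:M *m
    block_mx (- (j a * l0) / tdisc)%:M (l1 / tdisc)%:M (l1 / tdisc)%:M (- l0 / tdisc)%:M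
    = 1%:M :> 'M_(n + n) by [].
rewrite mulmx_block -!scalar_mxM -!raddfD scalar_mx_block -(raddf0 (@scalar_mx N n)).
have d0' := d0; rewrite /tdisc in d0'.
by congr block_mx; congr _%:M; rewrite /tdisc; field.
Qed.

Lemma trg_good n (M : 'M[K]_n) : good M -> good (trg M).
Proof.
move=> /andP[/eqP sM uM]; rewrite /good trg_tr sM eqxx /=.
rewrite -[M]mulmx1 trg_mul unitmx_mul trg1_unit andbT.
suff /mulmx1_unit[] : rho M *m rho (invmx M) = 1%:M by [].
by rewrite -rhoM mulmxV // rho1.
Qed.

Lemma trg_block m n (A : 'M[K]_m) (B : 'M[K]_(m, n)) (C : 'M[K]_(n, m)) (D : 'M[K]_n) :
  congruent (trg (block_mx A B C D)) (block_mx (trg A) (trg B) (trg C) (trg D)).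
Proof.
pose k (x : ('I_m + 'I_n) + ('I_m + 'I_n)) : ('I_m + 'I_m) + ('I_n + 'I_n) :=
  match x with
  | inl (inl r) => inl (inl r) | inl (inr r) => inr (inl r)
  | inr (inl r) => inl (inr r) | inr (inr r) => inr (inr r) end.
apply: (@congruent_reindex N (('I_m + 'I_n) + ('I_m + 'I_n)) (('I_m + 'I_m) + ('I_n + 'I_n)) _ _ _ _
  (@unsplit _ _ \o sum_fun (@unsplit _ _) (@unsplit _ _))
  (@unsplit _ _ \o sum_fun (@unsplit _ _) (@unsplit _ _)) k).
- by apply: bij_comp; [exact: unsplit_bij|apply: sum_fun_bij; exact: unsplit_bij].
- by apply: bij_comp; [exact: unsplit_bij|apply: sum_fun_bij; exact: unsplit_bij].
- exists (fun x => match x with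
    | inl (inl r) => inl (inl r) | inl (inr r) => inr (inl r)
    | inr (inl r) => inl (inr r) | inr (inr r) => inr (inr r) end); by case=> [[]|[]].
- rewrite /trg scale_block_mx !map_block_mx scale_block_mx.
  by case=> [[r|r]|[r|r]] [[s|s]|[s|s]] /=;
    rewrite !(block_mxEul, block_mxEur, block_mxEdl, block_mxEdr).
Qed.

Lemma trg0 m n : trg (0 : 'M[K]_(m, n)) = 0.
Proof.
have z : map_mx tfun (0 : 'M[K]_(m, n)) = 0.
  by apply/matrixP=> r s; rewrite !mxE tfun0.
by rewrite /trg scaler0 z scaler0 block_mx0.
Qed.

Lemma trg_dsum m n (M : 'M[K]_m) (M' : 'M[K]_n) :
  congruent (trg (dsum_mx M M')) (dsum_mx (trg M) (trg M')).
Proof. by have := trg_block M 0 0 M'; rewrite !trg0. Qed.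

Lemma trg_metabolic n (D : 'M[K]_n) : D^T = D -> mcl (trg (metabolic_mx D)) = 0.
Proof.
move=> sD; rewrite (mcl_congr (trg_block _ _ _ _)) trg0.
set B := trg 1%:M; have uB : B \in unitmx := trg1_unit n.
have BT : B^T = B by rewrite trg_tr trmx1.
suff /mcl_congr-> : congruent (block_mx 0 B B (trg D)) (metabolic_mx (trg D)).
  by apply: mcl_metabolic; rewrite trg_tr sD.
apply: (@congruent_unit _ _ (block_mx B 0 0 1%:M)).
  by rewrite unitmxE det_lblock unitrM -unitmxE uB det1 unitr1.
rewrite tr_block_mx !trmx0 /metabolic_mx !mulmx_block.
by rewrite !(mul0mx, mulmx0, addr0, add0r, mul1mx, mulmx1, trmx1) BT.
Qed.

Definition transfer : witt_ring K -> witt_ring N := class_map (fun n (M : 'M[K]_n) => trg M).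

Lemma transferB : {morph transfer : x y / x - y}.
Proof. exact: (class_mapB trg_good trg_congr trg_dsum trg_metabolic). Qed.
Lemma transferD : {morph transfer : x y / x + y}.
Proof. exact: (class_mapD trg_good trg_congr trg_dsum trg_metabolic). Qed.
Lemma transfer0 : transfer 0 = 0.
Proof. exact: (class_map0 trg_good trg_congr trg_dsum trg_metabolic). Qed.

Lemma transfer_qcl z : transfer (qcl z) = qcl (tfun z) * pf (tdisc * j (qnorm z)).
Proof.
have [->|z0] := eqVneq z 0; first by rewrite qcl0 transfer0 tfun0 qcl0 mul0r.
rewrite /transfer (class_map_mcl trg_good trg_congr trg_dsum trg_metabolic) ?good1 //.
have tc (w : K) : map_mx tfun (w%:M : 'M_1) = (tfun w)%:M.
  by apply/matrixP=> r s; rewrite !mxE !ord1 eqxx.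
have -> : trg (z%:M : 'M_1) = bin (tfun z) (tfun (th * z)) (j a * tfun z).
  by rewrite /trg scale_scalar_mx !tc scale_scalar_mx.
have D : tfun z * (j a * tfun z) - tfun (th * z) ^+ 2 = - (tdisc * j (qnorm z)).
  rewrite /tfun /tdisc /qnorm !qreM !qimM qre_th qim_th.
  by rewrite !(rmorphB, rmorphXn, rmorphD, rmorphM, rmorph0, rmorph1) /=; ring.
rewrite mcl_bin D; last by rewrite oppr_eq0 mulf_neq0 ?fmorph_eq0 ?qnorm_eq0.
by rewrite mulrN qclN qclM /pf mulrBr mulr1.
Qed.

(* If tfun z = 0 then tdisc * j (qnorm z) is the square of tfun (th * z).    *)
Lemma pf_transfer g z : I3_zero N -> g != 0 -> z != 0 ->
  pf g * transfer (qcl z) = pf g * pf (tdisc * j (qnorm z)).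
Proof.
move=> I3 g0 z0; have nz : j (qnorm z) != 0 by rewrite fmorph_eq0 qnorm_eq0.
rewrite transfer_qcl; have [t0|t0] := eqVneq (tfun z) 0; last first.
  by rewrite mulrCA qcl_pf2 // mulf_neq0.
have D : tdisc * j (qnorm z) = tfun (th * z) ^+ 2.
  have : tdisc * j (qnorm z) = tfun (th * z) ^+ 2 - tfun z * (j a * tfun z).
    rewrite /tfun /tdisc /qnorm !qreM !qimM qre_th qim_th.
    by rewrite !(rmorphB, rmorphXn, rmorphD, rmorphM, rmorph0, rmorph1) /=; ring.
  by rewrite t0 mul0r subr0.
rewrite D pf_sqr ?mulr0 ?t0 ?qcl0 ?mul0r ?mulr0 //.
by rewrite -sqrf_eq0 -D mulf_neq0.
Qed.
End Transfer.

(** * Similarity factors *)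

Section DivisionFacts.
Variables (F : fieldType) (a b : F).
Hypothesis division : @quat_division F a b.

Lemma division_nonsquare x : x ^+ 2 != a.
Proof.
apply/eqP => e; have := division (x := Q4 a b x 1 0 0).
rewrite /nrd /nrm !Q4E e => /(_ _)/(congr1 (@q1 _ _ _)) h.
by have /eqP := oner_neq0 F; apply; apply: h; ring.
Qed.
Lemma division_a0 : a != 0.
Proof. by have := division_nonsquare 0; rewrite expr0n eq_sym. Qed.
Lemma division_b0 : b != 0.
Proof.
apply/eqP => e; have := division (x := Q4 a b 0 0 1 0).
rewrite /nrd /nrm !Q4E e => /(_ _)/(congr1 (@q2 _ _ _)) h.
by have /eqP := oner_neq0 F; apply; apply: h; ring.
Qed.
Lemma division_norm0 x y : x ^+ 2 - a * y ^+ 2 = 0 -> x = 0 /\ y = 0.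
Proof.
move=> e; have h : Q4 a b x y 0 0 = 0.
  by apply: division; rewrite /nrd /nrm !Q4E e; ring.
by split; [exact: (congr1 (@q0 _ _ _) h)|exact: (congr1 (@q1 _ _ _) h)].
Qed.
Lemma division_quadext : exists N : quadext a, True.
Proof. by have [L [N _]] := quadext_exists division_nonsquare; exists N. Qed.
End DivisionFacts.

Section TraceClass.
Variables (F : fieldType) (a b : F) (N : quadext a).
Local Notation i := (qin N).
Local Notation th := (qrt N).
Hypothesis two0 : (2 : F) != 0.
Implicit Types (q : quat a b) (y : F).

(* If jpart q = 0 then -nrd q = q ^ 2 becomes a square in N.                 *)
Lemma pf_jclass g q : I3_zero N -> pure q -> nrd q != 0 -> g != 0 ->
  pf g * jclass N q = pf g * pf (i (- nrd q)).
Proof.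
move=> I3 pq nq g0; rewrite /jclass.
have -> : 1 + qcl (i (nrd q)) = pf (i (- nrd q)) by rewrite /pf rmorphN qclN opprK.
have in0 : i (- nrd q) != 0 by rewrite qin_eq0 oppr_eq0.
have [z0|z0] := eqVneq (jpart N q) 0; last by rewrite mulrCA qcl_pf2.
have [e2 e3] := jpart0P z0.
have -> : i (- nrd q) = (th * i (q1 q)) ^+ 2.
  rewrite /nrd /nrm pq e2 e3 exprMn qrt_sq -(rmorphXn i) -(rmorphM i); congr (i _); ring.
rewrite pf_sqr ?mulr0 // -sqrf_eq0.
have : i (- nrd q) != 0 by [].
rewrite /nrd /nrm pq e2 e3 [X in i X](_ : _ = a * q1 q ^+ 2); last by ring.
by rewrite exprMn qrt_sq -(rmorphXn i) -(rmorphM i).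
Qed.

(** Multiplied by [pf g], the cross terms of [pfM] fall into I^3. *)
Lemma pf_prod (K : fieldType) (I : Type) (s : seq I) (f : I -> K) (g : K) : I3_zero K -> g != 0 ->
  all (fun x => f x != 0) s ->
  pf g * pf (\prod_(x <- s) f x) = \sum_(x <- s) pf g * pf (f x).
Proof.
move=> I3 g0; elim: s => [|x s IHs] /=.
  by move=> _; rewrite !big_nil /pf qcl1; ring.
case/andP=> x0 s0; rewrite !big_cons pfM -IHs //.
rewrite mulrBr mulrDr mulrA I3 ?subr0 //.
by rewrite prodf_seq_neq0.
Qed.
End TraceClass.

Section Multiplier.
Variables (F : fieldType) (a b : F) (V : shs a b).
Local Notation h := (@sh F a b V).
Local Notation "x ** c" := (@sact F a b V x c) (at level 40, left associativity).
Hypothesis two0 : (2 : F) != 0.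
Hypothesis I3 : I3_zero F.
Hypothesis division : @quat_division F a b.
Hypothesis anis : forall x : V, h x x = 0 -> x = 0.
Implicit Types (x : V) (X : seq V).

Lemma frame_all X : frame X -> all (fun x => nrd (h x x) != 0) X.
Proof. by elim: X => //= x X IHX [x0 _ /IHX->]; rewrite sh_neq0. Qed.

(* The similarity factors y of x1 _|_ x3 _|_ X are the norms from the        *)
(* discriminant extension; hence x1 _|_ x2 _|_ x3 _|_ X has the same class   *)
(* of traces as y times X, which has 6 dimensions less over F(sqrt a).       *)
Lemma no_multiplier_diag x1 x2 x3 X (N : quadext a) y m n : frame (x1 :: x2 :: x3 :: X) ->
  jpart N (h x3 x3) = 0 -> h x2 x2 = qc a b (- y) * h x1 x1 -> y != 0 ->
  y = m ^+ 2 - (\prod_(x <- x1 :: x3 :: X) - nrd (h x x)) * n ^+ 2 -> False.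
Proof.
move=> fX j3 e2 y0 ey; have [x10 [x21 px1] [x20 px2 [x30 px3 fX3]]] := fX.
have I3N : I3_zero N := quadext_I3 two0 I3.
have [G [phi [dG cG _ _ _]]] := trace_form N two0 division anis fX3.
have gy : good ((qin N y)%:M : 'M_1) by rewrite good1 qin_eq0.
have [f [df _ cf]] := mcl_good gy.
have a0 := division_a0 division.
apply: (@trace_anisotropic F a b V N two0 division anis _ (tens_form f G) I3 a0 fX); last first.
  by rewrite /= df dG; lia.
rewrite witt_classM -cf -/(qcl _) cG !big_cons.
have J3 : jclass N (h x3 x3) = 0 by rewrite /jclass j3 qcl0 mul0r.
have J2 : jclass N (h x2 x2) = - (qcl (qin N y) * jclass N (h x1 x1)).
  rewrite e2 /jclass nrdM nrd_qc sqrrN rmorphM qclM rmorphXn qcl_sqr ?qin_eq0 // mul1r.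
  have -> : jpart N (qc a b (- y) * h x1 x1) = - (qin N y * jpart N (h x1 x1)).
    by rewrite /jpart !qE !(rmorphD, rmorphB, rmorphM, rmorphN, rmorph0) /=; ring.
  by rewrite qclN qclM !mulNr mulrA.
rewrite J2 J3.
set S := \sum_(x <- X) _; set J := jclass N (h x1 x1).
suff : pf (qin N y) * (J + S) = 0.
  by rewrite /pf => e; apply: (subr_transfer (esym e)); ring.
have fX' : frame (x1 :: x3 :: X) by split=> //; case: px1.
have D0 : all (fun x => qin N (- nrd (h x x)) != 0) (x1 :: x3 :: X).
  apply: sub_all (frame_all fX') => x; by rewrite qin_eq0 oppr_eq0.
have : pf (qin N y) * pf (qin N (\prod_(x <- x1 :: x3 :: X) - nrd (h x x))) = 0.
  set D := \prod_(x <- _) _ in ey *.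
  have Dn : D != 0.
    rewrite /D prodf_seq_neq0; apply: sub_all (frame_all fX') => x /=.
    by rewrite oppr_eq0.
  have eN : qin N y = qin N m ^+ 2 - qin N D * qin N n ^+ 2.
    by rewrite {1}ey rmorphB rmorphXn rmorphM rmorphXn.
  have := @qcl_norm1 N (qin N D) (qin N m) (qin N n).
  rewrite -eN !qin_eq0 => /(_ Dn y0) e.
  by rewrite {1}/pf mulrBl mul1r e subrr.
rewrite rmorph_prod pf_prod ?qin_eq0 // !big_cons => e.
have pj x : x != 0 -> pf (qin N y) * pf (qin N (- nrd (h x x))) = pf (qin N y) * jclass N (h x x).
  move=> x0; rewrite pf_jclass ?qin_eq0 //; [exact: sh_pure|exact: sh_neq0].
rewrite !pj // J3 mulr0 add0r in e.
rewrite mulrDr -[RHS]e; congr (_ + _); rewrite /S mulr_sumr.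
elim: {S e fX D0 fX' dG cG phi G} X {px1 px2 px3} fX3 ey => [|x X IHX] => [_ _|[x0 _ fX] _].
  by rewrite !big_nil.
rewrite !big_cons pj //; congr (_ + _).
elim: X {IHX} fX => [|z Z IHZ] => [_|[z0 _ fZ]]; first by rewrite !big_nil.
by rewrite !big_cons pj // IHZ.
Qed.
End Multiplier.

Section GeneralMultiplier.
Variables (F : fieldType) (a b : F) (V : shs a b).
Local Notation h := (@sh F a b V).
Hypothesis two0 : (2 : F) != 0.
Hypothesis I3 : I3_zero F.
Hypothesis division : @quat_division F a b.
Hypothesis anis : forall x : V, h x x = 0 -> x = 0.

Lemma pres_nrd_nu t v0 v1 (N0 : v0 ^+ 2 - a * v1 ^+ 2 != 0)
    (P0 : a * t ^+ 2 + b * (v0 ^+ 2 - a * v1 ^+ 2) != 0) (q : quat a b) :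
  nrd (pres_nu t v0 v1 q) = nrd q.
Proof. by rewrite -{2}[q](pres_nuK N0 P0) pres_nrd. Qed.

(** In the presentation generated by the value of h at x3 this value is the new i, and
    [no_multiplier_diag] applies. If it is a multiple of i already, the given presentation
    serves. *)
Lemma no_multiplier (x1 x2 x3 : V) (X : seq V) (y m n : F) : frame (x1 :: x2 :: x3 :: X) ->
  h x2 x2 = qc a b (- y) * h x1 x1 -> y != 0 ->
  y = m ^+ 2 - (\prod_(x <- x1 :: x3 :: X) - nrd (h x x)) * n ^+ 2 -> False.
Proof.
move=> fX e2 y0 ey; have [x10 _ [x20 _ [x30 _ _]]] := fX.
set p := h x3 x3; pose t := q1 p; pose v0 := q2 p; pose v1 := q3 p.
have p3 : pure p by exact: sh_pure.
have [N0|N0] := eqVneq (v0 ^+ 2 - a * v1 ^+ 2) 0.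
  have [v00 v10] := division_norm0 division N0.
  have [N _] := division_quadext division.
  apply: (no_multiplier_diag two0 I3 division anis (N := N) fX _ e2 y0 ey).
  by rewrite /jpart -/p -/v0 -/v1 v00 v10 !rmorph0 mul0r subr0.
have P0 : a * t ^+ 2 + b * (v0 ^+ 2 - a * v1 ^+ 2) != 0.
  rewrite (_ : _ + _ = - nrd p) ?oppr_eq0 ?sh_neq0 //.
  by rewrite /nrd /nrm p3 -/t -/v0 -/v1; ring.
have dv' := pres_division N0 P0 division.
have [N _] := division_quadext dv'.
pose V' := pres N0 P0 V.
have an' : forall x : V', @sh _ _ _ V' x x = 0 -> x = 0 by apply: transport_anis.
have fX' : @frame _ _ _ V' (x1 :: x2 :: x3 :: X) by apply: transport_frame.
apply: (no_multiplier_diag two0 I3 dv' an' (N := N) (y := y) (m := m) (n := n) fX' _ _ y0).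
- have -> : @sh _ _ _ V' x3 x3 = pres_nu t v0 v1 p by [].
  have j2 : q2 (pres_nu t v0 v1 p) = 0.
    by rewrite /pres_nu Q4E -/v0 -/v1 (mulrC v1) subrr mul0r.
  have j3 : q3 (pres_nu t v0 v1 p) = 0.
    rewrite /pres_nu Q4E -/v0 -/v1 -/t -!expr2 (_ : v0 * v0 - a * v1 * v1 = v0 ^+ 2 - a * v1 ^+ 2); last by ring.
    by rewrite mulfK // subrr mul0r.
  by rewrite /jpart j2 j3 !rmorph0 mul0r subr0.
- have -> : @sh _ _ _ V' x2 x2 = pres_nu t v0 v1 (h x2 x2) by [].
  have -> : @sh _ _ _ V' x1 x1 = pres_nu t v0 v1 (h x1 x1) by [].
  by rewrite e2 /pres_nu; apply: quat_eq; rewrite !qE; ring.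
- rewrite {1}ey; congr (_ - _ * _); apply: eq_bigr => x _.
  by rewrite -(pres_nrd_nu N0 P0).
Qed.
End GeneralMultiplier.

(** * Dependence of the transfer on the functional *)

Section Delta.
Variables (F : fieldType) (a : F) (K : quadext a) (N : fieldType) (j : {rmorphism F -> N}).
Variables l0 l1 : N.
Hypothesis two0 : (2 : F) != 0.
Hypothesis I3 : I3_zero F.
Hypothesis I3N : I3_zero N.
Hypothesis d0 : tdisc a j l0 l1 != 0.
Local Notation T := (transfer (K := K) j l0 l1).
Local Notation T' := (transfer (K := K) j 0 1).
Local Notation i := (qin K).

Lemma tdisc01 : tdisc a j 0 1 = 1 :> N.
Proof. by rewrite /tdisc expr0n mulr0 subr0 expr1n. Qed.
Lemma tdisc01_neq0 : tdisc a j 0 1 != 0 :> N.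
Proof. by rewrite tdisc01 oner_neq0. Qed.
Let d0' := tdisc01_neq0.

Lemma qnorm1 : qnorm (1 : K) = 1.
Proof. by rewrite -(rmorph1 i) qnorm_in expr1n. Qed.

Lemma transfer01_1 : T' (qcl 1) = 0.
Proof.
rewrite (transfer_qcl d0') qnorm1 tdisc01 rmorph1 mul1r.
by rewrite /pf qcl1 subrr mulr0.
Qed.

Section OneTransfer.
Variables m0 m1 : N.
Hypothesis e0 : tdisc a j m0 m1 != 0.
Local Notation S := (transfer (K := K) j m0 m1).

Lemma transfer_scale f z : f != 0 -> S (qcl (i f) * qcl z) = qcl (j f) * S (qcl z).
Proof.
move=> f0; rewrite -qclM !(transfer_qcl e0) qnormM qnorm_in rmorphM mulrCA.
have -> : tfun j m0 m1 (i f * z) = j f * tfun j m0 m1 z.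
  by rewrite /tfun !(qreM, qimM, qre_in, qim_in) !(rmorphD, rmorphM, rmorph0) /=; ring.
by rewrite rmorphXn (pfM (j f ^+ 2)) pf_sqr ?fmorph_eq0 // qclM; ring.
Qed.

(** By [transfer_scale] this is [pf g] times the difference of the transfers of 1 and z; there
    [tdisc] drops out because I^3 N = 0, so the result does not depend on the functional. *)
Lemma transfer_pf2 g z : g != 0 -> z != 0 ->
  S (pf (i g) * pf z) = - (pf (j g) * pf (j (qnorm z))).
Proof.
move=> g0 z0; have jg0 : j g != 0 by rewrite fmorph_eq0.
have -> : pf (i g) * pf z = (qcl 1 - qcl (i g) * qcl 1) - (qcl z - qcl (i g) * qcl z).
  by rewrite /pf qcl1; ring.
rewrite !(transferB e0) !transfer_scale //.
rewrite [LHS](_ : _ = pf (j g) * S (qcl 1) - pf (j g) * S (qcl z)); last by rewrite /pf; ring.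
rewrite !(pf_transfer e0) ?oner_neq0 // qnorm1 rmorph1 mulr1 pfM.
rewrite [LHS](_ : _ = pf (j g) * pf (tdisc a j m0 m1) * pf (j (qnorm z)) - pf (j g) * pf (j (qnorm z))); last by ring.
by rewrite I3N ?sub0r // fmorph_eq0 qnorm_eq0.
Qed.
End OneTransfer.

Let D (w : witt_ring K) := T w - T' w.
Let DB : {morph D : x y / x - y}.
Proof. by move=> x y; rewrite /D (transferB d0) (transferB d0'); ring. Qed.
Let D0 : D 0 = 0. Proof. by have := DB 0 0; rewrite !subrr. Qed.
Let DD : {morph D : x y / x + y}.
Proof. by move=> u v; rewrite -{1}[v]opprK DB -[- v]add0r DB D0 sub0r opprK. Qed.

Lemma transfer_diff_pf2 y z : y != 0 -> z != 0 -> D (pf y * pf z) = 0.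
Proof.
have I3K : I3_zero K := quadext_I3 two0 I3.
apply: quadext_symbols DB _ _ y z => [g z g0 z0|g y z w g0 y0 z0].
  by rewrite /D !transfer_pf2 // ?subrr //; exact: tdisc01_neq0.
by rewrite I3K ?qin_eq0 // mul0r D0.
Qed.

(** Each <z> is 1 - [pf z], and the sum of the [pf z] differs from [pf] of the product by products
    of two such classes, which [D] kills. *)
Lemma transfer_diff_sum (zs : seq K) : all (fun z => z != 0) zs ->
  D (\sum_(z <- zs) qcl z) = D 1 *+ size zs - D (pf (\prod_(z <- zs) z)).
Proof.
elim: zs => [|z zs IHzs] /=.
  by move=> _; rewrite !big_nil /pf qcl1 subrr D0 subrr.
case/andP=> z0 zs0; rewrite !big_cons DD IHzs // pfM DB DD transfer_diff_pf2 //; last first.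
  by rewrite prodf_seq_neq0.
have -> : qcl z = 1 - pf z by rewrite /pf; ring.
by rewrite DB mulrSr subr0; ring.
Qed.

(* The two transfers of an even-dimensional form whose discriminant lies in  *)
(* the base field differ by a class defined over the base field.             *)
Lemma transfer_diff (zs : seq K) f c n : all (fun z => z != 0) zs -> size zs = n.*2 ->
  \prod_(z <- zs) z = i f * c ^+ 2 -> f != 0 -> c != 0 ->
  \sum_(z <- zs) T (qcl z) = \sum_(z <- zs) T' (qcl z)
    + ((pf (-1) * pf (tdisc a j l0 l1)) *+ n - pf (j f) * pf (tdisc a j l0 l1)).
Proof.
move=> zs0 sz pz f0 c0.
have sumT (S : witt_ring K -> witt_ring N) : S 0 = 0 -> {morph S : x y / x + y} ->
    \sum_(z <- zs) S (qcl z) = S (\sum_(z <- zs) qcl z).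
  by move=> S0 SD; rewrite (big_morph S SD S0).
rewrite (sumT T (transfer0 K d0) (transferD d0)) (sumT T' (transfer0 K d0') (transferD d0')).
have e := transfer_diff_sum zs0; rewrite {1}/D in e.
have D1 : D 1 = T (qcl 1) by rewrite /D -qcl1 transfer01_1 subr0.
have T1 g : g != 0 -> pf g * T (qcl 1) = pf g * pf (tdisc a j l0 l1).
  by move=> g0; rewrite (pf_transfer d0) ?oner_neq0 // qnorm1 rmorph1 mulr1.
have DP : D (pf (\prod_(z <- zs) z)) = pf (j f) * pf (tdisc a j l0 l1).
  rewrite pz pfM pf_sqr // mulr0 subr0 addr0 -T1 ?fmorph_eq0 //.
  have -> : pf (i f) = qcl 1 - qcl (i f) * qcl 1 by rewrite /pf qcl1 mulr1.
  rewrite DB /D !transfer_scale // ?transfer01_1 ?mulr0 ?subr0 /pf; try exact: tdisc01_neq0.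
  by rewrite mulrBl mul1r.
have n1 : -1 != 0 :> N by rewrite oppr_eq0 oner_neq0.
rewrite -(T1 _ n1) -DP; move: e; rewrite sz D1 => e.
have -> : (pf (-1) * T (qcl 1)) *+ n = T (qcl 1) *+ n.*2.
  by rewrite -mul2n mulrnA; congr (_ *+ _); rewrite /pf qclN !qcl1; ring.
by apply: (subr_transfer e); rewrite /D; ring.
Qed.
End Delta.

(** If N(z) = g^2 then (z + g)^2 = z (tr z + 2 g). When z + g = 0, z already lies in F. *)
Lemma hilbert90_square (F : fieldType) (a : F) (K : quadext a) (z : K) (g : F) :
  z != 0 -> qnorm z = g ^+ 2 ->
  exists (f : F) (c : K), [/\ f != 0, c != 0 & z = qin K f * c ^+ 2].
Proof.
move=> z0 nz; have g0 : g != 0 by rewrite -sqrf_eq0 -nz qnorm_eq0.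
have [y0|y0] := eqVneq (z + qin K g) 0.
  exists (- g), 1; rewrite oppr_eq0 oner_neq0 g0 expr1n mulr1 rmorphN; split=> //.
  by apply/eqP; rewrite -addr_eq0 y0.
pose t := 2 * (qre z + g).
have yz : (z + qin K g) ^+ 2 = z * qin K t.
  have := qnormE z; rewrite nz rmorphXn => e.
  have -> : qin K t = z + (qin K (qre z) - qin K (qim z) * qrt K) + 2 * qin K g.
    by rewrite {1}[z]qeta /t rmorphM rmorph_nat rmorphD; ring.
  by apply: (subr_transfer e); ring.
have t0 : t != 0.
  by apply: contraNneq y0 => t0; rewrite -sqrf_eq0 yz t0 rmorph0 mulr0.
exists t^-1, (z + qin K g); rewrite invr_eq0; split=> //.
by rewrite yz fmorphV mulrCA mulVf ?mulr1 // qin_eq0.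
Qed.

(** * Square discriminant *)

Section CommonSlot.
Variables (F : fieldType) (a b : F) (k : nat).
Hypothesis two0 : (2 : F) != 0.
Hypothesis division : @quat_division F a b.
Hypothesis un : u_invariant_le F (4 * k).
Local Notation Q := (quat a b).

Lemma pres_exists (p : Q) : pure p -> p != 0 ->
  exists t v0 v1 : F, v0 ^+ 2 - a * v1 ^+ 2 != 0 /\
    a * t ^+ 2 + b * (v0 ^+ 2 - a * v1 ^+ 2) = - nrd p.
Proof.
move=> p0 pn0; have [N0|N0] := eqVneq (q2 p ^+ 2 - a * q3 p ^+ 2) 0; last first.
  exists (q1 p), (q2 p), (q3 p); split=> //.
  by rewrite /nrd /nrm p0; ring.
have [e2 e3] := division_norm0 division N0.
have b1 : 1 - b != 0.
  apply/eqP => b1; have := division (x := Q4 a b 1 0 1 0).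
  rewrite /nrd /nrm !Q4E => /(_ _)/(congr1 (@q0 _ _ _)) h.
  by have /eqP := oner_neq0 F; apply; apply: h; rewrite -[RHS]b1; ring.
have t0 : q1 p != 0.
  apply: contraNneq pn0 => e1; apply/eqP/quat_eq; rewrite !qE //.
(* Here p lies on the line of i; these are the coordinates of its conjugate by 1 + j, which does
   not. *)
exists ((1 + b) / (1 - b) * q1 p), 0, (- (2 / (1 - b)) * q1 p); split.
  have u0 : - (2 / (1 - b)) * q1 p != 0 by rewrite mulf_neq0 // oppr_eq0 mulf_neq0 ?invr_eq0.
  by rewrite expr0n sub0r oppr_eq0 mulf_neq0 ?(division_a0 division) ?expf_neq0.
by rewrite /nrd /nrm p0 e2 e3; field.
Qed.

Definition nrd_form : seq F := [:: 1; - a; - b; a * b].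
Lemma good_nrd_form : good (dmx nrd_form).
Proof.
apply: good_dmx; rewrite /= oner_neq0 !oppr_eq0 mulf_neq0 //;
by rewrite ?(division_a0 division) ?(division_b0 division).
Qed.

Lemma nrd_form_value (u : 'rV[F]_(size nrd_form)) (f : nat -> F) : (forall r, u 0 r = f r) ->
  (u *m dmx nrd_form *m u^T) 0 0 = nrd (Q4 a b (f 0) (f 1) (f 2) (f 3)).
Proof.
move=> uf; rewrite (dmx_value uf) /= !big_ord_recl big_ord0 /= /bump /= !add1n /=.
by rewrite /nrd /nrm !Q4E; ring.
Qed.

(* If f is anisotropic of large dimension then f and the norm form share a   *)
(* binary subform, hence f becomes isotropic over F(p) for a pure p.         *)
Lemma common_slot (f : symform F) : anisotropic f ->
  (4 * k <= (form_dim f).+1)%N ->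
  exists p : Q, [/\ pure p, p != 0 &
    exists (l0 l1 : 'rV[F]_(form_dim f)) (n0 mu : F), [/\ l0 != 0,
      l0 *m gram f *m l0^T = n0%:M,
      l0 *m gram f *m l1^T + l1 *m gram f *m l0^T = (2 * mu * n0)%:M &
      l1 *m gram f *m l1^T = ((mu ^+ 2 + nrd p) * n0)%:M]].
Proof.
move=> af dimf; have /andP[/eqP sn un0] := good_nrd_form.
pose nf := SymForm sn un0.
pose H := dsum_form f (opp_form nf).
have [g [ag cg dg]] := class_rep_le (witt_class H) un.
have dH : form_dim H = (form_dim f + 4)%N by [].
have od := odd_dim_class cg; rewrite dH in od.
(* The dimension of g is at most 4k, hence by parity at most that of f: the sum of f and the
   negative norm form, 4 larger, contains a totally isotropic plane. *)
have [||U [fU U0]] := @tot_isotropic_class F H g 2; first by [].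
  by rewrite dH; move: od dimf dg; rewrite oddD /= addbF; lia.
pose q (c : 'rV[F]_2) : 'rV[F]_4 := rsubmx (c *m U : 'rV_(form_dim f + 4)).
pose l (c : 'rV[F]_2) : 'rV[F]_(form_dim f) := lsubmx (c *m U : 'rV_(form_dim f + 4)).
pose m (c : 'rV[F]_2) : Q := Q4 a b (q c 0 (inord 0)) (q c 0 (inord 1)) (q c 0 (inord 2)) (q c 0 (inord 3)).
have lD c d e : l (c + e *: d) = l c + e *: l d by rewrite /l mulmxDl -scalemxAl linearD linearZ.
have mD c d e : m (c + e *: d) = m c + qc a b e * m d.
  have qD : q (c + e *: d) = q c + e *: q d by rewrite /q mulmxDl -scalemxAl linearD linearZ.
  by apply: quat_eq; rewrite /m !qE qD !mxE; ring.
have E c : l c *m gram f *m (l c)^T = (nrd (m c))%:M.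
  have : c *m U *m gram H *m (c *m U)^T = 0.
    have -> : c *m U *m gram H *m (c *m U)^T = c *m (U *m gram H *m U^T) *m c^T.
      by rewrite trmx_mul !mulmxA.
    by rewrite U0 mulmx0 mul0mx.
  rewrite /H /= dsum_value -/(l c) -/(q c) mulmxN mulNmx => /eqP.
  rewrite subr_eq0 => /eqP->; apply/matrixP=> x y; rewrite !ord1 [RHS]mxE eqxx mulr1n.
  rewrite (@nrd_form_value (q c) (fun x => q c 0 (inord x))) // => s.
  by rewrite inord_val.
have inj c : m c = 0 -> c = 0.
  move=> mc; have lc : l c = 0 by apply: af; rewrite E mc nrd0 raddf0.
  apply/eqP; rewrite -(mulmx_free_eq0 _ fU) -[c *m U](@hsubmxK _ _ (form_dim f) 4) -/(l c) lc.
  suff -> : rsubmx (c *m U : 'rV_(form_dim f + 4)) = 0 by rewrite row_mx0.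
  apply/rowP=> x; rewrite -/(q c) [RHS]mxE -[x]inord_val.
  have := congr1 (@q0 _ _ _) mc; have := congr1 (@q1 _ _ _) mc.
  have := congr1 (@q2 _ _ _) mc; have := congr1 (@q3 _ _ _) mc; rewrite /m !qE.
  by case: x => [[|[|[|[|]]]]].
pose c0 : 'rV[F]_2 := delta_mx 0 0; pose c1 : 'rV[F]_2 := delta_mx 0 1.
have c00 : c0 != 0 by apply/rV0Pn; exists 0; rewrite !mxE oner_neq0.
have m0 : m c0 != 0 by apply: contra_neq c00 => /inj.
pose n0 := nrd (m c0); have n00 : n0 != 0 by apply: nrd_neq0.
(* Here p is the pure part of m(c0)^-1 m(c1) = mu + p, so on the plane of l(c0), l(c1) f is n0 times
   the norm form on the span of 1 and mu + p. *)
pose y := qc a b n0^-1 * (qconj (m c0) * m c1); pose mu := q0 y; pose p := y - qc a b mu.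
have pp : pure p by rewrite /pure /p !qE subrr.
have ym : m c0 * y = m c1.
  by rewrite /y mulrA -qc_comm -mulrA (mulrA (m c0)) mul_qconj mulrA -qcM mulVf // mul1r.
have ny : nrd (m c1) = (mu ^+ 2 + nrd p) * n0.
  rewrite -ym nrdM mulrC; congr (_ * _).
  by rewrite -{1}[y](subrK (qc a b mu)) nrd_pureD.
have nz c : c != 0 -> nrd (m c) != 0 by move=> cn; apply: nrd_neq0 => //; apply: contra_neq cn => /inj.
exists p; split=> //.
  apply/eqP => p0; have yE : y = qc a b mu by apply/eqP; rewrite -subr_eq0 -/p p0.
  have : m (c1 + (- mu) *: c0) = 0.
    by rewrite mD -ym yE -qc_comm -mulrDl -qcD subrr mul0r.
  move/inj/matrixP/(_ 0 1); rewrite !mxE /= mulr0 addr0 => /eqP.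
  by rewrite oner_eq0.
exists (l c0), (l c1), n0, mu; split=> //.
- apply: contra_neq n00 => l0; have := E c0; rewrite l0 !mul0mx.
  by move=> /matrixP/(_ 0 0); rewrite !mxE eqxx.
- have := E (c1 + 1 *: c0); rewrite lD mD !scale1r qc1 mul1r linearD /= !mulmxDl !mulmxDr !E.
  have -> : nrd (m c1 + m c0) = nrd (m c1) + nrd (m c0) + 2 * mu * n0.
    by rewrite -ym nrd_mulD1.
  move: (l c0 *m _ *m _) (l c1 *m _ *m _) => X Y /matrixP/(_ 0 0); rewrite !mxE eqxx => e.
  apply/matrixP=> x z; rewrite !ord1 !mxE eqxx; move: e; rewrite !mulr1n => e.
  by apply: (subr_transfer e); ring.
- by rewrite E ny.
Qed.
End CommonSlot.

(** On the plane of l0, l1 the form is n0 ((X + mu)^2 - P Y^2) after setting Y = 1, with the zero X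
    = -(mu + sqrt P) over F(sqrt P). *)
Lemma isotropic_extension (F : fieldType) (P : F) (N : quadext P) (f : symform F)
    (l0 l1 : 'rV[F]_(form_dim f)) (n0 mu : F) : l0 != 0 ->
  l0 *m gram f *m l0^T = n0%:M ->
  l0 *m gram f *m l1^T + l1 *m gram f *m l0^T = (2 * mu * n0)%:M ->
  l1 *m gram f *m l1^T = ((mu ^+ 2 - P) * n0)%:M ->
  exists g : symform N, witt_class g = base_change (qin N) (witt_class f) /\
    form_dim f = (form_dim g + 2)%N.
Proof.
move=> l00 E0 E01 E1; set j := qin N; set th := qrt N.
have gM := map_good j (good_gram f).
have /andP[/eqP sM uM] := gM.
pose fN := SymForm sM uM.
have cN : witt_class fN = base_change j (witt_class f) by rewrite base_change_form -(mclE fN).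
suff /isotropic_reduce[g [cg dg]] : ~ anisotropic fN.
  by exists g; rewrite cg cN; split=> //; exact: dg.
pose al := - (j mu + th); pose v := al *: map_mx j l0 + map_mx j l1.
move=> /(_ v) h; have v0 : v = 0.
  have vT : v^T = al *: map_mx j l0^T + map_mx j l1^T.
    by rewrite /v linearD linearZ /= !matrix.map_trmx.
  apply: h; rewrite vT /v /=.
  rewrite !mulmxDl !mulmxDr -!scalemxAl -!scalemxAr -!map_mxM E0 E1.
  have := congr1 (map_mx j) E01; rewrite map_mxD !map_scalar_mx.
  move: (map_mx j _) (map_mx j _) => X Y.
  move/matrixP/(_ 0 0); rewrite !mxE eqxx !mulr1n => e.
  apply/matrixP => x y; rewrite !ord1 !mxE eqxx !mulr1n.
  have -> : Y 0 0 = j (2 * mu * n0) - X 0 0 by apply: (subr_transfer e); ring.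
  have tt := qrt_sq N; rewrite -/th -/j in tt.
  rewrite !(rmorphXn, rmorphB, rmorphM) rmorph_nat /= -tt /al; ring.
have [r lr] := rV0Pn _ l00.
have /rowP/(_ r) := v0; rewrite !mxE /al => e.
have /qfree[_ /eqP] : j (l1 0 r - mu * l0 0 r) + j (- l0 0 r) * th = 0.
  by rewrite -[RHS]e rmorphB rmorphM rmorphN; ring.
by rewrite oppr_eq0 (negPf lr).
Qed.

Section SquareDisc.
Variables (F : fieldType) (a b : F) (V : shs a b) (k : nat).
Local Notation h := (@sh F a b V).
Hypothesis two0 : (2 : F) != 0.
Hypothesis I3 : I3_zero F.
Hypothesis division : @quat_division F a b.
Hypothesis anis : forall x : V, h x x = 0 -> x = 0.
Hypothesis un : u_invariant_le F (4 * k).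
Let a0 := division_a0 division.
Let b0 := division_b0 division.

Section Fixed.
Variables (X : seq V) (K : quadext a) (f0 : F) (c : K).
Hypothesis fX : frame X.
Hypothesis sX : size X = k.+1.*2.
Hypothesis pX : planar X.
Local Notation i := (qin K).

(** A planar value is z j with z in F(i); this is z, read in K = F(sqrt a). *)
Definition planar_coord (x : V) : K := i (q2 (h x x)) + i (q3 (h x x)) * qrt K.

Lemma planar_coord_nrd x : q1 (h x x) = 0 -> nrd (h x x) = - (b * qnorm (planar_coord x)).
Proof.
by move=> e; rewrite planar_nrd // /qnorm /planar_coord qreE qimE; ring.
Qed.

Hypothesis f00 : f0 != 0.
Hypothesis c0 : c != 0.
Hypothesis prodX : \prod_(x <- X) planar_coord x = i f0 * c ^+ 2.

(** The transfers of the planar coordinates along the functional x + y sqrt a |-> y, corrected by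
    the difference term of [transfer_diff] with [tdisc] replaced by b. *)
Definition planar_class : witt_ring F :=
  \sum_(x <- X) qcl (q3 (h x x)) * pf (qnorm (planar_coord x))
  + ((pf (-1) * pf b) *+ k.+1 - pf f0 * pf b).

Lemma frame_nrd x : x \in X -> nrd (h x x) != 0.
Proof. by have /allP := frame_all division anis fX; apply. Qed.

Lemma planar_coord_neq0 x : x \in X -> planar_coord x != 0.
Proof.
move=> xX; have := frame_nrd xX; rewrite planar_coord_nrd ?pX //.
by rewrite oppr_eq0 mulf_eq0 qnorm_eq0 => /norP[].
Qed.

(** In the presentation by p, the [jpart] of z j is a functional of z with coefficients [l0] and
    [l1] in N. Its [tdisc] is b times a square whatever p is, so [transfer_diff] compares it with a
    fixed functional by a class defined over F. *)
Lemma planar_traces t v0 v1 (N0 : v0 ^+ 2 - a * v1 ^+ 2 != 0)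
    (P0 : a * t ^+ 2 + b * (v0 ^+ 2 - a * v1 ^+ 2) != 0)
    (N : quadext (a * t ^+ 2 + b * (v0 ^+ 2 - a * v1 ^+ 2))) :
  \sum_(x <- X) jclass N (pres_nu t v0 v1 (h x x)) = base_change (qin N) planar_class.
Proof.
set j := qin N; set th := qrt N; pose n := v0 ^+ 2 - a * v1 ^+ 2.
pose P := a * t ^+ 2 + b * n; have tt : th ^+ 2 = j P := qrt_sq N.
have jn0 : j n != 0 by rewrite fmorph_eq0.
have th0 : th != 0 by rewrite -sqrf_eq0 tt fmorph_eq0.
have jP0 : j P != 0 by rewrite fmorph_eq0.
have I3N : I3_zero N := quadext_I3 two0 I3.
pose l0 : N := - (j v1 / j n) - j t * j v0 / (j n * th).
pose l1 : N := j v0 / j n + j a * j t * j v1 / (j n * th).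
have jnE : j n = j v0 ^+ 2 - j a * j v1 ^+ 2 by rewrite /n !(rmorphXn, rmorphB, rmorphM).
have jPE : j P = j a * j t ^+ 2 + j b * j n by rewrite /P !(rmorphXn, rmorphD, rmorphM).
have dE : tdisc a j l0 l1 = j b * th^-1 ^+ 2.
  have jbn : j b * j n = th ^+ 2 - j a * j t ^+ 2 by rewrite tt jPE addrAC subrr add0r.
  have -> : j b * th^-1 ^+ 2 = (j b * j n) / (j n * th ^+ 2) by field; rewrite jn0 th0.
  rewrite jbn; move: jn0; rewrite /tdisc /l0 /l1 jnE => jn0'.
  by field; rewrite ?th0 ?jn0'.
have d0 : tdisc a j l0 l1 != 0 by rewrite dE mulf_neq0 ?fmorph_eq0 ?expf_neq0 ?invr_eq0.
have pfd : pf (tdisc a j l0 l1) = pf (j b).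
  by rewrite dE pfM pf_sqr ?invr_eq0 // mulr0 subr0 addr0.
have T1 x : x \in X -> jclass N (pres_nu t v0 v1 (h x x)) =
    transfer (K := K) j l0 l1 (qcl (planar_coord x)).
  move=> xX; have nx := frame_nrd xX; have px := pX xX.
  rewrite (transfer_qcl d0) /jclass (pres_nrd_nu N0 P0).
  have -> : jpart N (pres_nu t v0 v1 (h x x)) = tfun j l0 l1 (planar_coord x).
    rewrite /jpart /tfun /planar_coord qreE qimE /pres_nu !Q4E px /l0 /l1.
    move: (q2 _) (q3 _) => y z; rewrite -/j -/th subr0.
    have -> : j ((v0 * z - v1 * y) / n) = (j v0 * j z - j v1 * j y) / j n.
      by rewrite fmorph_div; congr (_ / _); rewrite rmorphB !rmorphM.
    have -> : j (t * (v0 * y - a * v1 * z) / n / P) = j t * (j v0 * j y - j a * j v1 * j z) / j n / j P.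
      rewrite !fmorph_div; congr (_ / _ / _); rewrite rmorphM; congr (_ * _).
      by rewrite rmorphB !rmorphM.
    by rewrite -tt; field; rewrite jn0 th0.
  congr (_ * _).
  rewrite planar_coord_nrd // rmorphN qclN rmorphM dE.
  have -> : j b * th^-1 ^+ 2 * j (qnorm (planar_coord x)) = (j b * j (qnorm (planar_coord x))) * th^-1 ^+ 2 by ring.
  by rewrite /pf (qclM _ (th^-1 ^+ 2)) qcl_sqr ?invr_eq0 // mulr1.
have T2 x : x \in X -> base_change j (qcl (q3 (h x x)) * pf (qnorm (planar_coord x))) =
    transfer (K := K) j 0 1 (qcl (planar_coord x)).
  move=> xX; rewrite (transfer_qcl (tdisc01_neq0 _ _)) tdisc01 mul1r.
  have -> : tfun j 0 1 (planar_coord x) = j (q3 (h x x)).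
    by rewrite /tfun /planar_coord qreE qimE mulr0 add0r mulr1.
  rewrite [X in base_change _ X](_ : _ = qcl (q3 (h x x)) - qcl (q3 (h x x) * qnorm (planar_coord x))); last first.
    by rewrite qclM /pf; ring.
  by rewrite base_changeD base_changeN !base_change_qcl rmorphM qclM /pf; ring.
have bcn (w : witt_ring F) n' : base_change j (w *+ n') = base_change j w *+ n'.
  by elim: n' => [|n' IHn]; rewrite ?mulr0n ?base_change0 // !mulrS base_changeD IHn.
rewrite (eq_big_seq _ T1) /planar_class base_changeD base_change_sum (eq_big_seq _ T2).
rewrite base_changeD base_changeN bcn !base_change_pf2 rmorphN rmorph1.
have := @transfer_diff F a K N j l0 l1 two0 I3 I3N d0 [seq planar_coord x | x <- X] f0 c k.+1.
rewrite !big_map size_map pfd => -> //.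
by rewrite all_map; apply/allP => x xX; apply: planar_coord_neq0.
Qed.
End Fixed.

Lemma planar_disc_norm (K : quadext a) (X : seq V) : planar X ->
  disc X = (- b) ^+ size X * qnorm (\prod_(x <- X) planar_coord K x).
Proof.
elim: X => [|x X IHX] pX; first by rewrite /disc !big_nil (qnorm1 K) mulr1.
have pX' : planar X by move=> y yX; apply: pX; rewrite inE yX orbT.
have px : q1 (h x x) = 0 by apply: pX; rewrite inE eqxx.
by rewrite disc_cons IHX // big_cons qnormM (planar_coord_nrd K px) exprS /=; ring.
Qed.

(** If the anisotropic form in [w] has dimension at most 4k - 2, its restriction to any F(p)
    contradicts [trace_anisotropic]; otherwise [common_slot] provides a p over which it loses 2 of
    its at most 4k dimensions. *)
Lemma square_disc_impossible (X : seq V) (s : F) : frame X -> size X = k.+1.*2 ->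
  disc X = s ^+ 2 -> False.
Proof.
move=> fX sX dX.
have [X' [fX' sX' pX' [s' dX']]] := planar_full two0 a0 b0 division anis I3 fX sX dX.
have [K _] := division_quadext division.
have Z0 : \prod_(x <- X') planar_coord K x != 0.
  by rewrite prodf_seq_neq0; apply/allP => x xX; apply: planar_coord_neq0 fX' pX' _ xX.
have nZ : qnorm (\prod_(x <- X') planar_coord K x) = (s' / b ^+ k.+1) ^+ 2.
  have := planar_disc_norm K pX'; rewrite dX' sX' -[k.*2.+2]/(k.+1.*2) -muln2.
  rewrite mulnC exprM sqrrN -exprM mulnC exprM => e.
  by rewrite exprMn e exprVn mulrAC divff ?mul1r // expf_neq0 ?expf_neq0.
have [f0 [c [f00 c0 prodX]]] := hilbert90_square Z0 nZ.
pose w := planar_class X' K f0.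
have fin t v0 v1 (N0 : v0 ^+ 2 - a * v1 ^+ 2 != 0)
    (P0 : a * t ^+ 2 + b * (v0 ^+ 2 - a * v1 ^+ 2) != 0)
    (N : quadext (a * t ^+ 2 + b * (v0 ^+ 2 - a * v1 ^+ 2))) (G : symform N) :
    witt_class G = base_change (qin N) w -> (form_dim G + 2 <= 4 * k)%N -> False.
  move=> cG dG; have dv' := pres_division N0 P0 division.
  have an' := @transport_anis _ _ _ _ _ V _ _ (pres_muK N0 P0) (pres_nuK N0 P0) (@pres_muD _ _ _ _ _ _)
    (@pres_muM _ _ _ _ _ _) (pres_mu1 _ _ _ _ _) (@pres_muJ _ _ _ _ _ _) anis.
  have fX2 : @frame _ _ _ (pres N0 P0 V) X' by apply: transport_frame.
  apply: (trace_anisotropic two0 dv' an' I3 P0 fX2 (g := G)).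
    by rewrite cG -(planar_traces fX' sX' pX' f00 c0 prodX N0 P0).
  by rewrite sX'; move: (form_dim G) dG => d; rewrite -!muln2; lia.
have [f [af cf df]] := class_rep_le w un.
have [le|lt] := leqP (form_dim f + 2) (4 * k).
  (* Any p serves; this one is p = j. *)
  have N0 : 1 ^+ 2 - a * 0 ^+ 2 != 0 by rewrite expr0n mulr0 subr0 expr1n oner_neq0.
  have P0 : a * 0 ^+ 2 + b * (1 ^+ 2 - a * 0 ^+ 2) != 0.
    by rewrite expr0n !mulr0 subr0 add0r expr1n mulr1.
  have [N _] := division_quadext (pres_division N0 P0 division).
  have [G [dG _ cG]] := mcl_good (map_good (qin N) (good_gram f)).
  by apply: (fin _ _ _ N0 P0 N G); rewrite ?dG // -cG -base_change_form cf.
have [|p [pp pn [l0 [l1 [n0 [mu [l00 E0 E01 E1]]]]]]] := common_slot two0 division un af.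
  by move: lt; rewrite addn2 ltnS.
have [t [v0 [v1 [N0 eP]]]] := pres_exists two0 division pp pn.
have P0 : a * t ^+ 2 + b * (v0 ^+ 2 - a * v1 ^+ 2) != 0.
  by rewrite eP oppr_eq0 nrd_neq0.
have [N _] := division_quadext (pres_division N0 P0 division).
have [|G [cG dG]] := isotropic_extension N l00 E0 E01.
  by rewrite E1 eP opprK.
apply: (fin _ _ _ N0 P0 N G); first by rewrite cG cf.
by rewrite -dG.
Qed.
End SquareDisc.

Lemma u_invariant_gt0 (K : fieldType) n : u_invariant_le K n -> (0 < n)%N.
Proof.
move=> un; have u1 : (1%:M : 'M[K]_1) \in unitmx by exact: unitmx1.
pose f := SymForm (trmx1 K 1) u1.
apply: (un f) => v /=; rewrite mulmx1 => /matrixP/(_ 0 0).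
rewrite !mxE big_ord1 !mxE => /eqP; rewrite mulf_eq0 orbb => /eqP e.
by apply/rowP => i; rewrite ord1 e mxE.
Qed.

Lemma big_prodN (R : comNzRingType) (I : Type) (s : seq I) (f : I -> R) :
  \prod_(x <- s) - f x = (-1) ^+ size s * \prod_(x <- s) f x.
Proof.
elim: s => [|x s IHs]; first by rewrite !big_nil mulr1.
by rewrite !big_cons IHs exprS /=; ring.
Qed.

Section Pair.
Variables (F : fieldType) (a b : F) (V : shs a b) (k : nat) (X : seq V).
Local Notation h := (@sh F a b V).
Hypothesis two0 : (2 : F) != 0.
Hypothesis I3 : I3_zero F.
Hypothesis division : @quat_division F a b.
Hypothesis anis : forall x : V, h x x = 0 -> x = 0.
Hypothesis fX : frame X.
Hypothesis full : forall u, perp X u -> u = 0.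
Hypothesis sX : size X = k.+2.*2.

(** Completing x, y to a frame supplies the third vector for [no_multiplier]. The complement of y
    has odd rank, whence the sign of the discriminant; squares from rebasing are absorbed in n. *)
Lemma multiplier_pair (x y : V) (Y m n : F) : x != 0 -> y != 0 -> h x y = 0 ->
  h y y = qc a b (- Y) * h x x -> Y != 0 ->
  Y = m ^+ 2 + disc X / nrd (h y y) * n ^+ 2 -> False.
Proof.
move=> x0 y0 xy eyx Y0 eY.
have sx : in_span X x by move=> u /full->; apply: sh0l.
have [X1 [sX1 fX1 pX1 [c c0 dX1]]] := frame_rebase two0 division anis fX sx x0.
have sy : in_span X1 y.
  have sy0 : in_span (x :: X1) y by move=> u /pX1/full->; apply: sh0l.
  have := in_span_cons division anis fX1 sy0.
  by rewrite /proj_coef xy mulr0 sact0 subr0.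
have [_ px1 fX1'] := fX1.
have [X2 [sX2 fX2 pX2 [d d0 dX2]]] := frame_rebase two0 division anis fX1' sy y0.
have fXX : frame (x :: y :: X2) by split=> //; apply: (pX2 x).1.
move: sX; rewrite sX1 sX2 => -[]; case: X2 sX2 fX2 pX2 dX2 fXX => // x3 X3 sX2 fX2 pX2 dX2 fXX [sX3].
have ny := sh_neq0 division anis y0.
apply: (no_multiplier two0 I3 division anis (y := Y) (m := m) (n := n / (c * d)) fXX eyx Y0).
rewrite {1}eY (big_prodN (x :: x3 :: X3)) /= -/(disc (x :: x3 :: X3)) disc_cons.
have -> : (-1) ^+ (size X3).+2 = -1 :> F by rewrite -signr_odd /= negbK sX3 /= odd_double.
have e : nrd (h x x) * disc (x3 :: X3) = (c * d) ^+ 2 * disc X / nrd (h y y).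
  apply: (canRL (mulfK ny)); move: dX1 dX2; rewrite (disc_cons x) (disc_cons y) exprMn => e1 e2.
  by rewrite -mulrA (mulrC (disc _)) e2 mulrCA e1; ring.
rewrite e; field; rewrite ny c0 d0 //.
Qed.
End Pair.

(** * Arbitrary discriminant *)

Definition quad_u_bound (F : fieldType) n :=
  forall P : F, (forall x, x ^+ 2 != P) -> exists N : quadext P, u_invariant_le N n.

Section SlotDisc.
Variables (F : fieldType) (a b : F) (V : shs a b) (k : nat) (X : seq V).
Local Notation h := (@sh F a b V).
Hypothesis two0 : (2 : F) != 0.
Hypothesis I3 : I3_zero F.
Hypothesis division : @quat_division F a b.
Hypothesis anis : forall x : V, h x x = 0 -> x = 0.
Hypothesis un2 : quad_u_bound F (4 * k.+1).
Hypothesis fX : frame X.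
Hypothesis full : forall u, perp X u -> u = 0.
Hypothesis sX : size X = k.+2.*2.

(** Over N = F(p), u(N) bounds a representative of h_N and leaves two orthogonal vectors with values
    al i and be i in the presentation by p. Then the discriminant over the norm of be i is minus a
    square, so the norm condition on Y = -be / al asks for a difference of two squares, which every
    Y is. *)
Lemma slot_disc_impossible (p : quat a b) (s : F) : pure p -> p != 0 ->
  disc X = - nrd p * s ^+ 2 -> False.
Proof.
move=> pp p0 dX; have [t [v0 [v1 [N0 eP]]]] := pres_exists two0 division pp p0.
have P0 : a * t ^+ 2 + b * (v0 ^+ 2 - a * v1 ^+ 2) != 0.
  by rewrite eP oppr_eq0 nrd_neq0.
have dv' := pres_division N0 P0 division.
have [N unN] := un2 (division_nonsquare dv').
pose V' := pres N0 P0 V.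
have an' : forall x : V', @sh _ _ _ V' x x = 0 -> x = 0 by apply: transport_anis.
have fX' : @frame _ _ _ V' X by apply: transport_frame.
have full' : forall u, @perp _ _ _ V' X u -> u = 0.
  move=> u pu; apply: full; elim: (X) pu => //= x Y IHY [e /IHY pY]; split=> //.
  by rewrite -[h x u](pres_nuK N0 P0) [pres_nu _ _ _ _]e; apply: quat_eq; rewrite /pres_mu !qE; ring.
have dX' : @disc _ _ _ V' X = - nrd p * s ^+ 2.
  by rewrite -dX; apply: eq_bigr => x _; rewrite -(pres_nrd_nu N0 P0).
have [g [_ cg dg]] := class_rep_le (\sum_(x <- X) jclass N (@sh _ _ _ V' x x)) unN.
have [|x [y [x0 y0 xy jx jy]]] := trace_pair two0 dv' an' fX' cg.
  by rewrite sX; move: (form_dim g) dg => d; rewrite -!muln2; lia.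
have val (z : V') : z != 0 -> jpart N (@sh _ _ _ V' z z) = 0 ->
    q1 (@sh _ _ _ V' z z) != 0 /\ @sh _ _ _ V' z z = Q4 _ _ 0 (q1 (@sh _ _ _ V' z z)) 0 0.
  move=> z0 /jpart0P[e2 e3]; have e : @sh _ _ _ V' z z = Q4 _ _ 0 (q1 (@sh _ _ _ V' z z)) 0 0.
    by apply: quat_eq; rewrite !Q4E //; apply: sh_pure.
  split=> //; apply: contra_neq z0 => e1; apply: an'.
  by rewrite e e1.
have [al0 ex] := val x x0 jx; have [be0 ey] := val y y0 jy.
move: (q1 _) al0 ex (q1 _) be0 ey => al al0 ex be be0 ey.
have s0 : s != 0.
  have := disc_neq0 dv' an' fX'; rewrite dX' mulf_eq0 negb_or => /andP[_].
  by rewrite sqrf_eq0.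
pose Y := - be / al; have Y0 : Y != 0 by rewrite mulf_neq0 ?oppr_eq0 ?invr_eq0.
apply: (multiplier_pair two0 I3 dv' an' fX' full' sX (Y := Y) (m := (Y + 1) / 2)
  (n := (Y - 1) / (2 * s / be)) x0 y0 xy _ Y0).
  by rewrite ex ey /Y; apply: quat_eq; rewrite !qE; field.
have np := nrd_neq0 division p0.
have nQ (P e : F) : nrd (Q4 P e 0 be 0 0) = - P * be ^+ 2 by rewrite /nrd /nrm !Q4E; ring.
rewrite dX' ey nQ eP opprK; move: (nrd p) np => np np0; clearbody Y; field.
by rewrite ?two0 ?s0 ?be0 ?np0.
Qed.
End SlotDisc.

(** * Extension of scalars to F(sqrt d) *)

Section Extend.
Variables (F : fieldType) (a b : F) (V : shs a b) (d : F) (E : quadext d).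
Local Notation Q := (quat a b).
Local Notation h := (@sh F a b V).
Local Notation "x ** c" := (@sact F a b V x c) (at level 40, left associativity).
Local Notation i := (qin E).
Local Notation t := (qrt E).
Local Notation QE := (quat (i a) (i b)).
Implicit Types (x y : Q) (c : QE).

Definition qlo c : Q := Q4 a b (qre (q0 c)) (qre (q1 c)) (qre (q2 c)) (qre (q3 c)).
Definition qhi c : Q := Q4 a b (qim (q0 c)) (qim (q1 c)) (qim (q2 c)) (qim (q3 c)).
Definition qmk x y : QE := Q4 (i a) (i b) (i (q0 x) + i (q0 y) * t) (i (q1 x) + i (q1 y) * t)
  (i (q2 x) + i (q2 y) * t) (i (q3 x) + i (q3 y) * t).

Lemma qmkK c : qmk (qlo c) (qhi c) = c.
Proof. by apply: quat_eq; rewrite /qmk /qlo /qhi !Q4E -qeta. Qed.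
Lemma qlo_mk x y : qlo (qmk x y) = x.
Proof. by apply: quat_eq; rewrite /qmk /qlo !Q4E qreE. Qed.
Lemma qhi_mk x y : qhi (qmk x y) = y.
Proof. by apply: quat_eq; rewrite /qmk /qhi !Q4E qimE. Qed.
Lemma qmkD x y x' y' : qmk (x + x') (y + y') = qmk x y + qmk x' y'.
Proof. by apply: quat_eq; rewrite /qmk !qE !rmorphD /=; ring. Qed.
Lemma qmkM x y x' y' :
  qmk x y * qmk x' y' = qmk (x * x' + qc a b d * (y * y')) (x * y' + y * x').
Proof.
have tt := qrt_sq E.
apply: quat_eq; rewrite /qmk !qE !(rmorphD, rmorphB, rmorphM, rmorph0) /= -tt; ring.
Qed.
Lemma qmkJ x y : qmk (qconj x) (qconj y) = qconj (qmk x y).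
Proof. by apply: quat_eq; rewrite /qmk !qE // !rmorphN /=; ring. Qed.
Lemma qmkN x y : qmk (- x) (- y) = - qmk x y.
Proof. by apply: quat_eq; rewrite /qmk !qE !rmorphN /=; ring. Qed.
Lemma qmk_eq0 x y : qmk x y = 0 -> x = 0 /\ y = 0.
Proof.
move=> e; split; [rewrite -(qlo_mk x y)|rewrite -(qhi_mk x y)]; rewrite e;
by apply: quat_eq; rewrite /qlo /qhi !qE -(rmorph0 i) ?qre_in ?qim_in.
Qed.
Lemma qmk0 : qmk 0 0 = 0.
Proof. by apply: quat_eq; rewrite /qmk !qE !rmorph0; ring. Qed.
Lemma qmk1 : qmk 1 0 = 1.
Proof. by apply: quat_eq; rewrite /qmk !qE !rmorph0 ?rmorph1; ring. Qed.
Lemma qlo1 : qlo 1 = 1. Proof. by rewrite -qmk1 qlo_mk. Qed.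
Lemma qhi1 : qhi 1 = 0. Proof. by rewrite -qmk1 qhi_mk. Qed.
Lemma qloD c c' : qlo (c + c') = qlo c + qlo c'.
Proof. by rewrite -[c]qmkK -[c']qmkK -qmkD !qlo_mk. Qed.
Lemma qhiD c c' : qhi (c + c') = qhi c + qhi c'.
Proof. by rewrite -[c]qmkK -[c']qmkK -qmkD !qhi_mk. Qed.
Lemma qloM c c' : qlo (c * c') = qlo c * qlo c' + qc a b d * (qhi c * qhi c').
Proof. by rewrite -{1}[c]qmkK -{1}[c']qmkK qmkM !qlo_mk. Qed.
Lemma qhiM c c' : qhi (c * c') = qlo c * qhi c' + qhi c * qlo c'.
Proof. by rewrite -{1}[c]qmkK -{1}[c']qmkK qmkM !qhi_mk. Qed.

Lemma nrd_qmk x y : nrd (qmk x y) = i (nrd x + d * nrd y) + i (2 * q0 (qconj x * y)) * t.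
Proof.
have tt := qrt_sq E.
rewrite (rmorphM i 2) (rmorph_nat i) /nrd /nrm /qmk !qE !(rmorphD, rmorphB, rmorphXn, rmorphM, rmorphN) /= -tt; ring.
Qed.
Lemma nrd_qmk0 x : nrd (qmk x 0) = i (nrd x).
Proof. by rewrite nrd_qmk nrd0 mulr0 addr0 mulr0 q0_0 mulr0 rmorph0 mul0r addr0. Qed.

(* The form V tensor F(sqrt d): the pair (x, y) stands for x + sqrt d y. *)
Definition ext_act (u : V * V) c : V * V :=
  (u.1 ** qlo c + u.2 ** (qc a b d * qhi c), u.1 ** qhi c + u.2 ** qlo c).
Definition ext_form (u v : V * V) : QE :=
  qmk (h u.1 v.1 + qc a b d * h u.2 v.2) (h u.1 v.2 + h u.2 v.1).

Definition extend_shs : shs (i a) (i b).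
Proof.
apply: (@SHS E (i a) (i b) (V * V)%type ext_act ext_form).
- by move=> u v c; rewrite /ext_act !sactDl; congr (_, _); rewrite addrACA.
- by move=> u c c'; rewrite /ext_act qloD qhiD mulrDr !sactDr; congr (_, _); rewrite addrACA.
- move=> u c c'; rewrite /ext_act /= qloM qhiM.
  have cm (x y : Q) : x * (qc a b d * y) = qc a b d * (x * y) by rewrite mulrA -qc_comm mulrA.
  by rewrite !sactDl -!sactA !cm mulrDr !sactDr -!mulrA; congr (_, _);
    rewrite (addrC (u.2 ** _)) addrACA.
- by move=> [x y]; rewrite /ext_act /= qlo1 qhi1 mulr0 !sact1 !sact0 addr0 add0r.
- by move=> u v w; rewrite /ext_form !shDr -qmkD; congr qmk; rewrite ?mulrDr addrACA.
- move=> u v c; rewrite /ext_form /ext_act /= -[X in _ = _ * X]qmkK qmkM !shDr !shZr.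
  have cm (x y : Q) : x * (qc a b d * y) = qc a b d * (x * y) by rewrite mulrA -qc_comm mulrA.
  by congr qmk; rewrite !cm ?mulrDl ?mulrDr ?mulrDl !mulrA (AC (2*2) ((1*4)*(2*3))).
- move=> u v; rewrite /ext_form -qmkJ -qmkN (shC u.1 v.1) (shC u.2 v.2) (shC u.1 v.2) (shC u.2 v.1).
  by congr qmk; apply: quat_eq; rewrite !qE; ring.
Defined.

Definition ext_vec (x : V) : extend_shs := (x, 0).

Lemma ext_vec_sh (x y : V) : @sh _ _ _ extend_shs (ext_vec x) (ext_vec y) = qmk (h x y) 0.
Proof. by rewrite /= /ext_form /= !sh0r !sh0l mulr0 !addr0. Qed.

Lemma ext_frame (X : seq V) : frame X -> frame (map ext_vec X).
Proof.
have P (u : V) Y : perp Y u -> perp (map ext_vec Y) (ext_vec u).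
  by elim: Y => //= y Y IHY [e p]; split; [by apply: etrans (ext_vec_sh _ _) _; rewrite e qmk0|exact: IHY].
elim: X => //= x X IHX [x0 px fX]; split; [|exact: P|exact: IHX].
by apply: contra_neq x0 => -[].
Qed.

Lemma ext_disc (X : seq V) : disc (map ext_vec X) = i (disc X).
Proof.
by rewrite /disc big_map rmorph_prod; apply: eq_bigr => x _; rewrite ext_vec_sh nrd_qmk0.
Qed.

(** If x + y sqrt d has norm 0 and y is nonzero, then p = qconj x y is pure of norm -d nrd(y)^2, so
    d is -nrd p up to squares. *)
Lemma ext_division : (2 : F) != 0 -> @quat_division F a b ->
  (forall (p : Q) (s : F), pure p -> p != 0 -> d <> - nrd p * s ^+ 2) ->
  @quat_division E (i a) (i b).
Proof.
move=> two0 division nslot c; rewrite -[c]qmkK; move: (qlo c) (qhi c) => x y.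
rewrite nrd_qmk => /qfree[e1 /eqP]; rewrite mulf_eq0 (negPf two0) /= => /eqP e2.
have [y0|y0] := eqVneq y 0.
  move: e1; rewrite y0 nrd0 mulr0 addr0 => /division->; exact: qmk0.
have ny := nrd_neq0 division y0.
have ex : nrd x = - (d * nrd y) by apply/eqP; rewrite -addr_eq0 e1.
have np : nrd (qconj x * y) = - d * nrd y ^+ 2 by rewrite nrdM nrd_qconj ex; ring.
have [d0|d0] := eqVneq d 0.
  case: (nslot (Q4 a b 0 1 0 0) 0) => //; last by rewrite d0 expr0n mulr0.
  by apply/eqP => /(congr1 (@q1 _ _ _))/eqP; rewrite Q4E oner_eq0.
case: (nslot (qconj x * y) (nrd y)^-1) => //.
  apply/eqP => p0; move: np; rewrite p0 nrd0 => /esym/eqP.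
  by rewrite mulf_eq0 oppr_eq0 (negPf d0) expf_eq0 (negPf ny).
by rewrite np; field.
Qed.
End Extend.

(** * Isotropy of skew-hermitian forms of rank 2k + 2 *)

Section Core.
Variables (F : fieldType) (a b : F) (V : shs a b) (k : nat) (X : seq V).
Local Notation h := (@sh F a b V).
Local Notation "x ** c" := (@sact F a b V x c) (at level 40, left associativity).
Hypothesis two0 : (2 : F) != 0.
Hypothesis I3 : I3_zero F.
Hypothesis division : @quat_division F a b.
Hypothesis un : u_invariant_le F (4 * k).
Hypothesis un2 : quad_u_bound F (4 * k).
Hypothesis fX : frame X.
Hypothesis full : forall u, perp X u -> u = 0.
Hypothesis sX : size X = k.+1.*2.

Lemma skew_hermitian_isotropic : exists2 x : V, x != 0 & h x x = 0.
Proof.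
apply: contrapT => noiso.
have anis (x : V) : h x x = 0 -> x = 0.
  by move=> hx; apply: contrapT => x0; apply: noiso; exists x => //; apply/eqP.
have k0 : (0 < k)%N by have := u_invariant_gt0 un; rewrite muln_gt0.
(* Since u(F) is at least 1, k is positive, and the rank is large enough for the third vector in
   [multiplier_pair]. *)
case: k k0 un2 sX un => // k' _ un2' sX' un'.
have nslot (p : quat a b) (s : F) : pure p -> p != 0 -> disc X <> - nrd p * s ^+ 2.
  exact: (slot_disc_impossible two0 I3 division anis un2' fX full sX').
have [[s es]|nsq] := pselect (exists s, disc X = s ^+ 2).
  exact: (square_disc_impossible two0 I3 division anis un' fX sX' es).
set d := disc X in nslot nsq; have d0 : d != 0 by apply: disc_neq0.
have [E unE] : exists E : quadext d, u_invariant_le E (4 * k'.+1).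
  by apply: un2' => x; apply/eqP => e; apply: nsq; exists x.
have [anE|] := pselect (forall u : extend_shs V E, sh u u = 0 -> u = 0).
  have sXE : size (map (@ext_vec _ _ _ V d E) X) = k'.+2.*2 by rewrite size_map.
  apply: (square_disc_impossible (quadext_two E two0) (quadext_I3 two0 I3)
    (ext_division two0 division nslot) anE unE (ext_frame E fX) sXE (s := qrt E)).
  by rewrite ext_disc qrt_sq.
move=> /existsNP[[x y] /not_implyP[/= /qmk_eq0[/= e1 e2] xy0]].
have y0 : y != 0.
  apply/eqP => y0; apply: xy0; move: e1; rewrite y0 sh0l mulr0 addr0 => /anis->.
  by [].
set q := h y y in e1; have ny : nrd q != 0 := sh_neq0 division anis y0.
have pq : pure q by exact: sh_pure.
have q0' : q != 0 by apply: contra_neq ny => ->; rewrite nrd0.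
pose m := q0 (h x y); have xy : h x y = qc a b m.
  have : qconj (h x y) = h x y.
    by move: e2; rewrite (shC x y) => /eqP; rewrite subr_eq0 => /eqP.
  have self_opp (z : F) : - z = z -> z = 0.
    move=> e; apply/eqP; rewrite -(inj_eq (mulfI two0)) mulr0 mulr_natl mulr2n.
    by rewrite -{1}e addNr.
  by move=> e; apply: quat_eq; rewrite // qE; apply: self_opp; rewrite -{2}e.
have yx : h y x = qc a b (- m) by rewrite shC xy qconj_qc qcN.
(* The relations expressing that x + y sqrt d is isotropic give the part of x orthogonal to y the
   value mu q. *)
pose x' := x - y ** proj_coef y x.
have yx' : h y x' = 0 by apply: proj_perp.
pose mu := - (d + m ^+ 2 / nrd q).
have hx' : h x' x' = qc a b mu * q.
  have -> : h x' x' = h x x'.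
    by rewrite {1}/x' -sactN shDl shZl yx' mulr0 addr0.
  have hxx : h x x = qc a b (- d) * q by rewrite qcN mulNr; apply/eqP; rewrite -addr_eq0 e1.
  rewrite /x' -sactN shDr shZr /proj_coef hxx xy yx -/q /qinv (pure_conj pq).
  rewrite -(qc_comm (- m)) !mulrN opprK !mulrA -!qcM -mulrDl -qcD; congr (qc _ _ _ * _).
  by rewrite /mu; field.
clearbody x'.
have [mu0|mu0] := eqVneq mu 0.
  have m0 : m ^+ 2 = - (d * nrd q).
    have e : m ^+ 2 + d * nrd q = - nrd q * mu by rewrite /mu; field.
    by apply/eqP; rewrite -addr_eq0 e mu0 mulr0.
  have m1 : m != 0 by rewrite -sqrf_eq0 m0 oppr_eq0 mulf_neq0.
  by apply: (nslot q (d / m)) => //; rewrite exprMn exprVn m0; field; rewrite oppr_eq0 mulf_neq0.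
have x'0 : x' != 0.
  apply: contra_neq mu0 => x'0; move: hx'; rewrite x'0 sh0l => /esym/(congr1 (@nrd _ _ _)).
  by rewrite nrdM nrd_qc nrd0 => /eqP; rewrite mulf_eq0 (negPf ny) orbF sqrf_eq0 => /eqP.
(* Scaling by q turns the value mu q into mu nrd(q) q = -Y q, and Y = m^2 + d nrd q has the required
   norm shape. *)
have z0 : x' ** q != 0 := sact_neq0 division x'0 q0'.
pose Y := - (nrd q * mu); have Y0 : Y != 0 by rewrite oppr_eq0 mulf_neq0.
have hz : h (x' ** q) (x' ** q) = qc a b (- Y) * q.
  rewrite shZl shZr hx' mulrA; congr (_ * _); rewrite /Y; move: (mu) => mu'.
  by apply: quat_eq; rewrite /nrd /nrm !qE (pq : q0 q = 0); ring.
apply: (multiplier_pair two0 I3 division anis fX full sX' (Y := Y) (m := m) (n := Y * nrd q) y0 z0 _ hz Y0).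
  by rewrite shZr yx' mul0r.
rewrite hz nrdM nrd_qc -/d sqrrN.
have YE : Y = m ^+ 2 + d * nrd q by rewrite /Y /mu; field.
by clearbody Y; rewrite {1}YE; field; rewrite Y0 ny.
Qed.
End Core.

(** * Descent from the algebra with involution *)

Section Recognition.
Variables (F : fieldType) (D : falgType F) (theta : D -> D).
Hypothesis two0 : (2 : F) != 0.
Hypothesis divD : division D.
Hypothesis dimD : \dim {:D} = 4.
Hypothesis thB : {morph theta : x y / x - y}.
Hypothesis thM : {morph theta : x y / x * y >-> y * x}.
Hypothesis thK : involutive theta.
Hypothesis thF : forall c : F, theta c%:A = c%:A.
Hypothesis fixF : forall t, theta t = t -> exists c : F, t = c%:A.

Let th0 : theta 0 = 0. Proof. by have := thB 0 0; rewrite !subrr. Qed.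
Let thN x : theta (- x) = - theta x. Proof. by have := thB 0 x; rewrite !sub0r th0 sub0r. Qed.
Let thD x y : theta (x + y) = theta x + theta y.
Proof. by rewrite -{1}[y]opprK thB thN opprK. Qed.
Let thZ c x : theta (c *: x) = c *: theta x.
Proof. by rewrite -mulr_algl thM thF mulr_algr. Qed.
Let two0D (x : D) : x + x = 0 -> x = 0.
Proof.
by move=> /eqP; rewrite -mulr2n -scaler_nat scaler_eq0 (negPf two0) => /eqP.
Qed.
Let mul0 (x y : D) : x * y = 0 -> x = 0 \/ y = 0.
Proof.
have [->|x0] := eqVneq x 0; first by left.
by move=> e; right; rewrite -[y]mul1r -(mulVr (divD x0)) -mulrA e mulr0.
Qed.
Let alg_inj (c : F) : c%:A = 0 :> D -> c = 0.
Proof. by move=> /eqP; rewrite scaler_eq0 oner_eq0 orbF => /eqP. Qed.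
Let skew_sqr x y : theta x = - x -> theta y = - y -> exists c : F, x * y + y * x = c%:A.
Proof. by move=> ex ey; apply: fixF; rewrite thD !thM ex ey !mulrNN addrC. Qed.
Let half (x : D) : x = 2^-1 *: (x + theta x) + 2^-1 *: (x - theta x).
Proof.
by rewrite -scalerDr addrACA subrr addr0 -mulr2n -scaler_nat scalerA mulVf ?scale1r.
Qed.
Let trF x : exists c : F, x + theta x = c%:A.
Proof. by apply: fixF; rewrite thD thK addrC. Qed.

Section Basis.
Variables (i j : D) (a b : F).
Hypothesis i0 : i != 0.
Hypothesis j0 : j != 0.
Hypothesis thi : theta i = - i.
Hypothesis thj : theta j = - j.
Hypothesis ii : i * i = a%:A.
Hypothesis jj : j * j = b%:A.
Hypothesis ji : j * i = - (i * j).

Definition quat_map (x : quat a b) : D := q0 x *: 1 + q1 x *: i + q2 x *: j + q3 x *: (i * j).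
Local Notation phi := quat_map.

Lemma quat_mapD x y : phi (x + y) = phi x + phi y.
Proof. by rewrite /phi !qE !scalerDl (AC ((2*2*2)*2) ((1*3*5*7)*(2*4*6*8))). Qed.
Lemma quat_mapZ c x : phi (qc a b c * x) = c *: phi x.
Proof.
rewrite /phi !scalerDr !scalerA; congr (_ *: _ + _ *: _ + _ *: _ + _ *: _); rewrite !qE; ring.
Qed.
Lemma quat_mapi y : phi (Q4 a b 0 1 0 0 * y) = i * phi y.
Proof.
rewrite /phi !mulrDr -!scalerAr mulr1 mulrA ii mulr_algl !scalerA.
rewrite [RHS](AC (3*1) ((2*1)*4*3)) /=.
by congr (_ *: _ + _ *: _ + _ *: _ + _ *: _); rewrite !qE; ring.
Qed.
Lemma quat_mapj y : phi (Q4 a b 0 0 1 0 * y) = j * phi y.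
Proof.
rewrite /phi !mulrDr -!scalerAr mulr1 mulrA ji mulNr -mulrA jj mulr_algr !scalerN !scalerA.
rewrite -!scaleNr [RHS](AC (3*1) ((3*4)*1*2)) /=.
by congr (_ *: _ + _ *: _ + _ *: _ + _ *: _); rewrite !qE; ring.
Qed.
Lemma quat_mapM x y : phi (x * y) = phi x * phi y.
Proof.
rewrite {2}/phi !mulrDl -!scalerAl mul1r -mulrA -quat_mapj -!quat_mapi -!quat_mapZ -!quat_mapD.
by congr phi; apply: quat_eq; rewrite !qE; ring.
Qed.
Lemma quat_mapJ x : theta (phi x) = phi (qconj x).
Proof.
rewrite /phi !thD !thZ !thM thi thj mulrNN ji !qE !scaleNr !scalerN -[1]scale1r thF //.
Qed.
Lemma quat_map_qc c : phi (qc a b c) = c%:A.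
Proof. by rewrite /phi !qE !scale0r !addr0. Qed.

(** Write the image as p + q j with p, q in F(i). As i commutes with F(i) and anticommutes with j, p
    = -q j forces 2 q i j = 0. *)
Lemma quat_map_inj x : phi x = 0 -> x = 0.
Proof.
have icF c : i <> c%:A.
  move=> e; move: thi; rewrite e thF => /eqP; rewrite -addr_eq0 => /eqP/two0D e'.
  by move: i0; rewrite e e' eqxx.
have Fi (c d : F) : c *: 1 + d *: i = 0 -> c = 0 /\ d = 0.
  have [->|d0] := eqVneq d 0; first by rewrite scale0r addr0 => /alg_inj.
  move=> /eqP; rewrite addrC addr_eq0 => /eqP e; case: (icF (- (d^-1 * c))).
  by rewrite scaleNr -scalerA -scalerN -e scalerA mulVf ?scale1r.
move=> e; pose p := q0 x *: 1 + q1 x *: i; pose q := q2 x *: 1 + q3 x *: i.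
have pq : p + q * j = 0.
  by rewrite -[RHS]e /phi /p /q mulrDl -!scalerAl mul1r addrA.
have ci r s : i * (r *: 1 + s *: i) = (r *: 1 + s *: i) * i.
  by rewrite mulrDr mulrDl -!scalerAr -!scalerAl mulr1 mul1r.
have : q * (i * j) = 0.
  apply: two0D; have e1 : q * j = - p by apply/eqP; rewrite -addr_eq0 addrC pq.
  rewrite {1}mulrA -ci -mulrA -[i * j]opprK -ji mulrN (mulrA q) e1.
  by rewrite mulrN mulNr opprK ci addNr.
move=> /mul0[|/mul0[|] /eqP]; last 2 first.
- by rewrite (negPf i0).
- by rewrite (negPf j0).
move=> q0'; move: pq; rewrite q0' mul0r addr0 => /Fi[e0 e1].
by have [e2 e3] := Fi _ _ q0'; apply: quat_eq.
Qed.

Lemma quat_map_surj t : exists x, phi x = t.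
Proof.
pose s := [:: 1; i; j; i * j].
have fs : free s.
  apply/freeP => /= c; rewrite !big_ord_recl big_ord0 addr0 /= !addrA => e.
  have := quat_map_inj (x := Q4 a b (c ord0) (c (lift ord0 ord0))
    (c (lift ord0 (lift ord0 ord0))) (c (lift ord0 (lift ord0 (lift ord0 ord0))))) e.
  move=> z; have := congr1 (@q0 _ _ _) z; have := congr1 (@q1 _ _ _) z.
  have := congr1 (@q2 _ _ _) z; have := congr1 (@q3 _ _ _) z; rewrite !qE => z3 z2 z1 z0.
  move=> r; case: r => -[|[|[|[|//]]]] l.
  - by rewrite -z0; congr c; apply: val_inj.
  - by rewrite -z1; congr c; apply: val_inj.
  - by rewrite -z2; congr c; apply: val_inj.
  - by rewrite -z3; congr c; apply: val_inj.
have full : <<s>>%VS = fullv by apply/eqP; rewrite eqEdim subvf (eqnP fs) dimD.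
have : t \in <<s>>%VS by rewrite full memvf.
rewrite /s !span_cons span_nil addv0 => /memv_addP[_ /vlineP[x0 ->] [_ /memv_addP[_ /vlineP[x1 ->]
  [_ /memv_addP[_ /vlineP[x2 ->] [_ /vlineP[x3 ->] ->]] ->]] ->]].
by exists (Q4 a b x0 x1 x2 x3); rewrite /phi !qE -!addrA.
Qed.
End Basis.

(** As symmetric elements are scalars, skew elements have scalar squares and anticommutators. Take
    skew i and j' outside the span of 1 and i; subtracting a multiple of i from j' makes them
    anticommute, and they generate D by dimension. *)
Lemma quaternion_recognition : exists (a b : F) (phi : quat a b -> D),
  [/\ forall x y, phi (x + y) = phi x + phi y, forall x y, phi (x * y) = phi x * phi y,
     forall x, theta (phi x) = phi (qconj x), forall x, phi x = 0 -> x = 0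
   & forall t, exists x, phi x = t] /\ quat_division a b.
Proof.
have out (U : {vspace D}) : (\dim U < 4)%N -> exists2 t, t \notin U & t - theta t \notin U \/ 1 \notin U.
  move=> dU; have /subvPn[t _ tU] : ~~ (fullv <= U)%VS by apply: contraL dU => /dimvS; rewrite dimD -leqNgt.
  exists t => //; have [U1|] := boolP (1 \in U); last by right.
  left; apply: contra tU => ttU; rewrite [t]half; have [c ->] := trF t.
  by rewrite rpredD ?rpredZ.
have skew t : theta (t - theta t) = - (t - theta t) by rewrite thB thK opprB.
have sqF x : theta x = - x -> exists c : F, x * x = c%:A.
  by move=> ex; apply: fixF; rewrite thM ex mulrNN.
have [|t _ [tU|]] := out 1%VS; [by rewrite dimv1| |by rewrite memv_line].
pose i := t - theta t; have i0 : i != 0 by apply: contraNneq tU; rewrite -/i => ->; rewrite mem0v.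
have thi : theta i = - i := skew t; clearbody i; have [a ii] := sqF i thi.
have a0 : a != 0.
  by apply/eqP => a0; move: ii; rewrite a0 scale0r => /mul0[] /eqP; rewrite (negPf i0).
pose U := <<([:: 1; i] : seq D)%R>>%VS.
have U1 : 1 \in U by apply: memv_span; rewrite inE eqxx.
have [|t' _ [tU'|]] := out U; [exact: leq_ltn_trans (dim_span _) _| |by rewrite U1].
pose j' := t' - theta t'; have thj' : theta j' = - j' := skew t'.
have [c ec] := skew_sqr thi thj'; rewrite -/j' in tU'; clearbody j'.
pose j := j' - (c / (2 * a)) *: i.
have Ui : i \in U by apply: memv_span; rewrite !inE eqxx orbT.
have j0 : j != 0.
  apply: contraNneq tU' => /eqP; rewrite subr_eq0 => /eqP->; exact: rpredZ.
have thj : theta j = - j.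
  by rewrite /j thB thZ thi thj' scalerN opprK opprD opprK.
have [b jj] := sqF j thj.
have ji : j * i = - (i * j).
  apply/eqP; rewrite -addr_eq0 /j mulrBl mulrBr -scalerAl. rewrite -scalerAr ii addrC addrACA ec.
  rewrite -opprD -mulr2n -scaler_nat !scalerA -scalerBl.
  by rewrite (_ : c - _ = 0) ?scale0r //; field; rewrite two0 a0.
exists a, b, (quat_map i j (b := b)); split; first split.
- exact: quat_mapD.
- exact: quat_mapM.
- exact: quat_mapJ.
- exact: quat_map_inj.
- exact: quat_map_surj.
move=> x nx; suff : quat_map i j x = 0 by apply: quat_map_inj.
have : quat_map i j x * quat_map i j (qconj x) = 0.
  by rewrite -quat_mapM // mul_qconj nx quat_map_qc scale0r.
case/mul0 => // e; rewrite -[x]qconjK -quat_mapJ // e th0 //.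
Qed.
End Recognition.

(** * Dimensions of ideals and corners after splitting *)

Section Splitting.
Variables (F : fieldType) (A : falgType F) (L : fieldType) (iota : {rmorphism F -> L}) (n : nat).
Variable f : {rmorphism A -> 'M[L]_n}.
Hypothesis spl : splitting iota f.
Local Notation N := (\dim {:A}).
Local Notation base := (vbasis {:A}).

Let basis_mx : 'M[L]_(N, n * n) := \matrix_i mxvec (f base`_i).

Let coord_mx (a : A) : 'rV[F]_N := \row_i coord base i a.

Let sum_basis (l : 'rV[L]_N) : l *m basis_mx = mxvec (\sum_i l 0 i *: f base`_i).
Proof.
by rewrite mulmx_sum_row linear_sum; apply: eq_bigr => i _; rewrite rowK linearZ.
Qed.

Let mxvec_split a : mxvec (f a) = map_mx iota (coord_mx a) *m basis_mx.
Proof.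
rewrite sum_basis {1}(coord_vbasis (memvf a)) rmorph_sum; congr mxvec.
by apply: eq_bigr => i _; rewrite spl.1 !mxE.
Qed.

Let base_free : row_free basis_mx.
Proof.
apply/row_freeP; have [_ [g gK _]] := spl.
suff : kermx basis_mx == 0 by rewrite kermx_eq0 => /row_freeP.
apply/rowV0P => v /sub_kermxP; rewrite sum_basis => /(congr1 vec_mx).
rewrite mxvecK linear0 => e; pose l : {ffun 'I_N -> L} := [ffun i => v 0 i].
have : l = [ffun=> 0].
  apply: (can_inj gK); rewrite [RHS]big1 => [|i _]; last by rewrite ffunE scale0r.
  by rewrite -[RHS]e; apply: eq_bigr => i _; rewrite ffunE.
by move/ffunP => h; apply/rowP => i; have := h i; rewrite !ffunE !mxE.
Qed.

Lemma splitting_dim : N = (n * n)%N.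
Proof.
apply/eqP; rewrite eqn_leq -{1}(eqP base_free) rank_leq_col /=.
rewrite -(mxrank1 L (n * n)) (leq_trans _ (rank_leq_row basis_mx)) // mxrankS //.
apply/row_subP => i; have [_ [g _ gK]] := spl.
set v := row i _; rewrite -[v]vec_mxK -(gK (vec_mx v)).
rewrite (_ : mxvec _ = (\row_i g (vec_mx v) i) *m basis_mx) ?submxMl // sum_basis.
by congr mxvec; apply: eq_bigr => j _; rewrite mxE.
Qed.

Lemma splitting_inj a : f a = 0 -> a = 0.
Proof.
move=> fa; have : map_mx iota (coord_mx a) = 0.
  by apply: (row_free_inj base_free); rewrite -mxvec_split fa mul0mx linear0.
move=> /eqP; rewrite map_mx_eq0 => /eqP/rowP e.
rewrite (coord_vbasis (memvf a)) big1 // => i _.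
by have := e i; rewrite !mxE => ->; rewrite scale0r.
Qed.

(* Linearly independent elements of A have L-independent images.             *)
Lemma dim_split_le (U : {vspace A}) p (G : 'M[L]_(p, n * n)) :
  (forall u, u \in U -> (mxvec (f u) <= G)%MS) -> (\dim U <= \rank G)%N.
Proof.
move=> sUG; pose C := \matrix_(i < \dim U) coord_mx (vbasis U)`_i.
have fC : row_free C.
  rewrite -kermx_eq0; apply/rowV0P => v /sub_kermxP; rewrite mulmx_sum_row => e.
  have e0 : \sum_i v 0 i *: (vbasis U)`_i = 0.
    rewrite (coord_vbasis (memvf (\sum_i _))) big1 // => j _.
    have := congr1 (fun M : 'rV_N => M 0 j) e; rewrite summxE mxE => ej.
    rewrite linear_sum -[X in X *: _]/(\sum_i _) (_ : \sum_i _ = 0) ?scale0r // -[RHS]ej.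
    by apply: eq_bigr => i _; rewrite linearZ !mxE.
  have /freeP fU := basis_free (vbasisP U).
  by apply/rowP => i; rewrite mxE; apply: fU e0 i.
rewrite -(eqP fC) -(mxrank_map iota) -(mxrankMfree _ base_free) mxrankS //.
apply/row_subP => i; rewrite row_mul -map_row rowK -mxvec_split.
by apply: sUG; rewrite vbasis_mem // mem_nth // size_tuple.
Qed.

(** The space w A v, covering A e, e A e and sigma(e) A e. *)
Definition sandwich (w v : A) : {vspace A} := ((amulr v \o amull w)%VF @: fullv)%VS.

Local Arguments sandwich (w v)%_R.

Lemma sandwichP w v x : reflect (exists y, x = w * y * v) (x \in sandwich w v).
Proof.
apply: (iffP memv_imgP) => [[y _ ->]|[y ->]]; exists y; rewrite ?memvf //;
by rewrite lfunE /= !lfunE.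
Qed.

(** By rank factorisations of f(w) and f(v), the image of w y v depends L-linearly on a matrix whose
    sides are these two ranks. *)
Lemma dim_sandwich_le w v : (\dim (sandwich w v) <= \rank (f w) * \rank (f v))%N.
Proof.
pose g := mulmx (col_base (f w)) \o mulmxr (row_base (f v)).
apply: leq_trans (rank_leq_row (lin_mx g)); apply: dim_split_le => u /sandwichP[y ->].
have -> : f (w * y * v) = g (row_base (f w) *m (f y *m col_base (f v))).
  transitivity ((col_base (f w) *m row_base (f w)) *m f y *m (col_base (f v) *m row_base (f v))).
    by rewrite !mulmx_base !rmorphM.
  by rewrite -[RHS]/(_ *m (_ *m _)) !mulmxA.
by rewrite -(mul_vec_lin g) submxMl.
Qed.

Section Idempotent.
Variable e : A.
Hypothesis ee : e * e = e.

Let rank_compl : (\rank (f (1 - e)%R) <= n - \rank (f e))%N.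
Proof.
suff : (\rank (f (1 - e)%R) + \rank (f e) <= n)%N by lia.
by apply: mulmx0_rank_max; rewrite -[_ *m _]rmorphM mulrBl mul1r ee subrr rmorph0.
Qed.

(** A e and A (1 - e) span A, of dimension n^2, and the second has dimension at most n (n - rank
    f(e)). *)
Lemma dim_left_ideal : (n * \rank (f e) <= \dim (sandwich 1 e))%N.
Proof.
have : (fullv <= sandwich 1 e + sandwich 1 (1 - e))%VS.
  apply/subvP => x _; have -> : x = x * e + x * (1 - e) by rewrite -mulrDr addrC subrK mulr1.
  by rewrite memv_add //; apply/sandwichP; exists x; rewrite mul1r.
move=> /dimvS le; have := leq_trans le (dimv_add_leqif _ _); rewrite splitting_dim.
have := dim_sandwich_le 1 (1 - e); rewrite rmorph1 mxrank1.
have := rank_compl; have := rank_leq_row (f e).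
move: (\rank _) (\rank _) (\dim _) (\dim _) => r s c d; nia.
Qed.

Lemma dim_corner : \dim (sandwich e e) = (\rank (f e) ^ 2)%N.
Proof.
apply/eqP; rewrite eqn_leq dim_sandwich_le /=.
have : (sandwich 1 e <= sandwich e e + sandwich (1 - e) e)%VS.
  apply/subvP => _ /sandwichP[x ->].
  have -> : 1 * x * e = e * x * e + (1 - e) * x * e by rewrite -!mulrDl addrC subrK.
  by rewrite memv_add //; apply/sandwichP; exists x.
move=> /dimvS le; have := leq_trans le (dimv_add_leqif _ _).
have := dim_left_ideal; have := dim_sandwich_le (1 - e) e.
have := rank_compl; have := rank_leq_row (f e).
move: (\rank _) (\rank _) (\dim _) (\dim _) (\dim _) => r s c d g; nia.
Qed.
End Idempotent.

Section Adjoint.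
Variables (sigma : A -> A) (B : 'M[L]_n).
Hypothesis symB : B^T = B.
Hypothesis unitB : B \in unitmx.
Hypothesis adjB : forall (a : A) (x y : 'cV[L]_n),
  bilin B (f a *m x) y = bilin B x (f (sigma a) *m y).

Lemma adjoint_mx a : (f a)^T *m B = B *m f (sigma a).
Proof.
apply/matrixP => i j; have := adjB a (delta_mx i 0) (delta_mx j 0).
rewrite /bilin trmx_mul -!mulmxA !(mulmxA _ _ (delta_mx j 0)) -!colE trmx_delta -!rowE.
by move/matrixP/(_ 0 0); rewrite !mxE.
Qed.

Lemma rank_sigma a : \rank (f (sigma a)) = \rank (f a).
Proof.
have fB : row_free B by rewrite row_free_unit.
have uB : row_full B by rewrite row_full_unit.
by rewrite -(eqmxMfull _ uB) -adjoint_mx mxrankMfree // mxrank_tr.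
Qed.

Definition skew_unit p : 'M[L]_p :=
  \matrix_(i, j) (if (i < j)%N then 1 else if (j < i)%N then - 1 else 0).

Lemma skew_small p (S : 'M[L]_p) : (2 : L) != 0 -> (p <= 2)%N -> S^T = - S ->
  exists s, S = s *: skew_unit p.
Proof.
move=> two0 p2 /matrixP sS.
have diag i : S i i = 0.
  have /eqP := sS i i; rewrite !mxE -addr_eq0 -mulr2n -mulr_natl mulf_eq0 (negPf two0).
  by move/eqP.
case: p p2 S sS diag => [|[|[|//]]] _ S sS diag.
- by exists 0; apply/matrixP => -[].
- by exists 0; apply/matrixP => i j; rewrite !ord1 diag mxE mul0r.
- exists (S 0 1); apply/matrixP => i j; rewrite !mxE.
  case: i j => [[|[|//]] i] [[|[|//]] j] /=; rewrite ?mulr0 ?mulr1 ?mulrN1.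
  + by rewrite -(diag 0); congr (S _ _); apply: val_inj.
  + by congr (S _ _); apply: val_inj.
  + have := sS 0 1; rewrite !mxE => <-; congr (S _ _); exact: val_inj.
  + by rewrite -(diag 1); congr (S _ _); apply: val_inj.
Qed.

(** Here orthogonality of the involution enters: for skew u the matrix B f(u) is skew-symmetric and
    is induced from a skew-symmetric matrix of size rank f(e), at most 2. *)
Lemma dim_skew e (U : {vspace A}) : (2 : L) != 0 -> e * e = e -> sigma e * sigma e = sigma e ->
  (\rank (f e) <= 2)%N ->
  (forall u, u \in U -> u \in sandwich (sigma e) e /\ sigma u = - u) ->
  (\dim U <= (\rank (f e)).-1)%N.
Proof.
move=> two0 ee sse r2 skU; set r := \rank (f e) in r2 *.
pose R := row_base (f e); pose C := col_base (f e).
have EE : f e = C *m R by rewrite mulmx_base.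
pose G : 'M[L]_n := invmx B *m (R^T *m skew_unit r *m R).
have : (\dim U <= \rank (mxvec G))%N.
  apply: dim_split_le => u /skU[/sandwichP[y ey] su].
  have skY : (B *m f u)^T = - (B *m f u).
    by rewrite trmx_mul symB adjoint_mx su rmorphN mulmxN.
  have fE : f e *m f e = f e by rewrite -[_ *m _]rmorphM ee.
  have eY : B *m f u = (f e)^T *m (B *m f u) *m f e.
    have -> : (f e)^T *m (B *m f u) = B *m f u.
      by rewrite mulmxA adjoint_mx -mulmxA -[_ *m f u]rmorphM ey !mulrA sse.
    by rewrite -mulmxA -[f u *m _]rmorphM ey -!mulrA ee.
  pose S := C^T *m (B *m f u) *m C.
  have [s eS] : exists s, S = s *: skew_unit r.
    apply: skew_small => //; rewrite /S trmx_mul (trmx_mul C^T) trmxK skY.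
    by rewrite mulNmx mulmxN mulmxA.
  have -> : f u = s *: G.
    rewrite -[LHS](mulKmx unitB) eY EE trmx_mul.
    rewrite (_ : _ *m C^T *m _ *m _ = R^T *m S *m R); last by rewrite /S !mulmxA.
    by rewrite eS -scalemxAr -scalemxAl -scalemxAr.
  by rewrite linearZ scalemx_sub.
have [r1|r1] := leqP r 1.
  have -> : G = 0.
    rewrite /G (_ : skew_unit r = 0) ?mulmx0 ?mul0mx ?mulmx0 //.
    apply/matrixP => i j; rewrite !mxE.
    have := leq_trans (ltn_ord i) r1; have := leq_trans (ltn_ord j) r1.
    by rewrite !ltnS !leqn0 => /eqP-> /eqP->.
  by rewrite linear0 mxrank0 => /leq_trans; apply.
move=> le; apply: leq_trans le _; apply: leq_trans (rank_leq_row _) _.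
by rewrite -ltnS prednK // ltnW.
Qed.
End Adjoint.
End Splitting.

Section Diagonal.
Variables (F : fieldType) (a b : F) (r : nat) (q : 'I_r -> quat a b).
Local Notation Q := (quat a b).
Hypothesis pq : forall s, pure (q s).

Definition diag_act (x : {ffun 'I_r -> Q}) (c : Q) : {ffun 'I_r -> Q} := [ffun s => x s * c].
Definition diag_form (x y : {ffun 'I_r -> Q}) : Q := \sum_s qconj (x s) * q s * y s.

Definition diag_shs : shs a b.
Proof.
apply: (@SHS F a b {ffun 'I_r -> Q} diag_act diag_form).
- by move=> x y c; apply/ffunP => s; rewrite !ffunE mulrDl.
- by move=> x c d; apply/ffunP => s; rewrite !ffunE mulrDr.
- by move=> x c d; apply/ffunP => s; rewrite !ffunE mulrA.
- by move=> x; apply/ffunP => s; rewrite !ffunE mulr1.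
- by move=> x y z; rewrite -big_split; apply: eq_bigr => s _; rewrite ffunE mulrDr.
- by move=> x y c; rewrite mulr_suml; apply: eq_bigr => s _; rewrite ffunE mulrA.
- move=> x y; rewrite (big_morph (@qconj _ _ _) (@qconjD _ _ _) (@qconj0 _ _ _)) -sumrN.
  apply: eq_bigr => s _; rewrite !qconjM qconjK (pure_conj (pq s)).
  by rewrite mulNr mulrN opprK mulrA.
Defined.

Local Notation V := diag_shs.

Definition diag_delta (s : 'I_r) : V := [ffun t => (s == t)%:R].

Lemma diag_delta_form s (u : V) : sh (diag_delta s) u = q s * (u : {ffun 'I_r -> Q}) s.
Proof.
rewrite /= /diag_form (bigD1 s) //= big1 => [|t ts].
  by rewrite /diag_delta ffunE eqxx qconj1 mul1r addr0.
by rewrite /diag_delta ffunE eq_sym (negPf ts) qconj0 !mul0r.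
Qed.

Lemma diag_perp (l : seq 'I_r) (u : V) : perp (map diag_delta l) u <->
  forall s, s \in l -> q s * (u : {ffun 'I_r -> Q}) s = 0.
Proof.
elim: l => [|s l IHl] //=; rewrite -/(diag_form _ _) -[diag_form _ _]/(sh (diag_delta s) u).
rewrite diag_delta_form IHl; split=> [[e p] t|p].
  by rewrite inE => /orP[/eqP->|/p].
by split=> [|t tl]; apply: p; rewrite inE ?eqxx ?tl ?orbT.
Qed.

Lemma diag_frame (l : seq 'I_r) : uniq l -> frame (map diag_delta l).
Proof.
elim: l => [|s l IHl] //= /andP[sl /IHl fl]; split=> //; last first.
  apply/diag_perp => t tl; rewrite /diag_delta ffunE.
  by case: eqP => [e|_]; [rewrite e tl in sl|rewrite mulr0].
apply/eqP => /ffunP/(_ s); rewrite !ffunE eqxx => /eqP.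
by rewrite oner_eq0.
Qed.
End Diagonal.

Lemma diag_isotropic (F : fieldType) (a b : F) (k : nat) (q : 'I_(k.+1.*2) -> quat a b) :
  (2 : F) != 0 -> I3_zero F -> quat_division a b ->
  u_invariant_le F (4 * k) -> quad_u_bound F (4 * k) ->
  (forall s, pure (q s)) -> (forall s, q s != 0) ->
  exists2 c : 'I_(k.+1.*2) -> quat a b, exists s, c s != 0
    & \sum_s qconj (c s) * q s * c s = 0.
Proof.
move=> two0 I3 dv un un2 pq q0.
have [|||c c0 hc] := @skew_hermitian_isotropic F a b (diag_shs pq) k
  (map (diag_delta pq) (enum 'I_(k.+1.*2))) two0 I3 dv un un2.
- by apply: diag_frame; apply: enum_uniq.
- move=> u /diag_perp p; apply/ffunP => s; rewrite [RHS]ffunE.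
  have nq := nrd_neq0 dv (q0 s).
  by rewrite -[LHS]mul1r -(qinv_mul nq) -mulrA p ?mem_enum // mulr0.
- by rewrite size_map size_enum_ord.
exists c => //; apply: contrapT => nz; case/eqP: c0; apply/ffunP => s; rewrite [RHS]ffunE.
by apply: contrapT => cs; apply: nz; exists s; apply/eqP.
Qed.

(** * From the involution to a form over the division algebra *)

Section Descent.
Variables (F : fieldType) (A D : falgType F) (L : fieldType) (iota : {rmorphism F -> L}) (n : nat).
Variables (f : {rmorphism A -> 'M[L]_n}) (sigma : A -> A) (B : 'M[L]_n) (eps : {linear D -> A}).
Hypothesis two0 : (2 : F) != 0.
Hypothesis spl : splitting iota f.
Hypothesis symB : B^T = B.
Hypothesis unitB : B \in unitmx.
Hypothesis adjB : forall (a : A) (x y : 'cV[L]_n),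
  bilin B (f a *m x) y = bilin B x (f (sigma a) *m y).
Hypothesis sigma_lin : linear sigma.
Hypothesis sigmaM : {morph sigma : x y / x * y >-> y * x}.
Hypothesis sigmaK : involutive sigma.
Hypothesis epsM : {morph eps : x y / x * y}.
Hypothesis eps_inj : injective eps.
Hypothesis eps_corner : forall y, exists d, eps 1 * y * eps 1 = eps d.
Hypothesis divD : division D.
Hypothesis centD : central D.
Hypothesis noiso : forall x, sigma x * x = 0 -> x = 0.

Local Notation e := (eps 1).
(** A e is a right D-module through [eps], and (x, y) |-> sigma(x) y is a form on it with values in
    sigma(e) A e, anisotropic by [noiso]. *)
Local Notation V := (sandwich 1%R e).
Local Notation M := (sandwich (sigma e) e).
Local Notation rho := (\rank (f e)).

Let sigmaB : {morph sigma : x y / x - y}.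
Proof.
move=> x y; have := sigma_lin (-1) y x.
by rewrite !scaleN1r (addrC _ x) (addrC _ (sigma x)).
Qed.
Let sigma0 : sigma 0 = 0. Proof. by have := sigmaB 0 0; rewrite !subrr. Qed.
Let sigmaZ c x : sigma (c *: x) = c *: sigma x.
Proof. by have := sigma_lin c x 0; rewrite !addr0 sigma0 addr0. Qed.
Let sigmaD : {morph sigma : x y / x + y}.
Proof. by move=> x y; have := sigma_lin 1 x y; rewrite !scale1r. Qed.
Let sigma_sum I (r : seq I) (g : I -> A) : sigma (\sum_(i <- r) g i) = \sum_(i <- r) sigma (g i).
Proof. exact: (big_morph _ sigmaD sigma0). Qed.

Let ee : e * e = e. Proof. by rewrite -epsM mulr1. Qed.
Let see : sigma e * sigma e = sigma e. Proof. by rewrite -sigmaM ee. Qed.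
Let e0 : e != 0. Proof. by rewrite -(raddf0 eps) (inj_eq eps_inj) oner_eq0. Qed.

Let memV x : (x \in V) -> x * e = x.
Proof. by case/sandwichP => y ->; rewrite -mulrA ee. Qed.
Let memVP x : x * e = x -> x \in V.
Proof. by move=> <-; apply/sandwichP; exists x; rewrite mul1r. Qed.
Let memM x y : x \in V -> y \in V -> sigma x * y \in M.
Proof.
move=> /memV ex /memV ey; apply/sandwichP; exists (sigma x * y).
by rewrite mulrA -sigmaM ex -mulrA ey.
Qed.
Let M_eps u d : u \in M -> u * eps d \in M.
Proof.
case/sandwichP => y ->; apply/sandwichP; exists (y * eps d).
by rewrite -!mulrA -!epsM mulr1 mul1r.
Qed.
Let eps_M u d : u \in M -> sigma (eps d) * u \in M.
Proof.
case/sandwichP => y ->; apply/sandwichP; exists (sigma (eps d) * y).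
by rewrite !mulrA -!sigmaM -!epsM mulr1 mul1r.
Qed.
Let M_V u : u \in M -> u * e = u.
Proof. by case/sandwichP => y ->; rewrite -mulrA ee. Qed.
Let sM_V u : u \in M -> sigma e * u = u.
Proof. by case/sandwichP => y ->; rewrite !mulrA see. Qed.
Let eps_reg u d : u \in M -> u != 0 -> u * eps d = 0 -> d = 0.
Proof.
move=> uM u0 ud; apply: contraNeq u0 => d0.
by rewrite -(M_V uM) -(mulrV (divD d0)) epsM mulrA ud mul0r.
Qed.

Let dimV : (n * rho <= \dim V)%N.
Proof. exact (dim_left_ideal spl ee). Qed.
Let dimM : (\dim M <= rho * rho)%N.
Proof. by have := dim_sandwich_le spl (sigma e) e; rewrite (rank_sigma unitB adjB). Qed.

Lemma dim_corner_ring : \dim {:D} = (rho ^ 2)%N.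
Proof.
rewrite -(dim_corner spl ee) -(@limg_dim_eq _ _ _ (linfun eps) fullv).
  congr (\dim _); apply/vspaceP => x; apply/memv_imgP/sandwichP.
    by case=> d _ ->; exists (eps d); rewrite lfunE -!epsM mul1r mulr1.
  by case=> y ->; have [d ->] := eps_corner y; exists d; rewrite ?memvf // lfunE.
apply/eqP; rewrite -subv0; apply/subvP => d; rewrite memv_cap memv_ker lfunE => /andP[_].
by rewrite -(raddf0 eps) (inj_eq eps_inj) memv0.
Qed.

(** The values lie on the line of the symmetric element u = sigma(e) e, so dividing by u gives a
    symmetric bilinear form over F on A e, of dimension at least n. *)
Lemma split_case k : u_invariant_le F (4 * k) -> (4 * k < n)%N -> rho = 1 -> False.
Proof.
move=> un kn r1; pose u := sigma e * e.
have uM : u \in M by apply: memM; apply: memVP; rewrite ee.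
have u0 : u != 0 by apply: contraNneq e0 => /noiso->.
have Mu : M = <[u]>%VS.
  apply/esym/eqP; rewrite eqEdim -memvE uM dim_vline u0.
  by have := dimM; rewrite r1.
have su : sigma u = u by rewrite /u sigmaM sigmaK.
set N := \dim V; pose x (i : 'I_N) := (vbasis V)`_i.
have xV i : x i \in V by rewrite vbasis_mem // mem_nth // size_tuple.
have ex (p : 'I_N * 'I_N) : exists c, sigma (x p.1) * x p.2 = c *: u.
  by apply/vlineP; rewrite -Mu; apply: memM.
have [b b_def] := choice ex; have hb i j : sigma (x i) * x j = b (i, j) *: u := b_def (i, j).
pose G := \matrix_(i, j) b (i, j).
have sG : G^T = G.
  apply/matrixP => i j; rewrite !mxE; have := congr1 sigma (hb i j).
  rewrite sigmaM sigmaK hb sigmaZ su => /eqP; rewrite -subr_eq0 -scalerBl scaler_eq0 (negPf u0).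
  by rewrite orbF subr_eq0 => /eqP.
have [|v v0 vG] := isotropic_vector un sG.
  by apply: leq_trans kn _; have := dimV; rewrite r1 muln1.
have : \sum_i v 0 i *: x i = 0.
  apply: noiso; rewrite sigma_sum mulr_suml.
  have -> : \sum_i sigma (v 0 i *: x i) * (\sum_j v 0 j *: x j) = (v *m G *m v^T) 0 0 *: u.
    rewrite mxE; under [in RHS]eq_bigr do rewrite mxE mulr_suml.
    rewrite exchange_big scaler_suml; apply: eq_bigr => i _.
    rewrite scaler_suml mulr_sumr; apply: eq_bigr => j _.
    rewrite sigmaZ -scalerAl -scalerAr hb !scalerA !mxE; congr (_ *: _).
    by rewrite -mulrA mulrC -mulrA mulrC (mulrC (b (i, j))).
  by rewrite vG mxE scale0r.
move=> sv; case/negP: v0; apply/eqP/rowP => i; rewrite mxE.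
have /freeP fU := basis_free (vbasisP V).
exact: (fU (fun i => v 0 i) sv i).
Qed.

Section Quaternionic.
Hypothesis r2 : rho = 2.

Let dimD : \dim {:D} = 4. Proof. by rewrite dim_corner_ring r2. Qed.
Let dimM4 : (\dim M <= 4)%N. Proof. by have := dimM; rewrite r2. Qed.

Lemma commutative_dim : (forall s t : D, s * t = t * s) -> False.
Proof.
move=> comm; have : (fullv <= 'Z({:D}))%VS.
  by apply/subvP => x _; rewrite memv_cap memvf; apply/centvP => y _.
by move=> /dimvS; rewrite centD dimv1 dimD.
Qed.

(** If sigma fixed M pointwise, then sigma(eps t) v = v eps t for v = sigma(e) e, and reversing
    products would make D commutative. *)
Lemma skew_exists : exists u, [/\ u \in M, u != 0 & sigma u = - u].
Proof.
apply: contrapT => none; pose v := sigma e * e.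
have eV : e \in V by apply: memVP.
have vM : v \in M by exact: memM.
have v0 : v != 0 by apply: contraNneq e0 => /noiso->.
have sM m : m \in M -> sigma m \in M.
  case/sandwichP => y ->; apply/sandwichP; exists (sigma y).
  by rewrite !sigmaM sigmaK mulrA.
have symM m : m \in M -> sigma m = m.
  move=> mM; apply: contrapT => ne; apply: none; exists (m - sigma m); split.
  - by rewrite rpredB // sM.
  - by rewrite subr_eq0; apply/eqP => e'; apply: ne.
  - by rewrite sigmaB sigmaK opprB.
have sv : sigma v = v := symM v vM.
have tv t : sigma (eps t) * v = v * eps t.
  by rewrite -(symM _ (M_eps t vM)) sigmaM sv.
apply: commutative_dim => s t; apply/eqP; rewrite -subr_eq0; apply/eqP.
apply: (eps_reg vM v0); rewrite raddfB mulrBr -(tv (s * t)) epsM sigmaM -mulrA tv mulrA tv.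
by rewrite -mulrA -epsM subrr.
Qed.

(* Every element of M is u * eps t for a skew u; conjugating sigma by u turns *)
(* it into the canonical involution of D.                                     *)
Lemma descent_involution : exists (u : A) (theta : D -> D),
  [/\ u \in M, u != 0, sigma u = - u & forall t, sigma (eps t) * u = u * eps (theta t)] /\
  [/\ {morph theta : x y / x - y}, {morph theta : x y / x * y >-> y * x}, involutive theta,
      forall c : F, theta c%:A = c%:A & forall t, theta t = t -> exists c : F, t = c%:A]
  /\ forall m, m \in M -> exists t, m = u * eps t.
Proof.
have [u [uM u0 su]] := skew_exists.
have uinj s t : u * eps s = u * eps t -> s = t.
  move=> est; apply/eqP; rewrite -subr_eq0; apply/eqP/(eps_reg uM u0).
  by rewrite raddfB mulrBr est subrr.
have uepsM : forall m, m \in M -> exists t, m = u * eps t.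
  pose g := (amull u \o linfun eps)%VF.
  have gE t : g t = u * eps t by rewrite lfunE /= !lfunE.
  have dimg : \dim (g @: fullv) = 4.
    rewrite limg_dim_eq ?dimD //; apply/eqP; rewrite -subv0; apply/subvP => d.
    rewrite memv_cap memv_ker gE => /andP[_ /eqP/(eps_reg uM u0)->].
    exact: mem0v.
  have gM : (g @: fullv <= M)%VS.
    by apply/subvP => _ /memv_imgP[d _ ->]; rewrite gE M_eps.
  have eM : (g @: fullv)%VS = M by apply/eqP; rewrite eqEdim gM dimg.
  by move=> m; rewrite -eM => /memv_imgP[t _ ->]; exists t; rewrite gE.
have [theta th] := choice (fun t => uepsM _ (eps_M t uM)).
have thK : involutive theta.
  move=> t; apply: uinj; rewrite -th; have := congr1 sigma (th t).
  by rewrite !sigmaM sigmaK su mulNr mulrN => /oppr_inj.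
have thF c : theta c%:A = c%:A.
  by apply: uinj; rewrite -th !linearZ /= sigmaZ -scalerAl -scalerAr (M_V uM) (sM_V uM).
exists u, theta; split=> //; split=> //; split=> //.
- by move=> x y; apply: uinj; rewrite -th !raddfB /= sigmaB mulrBl mulrBr !th.
- by move=> x y; apply: uinj; rewrite -th !epsM sigmaM -mulrA th mulrA th mulrA.
(* If [theta] fixes t, then u eps t is again skew in M; by [dim_skew] it is a multiple of u, so t is
   a scalar. *)
move=> t tt; pose w := u * eps t.
have sw : sigma w = - w by rewrite /w sigmaM su mulrN th tt.
have wM : w \in M := M_eps t uM.
pose U := (<[u]> + <[w]>)%VS.
have skU m : m \in U -> m \in M /\ sigma m = - m.
  case/memv_addP => _ /vlineP[c ->] [_ /vlineP[d ->] ->].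
  by rewrite rpredD ?rpredZ // sigmaD !sigmaZ su sw !scalerN opprD.
have two0L : (2 : L) != 0 by rewrite -(rmorph_nat iota) fmorph_eq0.
have dU : (\dim U <= 1)%N.
  have := dim_skew spl symB unitB adjB two0L ee see; rewrite r2 => /(_ U erefl); apply.
  exact: skU.
have uU : (<[u]> <= U)%VS by apply: addvSl.
have eU : <[u]>%VS = U by apply/eqP; rewrite eqEdim uU dim_vline u0.
have : w \in <[u]>%VS by rewrite eU -[w]add0r memv_add ?mem0v ?memv_line.
case/vlineP => c wc; exists c; apply: uinj; rewrite -/w wc linearZ /=.
by rewrite -scalerAr M_V.
Qed.

(** A e has dimension at least 2n and each orthogonality condition costs at most 4; as n > 4k + 2, a
    nonzero vector remains for each of 2k + 2 choices. *)
Lemma orthogonal_family k l : (4 * k + 2 < n)%N -> (l <= k.+1.*2)%N ->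
  exists (xs : seq A) (U : {vspace A}),
  [/\ size xs = l, all (fun x => (x != 0) && (x \in V)) xs,
      pairwise (fun x y => sigma x * y == 0) xs &
  [/\ (U <= V)%VS, forall x y, x \in xs -> y \in U -> sigma x * y = 0
    & (2 * n <= \dim U + 4 * l)%N]].
Proof.
move=> kn; elim: l => [|l IHl] lk.
  exists [::], V; split=> //; split=> //.
  by rewrite addn0; have := dimV; rewrite r2 mulnC.
have [xs [U [sxs axs pxs [UV xsU dU]]]] := IHl (ltnW lk).
pose y := vpick U; have yU : y \in U := memv_pick U.
have y0 : y != 0.
  rewrite vpick0 -dimv_eq0 -lt0n; move: lk dU; rewrite -muln2; lia.
have yV := subvP UV y yU.
have sym x z : sigma x * z = 0 -> sigma z * x = 0.
  by move/(congr1 sigma); rewrite sigmaM sigmaK sigma0.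
exists (y :: xs), (U :&: lker (amull (sigma y)))%VS; split=> /=.
- by rewrite sxs.
- by rewrite y0 yV.
- by rewrite pxs andbT; apply/allP => x /xsU/(_ yU)/sym->.
split.
- exact: subv_trans (capvSl _ _) UV.
- move=> x z; rewrite inE memv_cap memv_ker lfunE /= => /orP[/eqP->|xxs] /andP[zU /eqP zy] //.
  exact: xsU.
have : (amull (sigma y) @: U <= M)%VS.
  by apply/subvP => _ /memv_imgP[z zU ->]; rewrite lfunE; apply: memM => //; apply: subvP UV z zU.
move=> /dimvS le; rewrite mulnS (leq_trans dU) // -(limg_ker_dim (amull (sigma y)) U).
by rewrite -addnA leq_add2l leq_add2r (leq_trans le dimM4).
Qed.

(** Dividing by u turns the values sigma(x) x into pure quaternions. The combination given by
    [diag_isotropic] is isotropic, hence 0, and pairing it with the x_s kills its coefficients. *)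
Lemma quaternion_case k : I3_zero F -> u_invariant_le F (4 * k) -> quad_u_bound F (4 * k) ->
  (4 * k + 2 < n)%N -> False.
Proof.
move=> I3 un un2 kn.
have [u [theta [[uM u0 su th] [[thB thM thK thF fixF] uepsM]]]] := descent_involution.
have [a [b [phi [[phiD phiM phiJ phi_inj phi_surj] dv]]]] :=
  quaternion_recognition two0 divD dimD thB thM thK thF fixF.
have [xs [_ [sxs axs pxs _]]] := orthogonal_family kn (leqnn k.+1.*2).
pose x (s : 'I_(k.+1.*2)) := xs`_s.
have /allP xsP := axs.
have xxs s : x s \in xs by rewrite mem_nth // sxs.
have x0 s : x s != 0 by have /andP[] := xsP _ (xxs s).
have xV s : x s \in V by have /andP[] := xsP _ (xxs s).
have orth_lt (s t : 'I_(k.+1.*2)) : (s < t)%N -> sigma (x s) * x t = 0.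
  by move=> st; apply/eqP; have /(pairwiseP 0) := pxs; apply; rewrite ?inE ?sxs.
have orth s t : s != t -> sigma (x s) * x t = 0.
  rewrite -val_eqE; case: (ltngtP s t) => // [/orth_lt//|/orth_lt/(congr1 sigma) e' _].
  by move: e'; rewrite sigmaM sigmaK sigma0.
pose psi y := eps (phi y).
have psiM y z : psi (y * z) = psi y * psi z by rewrite /psi phiM epsM.
have psi_reg y : u * psi y = 0 -> y = 0 by move/(eps_reg uM u0)/phi_inj.
have psiD y z : psi (y + z) = psi y + psi z by rewrite /psi phiD raddfD.
have psi0 : psi 0 = 0 by apply: (addrI (psi 0)); rewrite -psiD !addr0.
have psiN y : psi (- y) = - psi y by apply/eqP; rewrite -addr_eq0 -psiD addNr psi0.
have psiJ y : sigma (psi y) * u = u * psi (qconj y) by rewrite /psi th phiJ.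
have exq s : exists q, sigma (x s) * x s = u * psi q.
  have [t ->] := uepsM _ (memM (xV s) (xV s)); have [q <-] := phi_surj t.
  by exists q.
have [q hq] := choice exq.
have pq s : pure (q s).
  apply: pureP => //; apply/eqP; rewrite -addr_eq0; apply/eqP/psi_reg.
  have := congr1 sigma (hq s); rewrite sigmaM sigmaK hq sigmaM su mulrN psiJ => e'.
  by rewrite psiD mulrDr e' addrN.
have q0 s : q s != 0.
  by apply: contraNneq (x0 s) => e'; apply/eqP/noiso; rewrite hq e' psi0 mulr0.
have [c [s cs] hc] := diag_isotropic two0 I3 dv un un2 pq q0.
have sx t : sigma (x t) * (\sum_s x s * psi (c s)) = u * psi (q t * c t).
  rewrite mulr_sumr (bigD1 t) //= big1 => [|s' s't].
    by rewrite addr0 mulrA hq psiM mulrA.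
  by rewrite mulrA orth ?mul0r // eq_sym.
have a0 : \sum_s x s * psi (c s) = 0.
  apply: noiso; rewrite sigma_sum mulr_suml.
  have -> : \sum_i sigma (x i * psi (c i)) * (\sum_s x s * psi (c s)) =
      u * psi (\sum_s qconj (c s) * q s * c s).
    rewrite (big_morph _ psiD psi0) mulr_sumr; apply: eq_bigr => t _.
    by rewrite sigmaM -mulrA sx mulrA psiJ -mulrA -psiM mulrA.
  by rewrite hc psi0 mulr0.
have := sx s; rewrite a0 mulr0 => /esym/psi_reg qc0; case/eqP: cs.
have nq := nrd_neq0 dv (q0 s).
by rewrite -[c s]mul1r -(qinv_mul nq) -mulrA qc0 mulr0.
Qed.
End Quaternionic.
End Descent.

Lemma I3_zero_of_ideal (F : fieldType) :
  (forall w : witt_ring F, ideal_power (@fundamental_ideal F) 3 w -> w = 0) -> I3_zero F.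
Proof.
move=> I3 x y z x0 y0 z0; apply: I3.
have pfI (u : F) : u != 0 -> fundamental_ideal (pf u).
  move=> u0; have gu : good ((- u)%:M : 'M[F]_1) by rewrite good1 oppr_eq0.
  have [g [dg _ cg]] := mcl_good gu.
  exists (dsum_form (one_form F) g); rewrite /= dg; split=> //.
  by rewrite witt_classD witt_class1 -cg -/(qcl _) qclN.
exists [:: [tuple pf x; pf y; pf z]]; split=> [t|].
  by rewrite inE => /eqP-> w; rewrite !inE => /or3P[] /eqP->; apply: pfI.
by rewrite big_seq1 /= !big_cons big_nil mulr1 mulrA.
Qed.

Section Corner.
Variables (F : fieldType) (A D : falgType F) (r : nat) (g : {rmorphism A -> 'M[D]_r.+1}).
Hypothesis bijg : bijective g.
Hypothesis linearg : forall (c : F) (a : A), g (c *: a) = map_mx ( *:%R c) (g a).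

Definition corner_mx (d : D) : 'M[D]_r.+1 :=
  \matrix_(i, j) (if (i == 0) && (j == 0) then d else 0).

Lemma corner_mxE (M : 'M[D]_r.+1) : corner_mx 1 * M * corner_mx 1 = corner_mx (M 0 0).
Proof.
apply/matrixP => i j; rewrite !mxE (bigD1 0) //= big1 => [|l l0]; last first.
  by rewrite [X in _ * X]mxE (negPf l0) mulr0.
rewrite addr0 !mxE eqxx /= (bigD1 0) //= big1 => [|l l0]; last first.
  by rewrite !mxE (negPf l0) andbF mul0r.
rewrite addr0 !mxE eqxx andbT.
by case: (i == 0); case: (j == 0); rewrite ?mul1r ?mul0r ?mulr1 ?mulr0.
Qed.

(** The embedding of D at the first diagonal entry is not unital; its image is e A e. *)
Lemma corner_embedding : exists eps : {linear D -> A},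
  [/\ {morph eps : x y / x * y}, injective eps
    & forall y, exists d, eps 1 * y * eps 1 = eps d].
Proof.
have [h gK hK] := bijg; have g_inj := can_inj gK.
pose em d := h (corner_mx d); have gem d : g (em d) = corner_mx d by rewrite hK.
have em_lin : linear em.
  move=> c x y; apply: g_inj; rewrite rmorphD linearg !gem.
  by apply/matrixP => i j; rewrite !mxE; case: ifP => // _; rewrite scaler0 addr0.
have emM : {morph em : x y / x * y}.
  move=> x y; apply: g_inj; rewrite rmorphM !gem; apply/matrixP => i j.
  rewrite !mxE (bigD1 0) //= big1 => [|l l0]; last by rewrite !mxE (negPf l0) andbF mul0r.
  rewrite addr0 !mxE eqxx andbT.
  by case: (i == 0); case: (j == 0); rewrite ?mul0r ?mulr0.
pose eps : {linear D -> A} := HB.pack em (GRing.isLinear.Build F D A *:%R em em_lin).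
exists eps; split=> // [x y /(congr1 g)|y].
  by rewrite !gem => /matrixP/(_ 0 0); rewrite !mxE eqxx.
by exists (g y 0 0); apply: g_inj; rewrite !rmorphM !gem corner_mxE.
Qed.
End Corner.

Theorem theorem5p6 (F : fieldType) (k : nat) (A : falgType F) (m : nat) :
  2%N \notin [pchar F] ->
  (forall w : witt_ring F, ideal_power (@fundamental_ideal F) 3 w -> w = 0) ->
  (forall K : fieldExtType F, (\dim {:K} <= 2)%N -> u_invariant_le K (4 * k)%N) ->
  central_simple A ->
  has_index A m -> (m <= 2)%N ->
  (4 * k + 2 < degree A)%N ->
  forall sigma : A -> A, orthogonal_involution sigma -> isotropic_involution sigma.
Proof.
move=> char2 /I3_zero_of_ideal I3 hu _ [D [r [g [centD divD bijg linearg degD]]]] m2 lt_deg sigma.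
move=> [[sigma_lin sigmaM sigmaK] [L [iota [n [f [B [spl symB unitB adjB]]]]]]].
have two0 : (2 : F) != 0 by move: char2; rewrite inE.
have un : u_invariant_le F (4 * k).
  move=> [d M sM uM] anis; have := hu F^o; rewrite dimvf => /(_ isT).
  by move=> /(_ (@SymForm F^o d M sM uM)); apply.
have un2 : quad_u_bound F (4 * k).
  move=> P nsq; have [K [Q [dK eK]]] := quadext_exists nsq.
  by exists Q; rewrite eK; apply: hu; rewrite dK.
have [eps [epsM eps_inj corner]] := corner_embedding bijg linearg.
apply: contrapT => iso; have noiso x : sigma x * x = 0 -> x = 0.
  by move=> sx; apply: contrapT => /eqP x0; apply: iso; exists x.
have dimA := splitting_dim spl; have dimD := dim_corner_ring spl epsM eps_inj corner.
have ltn : (4 * k + 2 < n)%N by move: lt_deg; rewrite /degree dimA PeanoNat.Nat.sqrt_square.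
move: degD; rewrite /degree dimD -mulnn PeanoNat.Nat.sqrt_square => degD.
have e0 : f (eps 1) != 0.
  apply/eqP => /(splitting_inj spl)/eqP.
  by rewrite -(raddf0 eps) (inj_eq eps_inj) oner_eq0.
move: e0; rewrite -mxrank_eq0 => r0.
(* The rank of f(e) is the degree of D, so the index bound leaves 1 and 2. *)
have [r1|r2] : \rank (f (eps 1)) = 1%N \/ \rank (f (eps 1)) = 2%N.
  by move: m2 r0; rewrite -degD; case: (\rank _) => [|[|[|]]]; auto.
- apply: (split_case spl unitB adjB sigma_lin sigmaM sigmaK epsM eps_inj noiso un _ r1).
  by apply: leq_ltn_trans ltn; apply: leq_addr.
- exact: (quaternion_case two0 spl symB unitB adjB sigma_lin sigmaM sigmaK epsM eps_inj corner
    divD centD noiso r2 I3 un un2 ltn).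
Qed.
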